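(* Let $n\ge 2$ and $0<\alpha<1$. Let $u:\overline{\mathbb{B}_n}\to\mathbb{R}$ be the function defined by \[ u(x):=\sum_{j=1}^\infty \frac{1}{2^{j\alpha}}\,\mathrm{Re}\bigl((x_1+ix_2)^{2^j}\bigr)\quad\text{for all }x=(x_1,\dots,x_n)\in\overline{\mathbb{B}_n}. \] Then $u$ is harmonic in $\mathbb{B}_n$, H\''older continuous with exponent $\alpha$ on $\overline{\mathbb{B}_n}$, does not belong to $C^{0,\alpha+\epsilon}(\overline{\mathbb{B}_n})$ for any $\epsilon>0$, and does not belong to $H^{\sigma+1/2}(\mathbb{B}_n)$ for any $\sigma\ge\alpha+(n-2)/4$.
   Context: $\mathbb{B}_n$ is the open unit ball of $\mathbb{R}^n$ centered at the origin. $C^{0,\beta}$ denotes the space of H\''older continuous functions with exponent $\beta$. $H^s$ denotes the usual $L^2$-based Sobolev space of (possibly fractional) order $s$. *)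

(* Defs.v *)
From HB Require Import structures.
From mathcomp Require Import all_boot all_order all_algebra.
From mathcomp Require Import all_classical all_reals all_analysis.
From mathcomp Require Import complex.

Set Implicit Arguments.
Unset Strict Implicit.
Unset Printing Implicit Defensive.

Import Order.TTheory GRing.Theory Num.Theory.
Import numFieldNormedType.Exports.

Local Open Scope classical_set_scope.
Local Open Scope ring_scope.

(* The library norm on 'rV[R]_n is the sup norm. *)
Definition enorm (R : realType) (n : nat) (x : 'rV[R]_n) : R :=
  Num.sqrt (\sum_(i < n) x 0 i ^+ 2).

Definition unit_ball (R : realType) (n : nat) : set 'rV[R]_n :=
  [set x | enorm x < 1].

Definition closed_unit_ball (R : realType) (n : nat) : set 'rV[R]_n :=
  [set x | enorm x <= 1].

Arguments unit_ball : clear implicits.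
Arguments closed_unit_ball : clear implicits.

(* partials [:: i1; ...; im] f is the iterated partial derivative
   d_i1 (... (d_im f)); it is only meaningful where these derivatives exist. *)
Fixpoint partials (R : realType) (n : nat) (s : seq 'I_n)
    (f : 'rV[R]_n -> R) : 'rV[R]_n -> R :=
  if s is i :: s' then 'D_(delta_mx 0 i) (partials s' f) else f.

Definition Ck_on (R : realType) (n k : nat) (Omega : set 'rV[R]_n)
    (f : 'rV[R]_n -> R) : Prop :=
  forall (s : seq 'I_n) (x : 'rV[R]_n), (size s <= k)%N -> Omega x ->
    {for x, continuous (partials s f)} /\
    ((size s < k)%N ->
       forall i : 'I_n, derivable (partials s f) x (delta_mx 0 i)).

Definition laplacian (R : realType) (n : nat) (f : 'rV[R]_n -> R)
    (x : 'rV[R]_n) : R :=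
  \sum_(i < n) partials [:: i; i] f x.

Definition harmonic_on (R : realType) (n : nat) (Omega : set 'rV[R]_n)
    (f : 'rV[R]_n -> R) : Prop :=
  Ck_on 2 Omega f /\ forall x, Omega x -> laplacian f x = 0.

Definition holder_on (R : realType) (n : nat) (beta : R) (A : set 'rV[R]_n)
    (f : 'rV[R]_n -> R) : Prop :=
  exists C : R, forall x y : 'rV[R]_n, A x -> A y ->
    `|f x - f y| <= C * enorm (x - y) `^ beta.

Section lebesgue_tuple.
Context (R : realType).

Definition cons_pair (n : nat)
    (p : measurableTypeR R * n.-tuple (measurableTypeR R)) :
    n.+1.-tuple (measurableTypeR R) := [tuple of p.1 :: p.2].

Definition uncons_pair (n : nat) (t : n.+1.-tuple (measurableTypeR R)) :
    measurableTypeR R * n.-tuple (measurableTypeR R) :=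
  (thead t, [tuple of behead t]).

Lemma cons_pairK n : cancel (@uncons_pair n) (@cons_pair n).
Proof. by move=> t; rewrite /cons_pair/= -tuple_eta. Qed.

Lemma uncons_pairK n : cancel (@cons_pair n) (@uncons_pair n).
Proof.
by case=> x t; rewrite /uncons_pair /cons_pair theadE/=; congr pair; exact: val_inj.
Qed.

Lemma measurable_cons_pair n : measurable_fun [set: _] (@cons_pair n).
Proof. by apply: measurable_cons. Qed.

Lemma measurable_uncons_pair n : measurable_fun [set: _] (@uncons_pair n).
Proof.
apply: measurable_fun_pair; last exact: measurable_behead.
exact: (@measurable_tnth _ (measurableTypeR R) n.+1 ord0).
Qed.

Section cons.
Variables (n : nat)
  (m : {sigma_finite_measure set (n.-tuple (measurableTypeR R)) -> \bar R}).

Definition lebesgue_cons : set (n.+1.-tuple (measurableTypeR R)) -> \bar R :=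
  pushforward (lebesgue_measure \x m)%E (@cons_pair n).

HB.instance Definition _ := Measure.copy lebesgue_cons
  (measure_function_pushforward__canonical__measure_function_Measure
     (lebesgue_measure \x m)%E (@measurable_cons_pair n)).

Let sigma_finite_lebesgue_cons : sigma_finite setT lebesgue_cons.
Proof.
have /sigma_finiteP[F [TF ndF Foo]] := sigma_finiteT (@lebesgue_measure R).
have /sigma_finiteP[G [TG ndG Goo]] := sigma_finiteT m.
exists (fun k => @uncons_pair n @^-1` (F k `*` G k)) => [|k].
  rewrite -preimage_bigcup (_ : \bigcup_k _ = setT) ?preimage_setT//.
  rewrite -setXTT TF TG predeqE => -[x y]; split; last first.
    move=> [/= [i _ Fix] [j _ Gjy]]; exists (maxn i j) => //; split.
    - by move: x Fix; exact/subsetPset/ndF/leq_maxl.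
    - by move: y Gjy; exact/subsetPset/ndG/leq_maxr.
  by move=> [i _ []/= ? ?]; split; exists i.
have [mF Fk] := Foo k; have [mG Gk] := Goo k.
split.
  by rewrite -[X in measurable X]setTI; apply: measurable_uncons_pair => //;
    exact: measurableX.
rewrite /lebesgue_cons /pushforward -comp_preimage.
rewrite (_ : _ \o _ = id) ?preimage_id; last first.
  by apply/funext => p; exact: uncons_pairK.
by rewrite product_measure1E// lte_mul_pinfty// ge0_fin_numE.
Qed.

HB.instance Definition _ := @Measure_isSigmaFinite.Build _ _ _ lebesgue_cons
  sigma_finite_lebesgue_cons.

End cons.

Fixpoint lebesgue_tuple (n : nat) :
    {sigma_finite_measure set (n.-tuple (measurableTypeR R)) -> \bar R} :=
  match n with
  | 0 => \d_[tuple]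
  | n'.+1 => lebesgue_cons (lebesgue_tuple n')
  end.

Lemma lebesgue_tuple_box n (A : 'I_n -> set (measurableTypeR R)) :
  (forall i, measurable (A i)) ->
  lebesgue_tuple n [set t | forall i, A i (tnth t i)] =
  (\prod_(i < n) lebesgue_measure (A i))%E.
Proof.
elim: n A => [|n IHn] A mA.
  rewrite big_ord0 /= diracE mem_set//= => -[]//.
rewrite big_ord_recl /= /lebesgue_cons /pushforward -(IHn (A \o lift ord0)); last first.
  by move=> i; exact: mA.
rewrite -product_measure1E//; last first.
  rewrite (_ : [set t | _] = \bigcap_(i in [set: 'I_n])
      ((@tnth n (measurableTypeR R))^~ i @^-1` (A (lift ord0 i)))).
    apply: fin_bigcap_measurable => //= i _.
    by rewrite -[X in measurable X]setTI; exact: measurable_tnth.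
  by apply/seteqP; split=> [t At i _|t At i]; [exact: At|exact: (At i Logic.I)].
congr (_ _); apply/seteqP; split => [[x t]/= At|[x t]/= [Ax At] i].
- split; first by have := At ord0.
  by move=> i; have := At (lift ord0 i); rewrite tnthS.
- by have [j ->|->] := unliftP ord0 i; rewrite ?tnthS.
Qed.

End lebesgue_tuple.

Definition row_of (R : realType) (n : nat)
    (t : n.-tuple (measurableTypeR R)) : 'rV[R]_n := \row_i tnth t i.

(* Omega, a subset of R^n, seen as a set of tuples; likewise a function on R^n
   is integrated after composition with row_of. *)
Definition tuples_of (R : realType) (n : nat) (Omega : set 'rV[R]_n) :
    set (n.-tuple (measurableTypeR R)) := @row_of R n @^-1` Omega.

Definition L2_on (R : realType) (n : nat) (Omega : set 'rV[R]_n)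
    (g : 'rV[R]_n -> R) : Prop :=
  measurable_fun (tuples_of Omega) (g \o @row_of R n) /\
  (\int[lebesgue_tuple R n]_(t in tuples_of Omega)
     (g (row_of t) ^+ 2)%:E < +oo)%E.

Definition test_function (R : realType) (n : nat) (Omega : set 'rV[R]_n)
    (phi : 'rV[R]_n -> R) : Prop :=
  (forall k : nat, Ck_on k setT phi) /\
  compact (closure [set x | phi x != 0]) /\
  closure [set x | phi x != 0] `<=` Omega.

(* g is the weak derivative d_i1 ... d_im f on Omega, for s = [:: i1; ...; im]. *)
Definition weak_partials (R : realType) (n : nat) (Omega : set 'rV[R]_n)
    (s : seq 'I_n) (f g : 'rV[R]_n -> R) : Prop :=
  forall phi : 'rV[R]_n -> R, test_function Omega phi ->
    (\int[lebesgue_tuple R n]_(t in tuples_of Omega)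
       (f (row_of t) * partials s phi (row_of t))%:E =
     ((-1) ^+ size s)%:E *
     \int[lebesgue_tuple R n]_(t in tuples_of Omega)
       (g (row_of t) * phi (row_of t))%:E)%E.

Definition gagliardo (R : realType) (n : nat) (theta : R)
    (Omega : set 'rV[R]_n) (g : 'rV[R]_n -> R) : \bar R :=
  (\int[lebesgue_tuple R n \x lebesgue_tuple R n]_(p in
      tuples_of Omega `*` tuples_of Omega)
     ((g (row_of p.1) - g (row_of p.2)) ^+ 2 /
      enorm (row_of p.1 - row_of p.2) `^ (n%:R + 2 * theta))%:E)%E.

(* The L^2-based Sobolev (Sobolev-Slobodeckij) space H^s(Omega), s >= 0: with
   k the integer part of s, all weak derivatives of order at most k are in
   L^2(Omega) and, when s is not an integer, those of order k have finite
   Gagliardo seminorm of order s - k. *)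
Definition in_Hs (R : realType) (n : nat) (s : R) (Omega : set 'rV[R]_n)
    (f : 'rV[R]_n -> R) : Prop :=
  L2_on Omega f /\
  forall I : seq 'I_n, (size I <= Num.truncn s)%N ->
    exists g : 'rV[R]_n -> R,
      [/\ L2_on Omega g,
          weak_partials Omega I f g
        & size I = Num.truncn s -> 0 < s - (Num.truncn s)%:R ->
          (gagliardo (s - (Num.truncn s)%:R) Omega g < +oo)%E].

(* The terms and the sum of the series; x_1 and x_2 are the coordinates of
   index 0 and 1. *)
Definition lacunary_term (R : realType) (n : nat) (hn : (1 < n)%N) (alpha : R)
    (x : 'rV[R]_n) (j : nat) : R :=
  (2 `^ (j%:R * alpha))^-1 *
  complex.Re ((x 0 (Ordinal (ltnW hn)) +i* x 0 (Ordinal hn))%C ^+ (2 ^ j)).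

Definition lacunary (R : realType) (n : nat) (hn : (1 < n)%N) (alpha : R)
    (x : 'rV[R]_n) : R :=
  limn (fun N => \sum_(1 <= j < N) lacunary_term hn alpha x j).

(* The value of lacunary outside the closed unit ball, where the series may
   diverge, is irrelevant; on the closed unit ball the series converges. *)
Lemma is_cvg_lacunary (R : realType) (n : nat) (hn : (1 < n)%N) (alpha : R)
    (x : 'rV[R]_n) : 0 < alpha -> closed_unit_ball R n x ->
  cvgn (fun N => \sum_(1 <= j < N) lacunary_term hn alpha x j).
Proof.
move=> alpha0 xB.
set z := (x 0 (Ordinal (ltnW hn)) +i* x 0 (Ordinal hn))%C.
have z1 : `|z| <= 1.
  rewrite normc_def lecR.
  apply: le_trans xB; rewrite /enorm ler_wsqrtr//.
  rewrite (bigD1 (Ordinal (ltnW hn)))//= (bigD1 (Ordinal hn))//= addrA lerDl.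
  by apply: sumr_ge0 => i _; exact: sqr_ge0.
have Rez m : `|complex.Re (z ^+ m)| <= 1.
  rewrite -lecR (le_trans (normc_ge_Re _))// normrX.
  exact: exprn_ile1.
set q := (2 `^ alpha)^-1 : R.
have q0 : 0 < q by rewrite invr_gt0 powR_gt0.
have q1 : q < 1.
  rewrite invf_lt1 ?powR_gt0//.
  have := @gt0_ltr_powR R alpha alpha0 1 2.
  by rewrite powR1; apply; rewrite ?nnegrE// ltr1n.
have tq j : `|lacunary_term hn alpha x j| <= geometric 1 q j.
  rewrite /lacunary_term normrM mulrC /geometric/= mul1r mulrC.
  rewrite -[leRHS]mulr1 ler_pM// mulrC powRrM powR_mulrn ?powR_ge0//.
  by rewrite -exprVn ger0_norm// exprn_ge0// ltW.
rewrite (is_cvg_series_restrict 1 (lacunary_term hn alpha x)).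
apply: normed_cvg; apply: (series_le_cvg _ _ tq) => //= [j|].
  by rewrite mul1r exprn_ge0// ltW.
by apply: is_cvg_geometric_series; rewrite gtr0_norm.
Qed.

(* Main.v *)
(* With z = x_1 + i x_2, the function u is the real part of a power series in z of
   radius of convergence 1, hence harmonic.  For the modulus of continuity at scale
   d one splits the series at 2^J ~ 1/d; the points (1, 0) and (1 - 2^-J, 0) show
   that alpha is optimal, since there all terms of the difference have one sign.

   For the last claim, put s = sigma + 1/2 >= alpha + n/4 and k = floor(s).
   Integration by parts against product test functions identifies any weak
   derivative d_1^k u with the termwise derivative f = Re \sum_j a_j z^(m_j), where
   m_j = 2^j - k.  Let omega^(2^(M+1)) = -1.  Rotating the variable z by the powers
   of omega preserves the Lebesgue measure of the ball, and the terms with index in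
   [k+2, M] are orthogonal, along an orbit, to one another and to all other terms.
   Averaging over the orbit therefore bounds the L^2 energy (s = k) or the Gagliardo
   energy (s > k) of f below by half the sum of the energies of these terms.  Each
   of them is at least a constant independent of j, as one sees on a shell at
   distance about 2^-j from the sphere, and M is arbitrary. *)

Require Import Defs.
From mathcomp Require Import all_boot all_order all_algebra.
From mathcomp Require Import all_classical all_reals all_analysis.
From mathcomp Require Import measurable_realfun complex ring lra zify.

Set Implicit Arguments.
Unset Strict Implicit.
Unset Printing Implicit Defensive.

Import Order.TTheory GRing.Theory Num.Theory.
Import numFieldNormedType.Exports.
Import Normc.
Local Open Scope classical_set_scope.
Local Open Scope ring_scope.

Local Notation Re := complex.Re.
Local Notation Im := complex.Im.

(** * Lacunary power series *)

Section BoundedSeries.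
Variable R : realType.

Lemma bounded_series_cvg (a b : nat -> R) (B : R) :
  (forall j, `|a j| <= b j) -> (forall N, \sum_(1 <= j < N) b j <= B) ->
  cvgn (fun N => \sum_(1 <= j < N) a j).
Proof.
move=> ab bB.
have b0 j : 0 <= b j by apply: le_trans (ab j).
have cb : cvgn (fun N => \sum_(1 <= j < N) b j).
  apply: nondecreasing_is_cvgn; last by exists B => _ [N _ <-].
  move=> M N MN; case: M MN => [|M] MN.
    by rewrite big_geq// sumr_ge0.
  by rewrite (@big_cat_nat _ _ _ M.+1 1 N)//= lerDl sumr_ge0.
rewrite (is_cvg_series_restrict 1 a).
apply: normed_cvg; apply: (series_le_cvg _ b0 ab) => //.
by rewrite -(is_cvg_series_restrict 1 b).
Qed.

Lemma bounded_series_lim (a b : nat -> R) (B : R) :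
  (forall j, `|a j| <= b j) -> (forall N, \sum_(1 <= j < N) b j <= B) ->
  `|limn (fun N => \sum_(1 <= j < N) a j)| <= B.
Proof.
move=> ab bB; have ca := bounded_series_cvg ab bB.
have aB N : `|\sum_(1 <= j < N) a j| <= B.
  by rewrite (le_trans (ler_norm_sum _ _ _))// (le_trans _ (bB N))// ler_sum.
rewrite ler_norml limr_ge ?limr_le//; apply: nearW => N;
  by have /(_ N) := aB; rewrite ler_norml => /andP[].
Qed.

Lemma cvg_seriesZ (k : R) (a : nat -> R) l :
  (fun N => \sum_(1 <= j < N) a j) @ \oo --> l ->
  (fun N => \sum_(1 <= j < N) (k * a j)) @ \oo --> k * l.
Proof.
move=> ca; rewrite (_ : (fun N => _) = (fun N => k * \sum_(1 <= j < N) a j)).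
  exact: cvgMl_tmp.
by apply/funext => N; rewrite -mulr_sumr.
Qed.

Lemma cvg_seriesD (a b : nat -> R) l l' :
  (fun N => \sum_(1 <= j < N) a j) @ \oo --> l ->
  (fun N => \sum_(1 <= j < N) b j) @ \oo --> l' ->
  (fun N => \sum_(1 <= j < N) (a j + b j)) @ \oo --> l + l'.
Proof.
move=> ca cb; rewrite (_ : (fun N => _) = (fun N => \sum_(1 <= j < N) a j +
  \sum_(1 <= j < N) b j)); first exact: cvgD.
by apply/funext => N; rewrite big_split.
Qed.

End BoundedSeries.

Section ComplexPowers.
Variable R : rcfType.
Implicit Types z w h : R[i].

Lemma normcX z m : normc (z ^+ m) = normc z ^+ m.
Proof.
by elim: m => [|m IH]; rewrite ?expr0 ?normc1// !exprS normcM IH.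
Qed.

Lemma normc_ge0 z : 0 <= normc z.
Proof. by case: z => a b; exact: sqrtr_ge0. Qed.

Lemma normc_natM m z : normc (m%:R * z) = m%:R * normc z.
Proof. by rewrite mulr_natl normcMn mulr_natl. Qed.

Lemma Re_le_normc z : `|Re z| <= normc z.
Proof. by case: z => a b /=; rewrite -sqrtr_sqr ler_wsqrtr// lerDl sqr_ge0. Qed.

Lemma Im_le_normc z : `|Im z| <= normc z.
Proof. by case: z => a b /=; rewrite -sqrtr_sqr ler_wsqrtr// lerDr sqr_ge0. Qed.

Lemma expr_taylor1 z h m (rho : R) :
  normc z <= rho -> normc (z + h) <= rho ->
  normc ((z + h) ^+ m - z ^+ m - m%:R * (h * z ^+ m.-1)) <=
    m%:R * (m.-1)%:R * rho ^+ m.-2 * normc h ^+ 2.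
Proof.
move=> zr zhr; have rho0 : 0 <= rho by apply: le_trans zr; exact: normc_ge0.
have h20 : 0 <= normc h ^+ 2 by rewrite exprn_ge0// normc_ge0.
elim: m => [|m IH].
  by rewrite !expr0 subrr !mul0r subr0 normc0.
have -> : (z + h) ^+ m.+1 - z ^+ m.+1 - (m.+1)%:R * (h * z ^+ m) =
  (z + h) * ((z + h) ^+ m - z ^+ m - m%:R * (h * z ^+ m.-1)) +
  m%:R * (h ^+ 2 * z ^+ m.-1).
  by case: m {IH} => [|m]; rewrite /= ?exprS; ring.
apply: le_trans (le_normcD _ _) _; rewrite normcM normc_natM normcM !normcX.
apply: (@le_trans _ _ (rho * (m%:R * m.-1%:R * rho ^+ m.-2 * normc h ^+ 2) +
   m%:R * (normc h ^+ 2 * rho ^+ m.-1))).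
  apply: lerD; first by rewrite ler_pM ?normc_ge0.
  by rewrite ler_wpM2l// ler_wpM2l// lerXn2r ?nnegrE ?normc_ge0.
case: m {IH} => [|m] /=; first by rewrite mulr0n !(mul0r, mulr0) addr0.
have -> : rho * (m.+1%:R * m%:R * rho ^+ m.-1 * normc h ^+ 2) =
  m.+1%:R * m%:R * rho ^+ m * normc h ^+ 2.
  by case: m => [|m] /=; rewrite ?exprS; ring.
rewrite (_ : _ + _ = m.+1%:R * m.+1%:R * rho ^+ m * normc h ^+ 2); last by ring.
by rewrite ler_wpM2r// ler_wpM2r ?exprn_ge0// ler_wpM2r// ler_nat.
Qed.

Lemma normc_subX z w m (rho : R) : normc z <= rho -> normc w <= rho ->
  normc (z ^+ m - w ^+ m) <= m%:R * rho ^+ m.-1 * normc (z - w).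
Proof.
move=> zr wr; have rho0 : 0 <= rho by apply: le_trans zr; exact: normc_ge0.
elim: m => [|m IH]; first by rewrite !expr0 subrr normc0 !mul0r.
have -> : z ^+ m.+1 - w ^+ m.+1 = z * (z ^+ m - w ^+ m) + (z - w) * w ^+ m.
  by rewrite !exprS; ring.
apply: le_trans (le_normcD _ _) _; rewrite !normcM normcX.
apply: (@le_trans _ _ (rho * (m%:R * rho ^+ m.-1 * normc (z - w)) +
   normc (z - w) * rho ^+ m)).
  apply: lerD; first by rewrite ler_pM ?normc_ge0.
  by rewrite ler_wpM2l ?normc_ge0// lerXn2r ?nnegrE ?normc_ge0.
by case: m {IH} => [|m] /=; rewrite ?exprS; lra.
Qed.

End ComplexPowers.

Section PowerSeries.
Variable R : realType.
Implicit Types (c : nat -> R) (e : nat -> nat) (z h : R[i]).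

(* A pair (c, e) stands for the power series \sum_(j >= 1) c_j z^(e_j). *)
Definition psre c e z := limn (fun N => \sum_(1 <= j < N) (c j * Re (z ^+ e j))).
Definition psim c e z := limn (fun N => \sum_(1 <= j < N) (c j * Im (z ^+ e j))).

Definition radius1 c e := forall rho : R, 0 <= rho < 1 ->
  exists B, forall N, \sum_(1 <= j < N) (`|c j| * rho ^+ e j) <= B.

Definition dcoef c e j : R := (e j)%:R * c j.
Definition dexpo e j : nat := (e j).-1.

Lemma exprn_convex (a b : R) m : 0 <= a -> a <= b ->
  m%:R * a ^+ m.-1 * (b - a) <= b ^+ m - a ^+ m.
Proof.
move=> a0 ab; have b0 := le_trans a0 ab.
elim: m => [|m IH]; first by rewrite !mul0r !expr0 subrr.
have -> : b ^+ m.+1 - a ^+ m.+1 = b * (b ^+ m - a ^+ m) + (b - a) * a ^+ m.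
  by rewrite !exprS; ring.
have : a * (m%:R * a ^+ m.-1 * (b - a)) <= b * (b ^+ m - a ^+ m).
  by rewrite ler_pM// mulr_ge0 ?subr_ge0// mulr_ge0 ?exprn_ge0.
by case: m {IH} => [|m] /=; rewrite ?exprS; lra.
Qed.

Lemma radius1_diff c e : radius1 c e -> radius1 (dcoef c e) (dexpo e).
Proof.
move=> ce rho /andP[r0 r1].
have r'1 : 0 <= (1 + rho) / 2 < 1 by apply/andP; split; lra.
have [B cB] := ce _ r'1; exists (((1 + rho) / 2 - rho)^-1 * B) => N.
have d0 : 0 < (1 + rho) / 2 - rho by lra.
apply: le_trans (_ : ((1 + rho) / 2 - rho)^-1 *
  \sum_(1 <= j < N) (`|c j| * ((1 + rho) / 2) ^+ e j) <= _); last first.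
  by rewrite ler_pM2l ?invr_gt0.
rewrite mulr_sumr ler_sum// => j _.
rewrite ler_pdivlMl// /dcoef /dexpo normrM normr_nat.
rewrite [leLHS](_ : _ = `|c j| * ((e j)%:R * rho ^+ (e j).-1 * ((1 + rho) / 2 - rho)));
  last by ring.
rewrite ler_wpM2l//.
have := @exprn_convex rho ((1 + rho) / 2) (e j) r0.
have := exprn_ge0 (e j) r0; lra.
Qed.

Lemma ps_cvg c e z : radius1 c e -> normc z < 1 ->
  cvgn (fun N => \sum_(1 <= j < N) (c j * Re (z ^+ e j))) /\
  cvgn (fun N => \sum_(1 <= j < N) (c j * Im (z ^+ e j))).
Proof.
move=> ce z1; have [|B cB] := ce (normc z); first by rewrite normc_ge0.
split; apply: (bounded_series_cvg _ cB) => j; rewrite normrM -normcX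
 ler_wpM2l//; [exact: Re_le_normc|exact: Im_le_normc].
Qed.

Lemma ReM z h : Re (z * h) = Re z * Re h - Im z * Im h.
Proof. by case: z; case: h. Qed.

Lemma ImM z h : Im (z * h) = Re z * Im h + Im z * Re h.
Proof. by case: z; case: h => a b d f /=; rewrite addrC. Qed.

Lemma ReD z h : Re (z + h) = Re z + Re h.
Proof. by case: z; case: h. Qed.

Lemma ImD z h : Im (z + h) = Im z + Im h.
Proof. by case: z; case: h. Qed.

Lemma ReN z : Re (- z) = - Re z.
Proof. by case: z. Qed.

Lemma ImN z : Im (- z) = - Im z.
Proof. by case: z. Qed.

Lemma Re_natM m z : Re (m%:R * z) = m%:R * Re z.
Proof. by elim: m => [|m IH]; rewrite ?mul0r// -addn1 !natrD !mulrDl ReD IH !mul1r. Qed.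

Lemma Im_natM m z : Im (m%:R * z) = m%:R * Im z.
Proof. by elim: m => [|m IH]; rewrite ?mul0r// -addn1 !natrD !mulrDl ImD IH !mul1r. Qed.

Definition ReIm := (Re_natM, Im_natM, ReM, ImM, ReD, ImD, ReN, ImN).

Lemma ps_taylor c e (rho : R) : radius1 c e -> 0 <= rho < 1 ->
  exists B : R, forall z h, normc z <= rho -> normc (z + h) <= rho ->
    `|psre c e (z + h) - psre c e z - (Re h * psre (dcoef c e) (dexpo e) z
        - Im h * psim (dcoef c e) (dexpo e) z)| <= B * normc h ^+ 2 /\
    `|psim c e (z + h) - psim c e z - (Re h * psim (dcoef c e) (dexpo e) z
        + Im h * psre (dcoef c e) (dexpo e) z)| <= B * normc h ^+ 2.
Proof.
move=> ce rho01; have ce' := radius1_diff ce; have ce'' := radius1_diff ce'.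
have [B cB] := ce'' _ rho01; exists B => z h zr zhr.
have /andP[rho0 rho1] := rho01.
have [cz1 cz2] := ps_cvg ce (le_lt_trans zr rho1).
have [ch1 ch2] := ps_cvg ce (le_lt_trans zhr rho1).
have [cd1 cd2] := ps_cvg ce' (le_lt_trans zr rho1).
have cB' N : \sum_(1 <= j < N) (`|dcoef (dcoef c e) (dexpo e) j| *
   rho ^+ (dexpo (dexpo e)) j * normc h ^+ 2) <= B * normc h ^+ 2.
  by rewrite -mulr_suml ler_wpM2r ?exprn_ge0// normc_ge0.
have key j : normc ((c j)%:C%C * ((z + h) ^+ e j - z ^+ e j -
    (e j)%:R * (h * z ^+ (e j).-1)))
    <= `|dcoef (dcoef c e) (dexpo e) j| * rho ^+ (dexpo (dexpo e)) j * normc h ^+ 2.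
  have nC (x : R) : normc x%:C%C = `|x| by rewrite /= expr0n addr0 sqrtr_sqr.
  rewrite normcM nC /dcoef !normrM !normr_nat.
  apply: le_trans (ler_wpM2l _ (expr_taylor1 (e j) zr zhr)) _ => //.
  by rewrite /dexpo; lra.
split.
- pose a j := c j * Re ((z + h) ^+ e j) + (-1) * (c j * Re (z ^+ e j)) +
     (-1) * (Re h * (dcoef c e j * Re (z ^+ dexpo e j)) +
      (-1) * (Im h * (dcoef c e j * Im (z ^+ dexpo e j)))).
  have aE j : a j = Re ((c j)%:C%C * ((z + h) ^+ e j - z ^+ e j -
    (e j)%:R * (h * z ^+ (e j).-1))).
    by rewrite /a /dcoef /dexpo !ReIm /=; ring.
  rewrite (_ : _ - _ = limn (fun N => \sum_(1 <= j < N) a j)).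
    by apply: (bounded_series_lim _ cB') => j; rewrite aE;
      exact: le_trans (Re_le_normc _) (key j).
  have L := (cvg_seriesD (cvg_seriesD ch1 (cvg_seriesZ (k := -1) cz1))
    (cvg_seriesZ (k := -1) (cvg_seriesD (cvg_seriesZ (k := Re h) cd1)
      (cvg_seriesZ (k := -1) (cvg_seriesZ (k := Im h) cd2))))).
  by rewrite !mulN1r in L; exact: esym (cvg_lim (@Rhausdorff R) L).
- pose a j := c j * Im ((z + h) ^+ e j) + (-1) * (c j * Im (z ^+ e j)) +
     (-1) * (Re h * (dcoef c e j * Im (z ^+ dexpo e j)) +
       (Im h * (dcoef c e j * Re (z ^+ dexpo e j)))).
  have aE j : a j = Im ((c j)%:C%C * ((z + h) ^+ e j - z ^+ e j -
    (e j)%:R * (h * z ^+ (e j).-1))).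
    by rewrite /a /dcoef /dexpo !ReIm /=; ring.
  rewrite (_ : _ - _ = limn (fun N => \sum_(1 <= j < N) a j)).
    by apply: (bounded_series_lim _ cB') => j; rewrite aE;
      exact: le_trans (Im_le_normc _) (key j).
  have L := (cvg_seriesD (cvg_seriesD ch2 (cvg_seriesZ (k := -1) cz2))
    (cvg_seriesZ (k := -1) (cvg_seriesD (cvg_seriesZ (k := Re h) cd2)
      (cvg_seriesZ (k := Im h) cd1)))).
  by rewrite !mulN1r in L; exact: esym (cvg_lim (@Rhausdorff R) L).
Qed.

End PowerSeries.

Section Derivatives.
Variables (R : realType) (n : nat).

Lemma is_derive_quadratic (V : normedModType R) (f : V -> R) x v (d delta B : R) : 0 < delta ->
  (forall t, `|t| <= delta -> `|f (t *: v + x) - f x - t * d| <= B * t ^+ 2) ->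
  is_derive x v f d.
Proof.
move=> delta0 fB.
suff : (fun h : R => h^-1 *: ((f \o shift x) (h *: v) - f x)) @ 0^' --> d.
  by move=> fd; split; [apply/cvg_ex; exists d|exact: cvg_lim].
apply/cvgrPdist_le => eps eps0; near=> h.
have h0 : h != 0 by near: h; exact: nbhs_dnbhs_neq.
have hd : `|h| <= delta by near: h; exact: dnbhs0_le.
have hB : `|h| <= eps / (`|B| + 1).
  by near: h; apply: dnbhs0_le; rewrite divr_gt0// ltr_wpDl.
rewrite distrC -[X in _ - X](mulKf h0) -[_ *: _]/(_ * _) -mulrBr normrM normfV /=.
rewrite ler_pdivrMl ?normr_gt0//; apply: le_trans (fB _ hd) _.
rewrite -real_normK ?num_real// expr2 mulrCA ler_wpM2l//.
move: hB; rewrite ler_pdivlMr ?ltr_wpDl//; apply: le_trans.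
by rewrite mulrC ler_wpM2l// (le_trans (ler_norm _))// lerDl.
Unshelve. all: by end_near. Qed.

Lemma Ck_on_closed_class (Omega : set 'rV[R]_n) (P : ('rV[R]_n -> R) -> Prop) :
  (forall f, P f -> forall x, Omega x -> {for x, continuous f} /\
     forall i, derivable f x (delta_mx 0 i)) ->
  (forall f i, P f -> P ('D_(delta_mx 0 i) f)) ->
  forall f k, P f -> Ck_on k Omega f.
Proof.
move=> Pd PD f k Pf s x _ Ox.
have Ps : P (partials s f) by elim: s => //= i s; exact: PD.
by have [? ?] := Pd _ Ps _ Ox.
Qed.

End Derivatives.

Section Plane.
Variables (R : realType) (n : nat) (i0 i1 : 'I_n).
Hypothesis i01 : i0 != i1.
Implicit Types (x y : 'rV[R]_n).

Definition plane x : R[i] := (x 0 i0 +i* x 0 i1)%C.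
Arguments plane : simpl never.

Lemma normc_le_add (a b : R) : normc (a +i* b)%C <= `|a| + `|b|.
Proof.
rewrite /= -[leRHS]ger0_norm ?addr_ge0// -sqrtr_sqr ler_wsqrtr// sqrrD.
by rewrite !real_normK ?num_real// lerD2r lerDl mulrn_wge0// mulr_ge0.
Qed.

Lemma near_plane x (eps : R) : 0 < eps ->
  \forall y \near x, normc (plane y - plane x) < eps.
Proof.
move=> eps0; have e20 : 0 < eps / 2 by rewrite divr_gt0.
near=> y; apply: le_lt_trans (normc_le_add _ _) _.
rewrite [ltRHS]splitr ltrD//; rewrite distrC; near: y.
- by move/cvgrPdist_lt: (@coord_continuous R 1 n 0 i0 x); exact.
- by move/cvgrPdist_lt: (@coord_continuous R 1 n 0 i1 x); exact.
Unshelve. all: by end_near. Qed.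

Definition cylinder : set 'rV[R]_n := [set x | normc (plane x) < 1].

Lemma normc_plane_le x : normc (plane x) <= enorm x.
Proof.
rewrite /plane /enorm /= ler_wsqrtr// (bigD1 i0)//= (bigD1 i1)/= 1?eq_sym//.
by rewrite addrA lerDl sumr_ge0// => i _; exact: sqr_ge0.
Qed.

Lemma unit_ball_cylinder : unit_ball R n `<=` cylinder.
Proof. by move=> x; apply: le_lt_trans (normc_plane_le x). Qed.

Lemma near_cylinder x : cylinder x -> \forall y \near x, cylinder y.
Proof.
move=> x1; have e0 : 0 < 1 - normc (plane x) by rewrite subr_gt0.
near=> y; rewrite /cylinder /mkset -[plane y](subrK (plane x)).
apply: le_lt_trans (le_normcD _ _) _; rewrite -ltrBrDr.
by near: y; exact: near_plane.
Unshelve. all: by end_near. Qed.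

Variables (c : nat -> R) (e : nat -> nat).
Hypothesis ce : radius1 c e.

Lemma is_derive_ps x i : cylinder x ->
  is_derive x (delta_mx 0 i) (psre c e \o plane)
    ((i == i0)%:R * psre (dcoef c e) (dexpo e) (plane x) -
     (i == i1)%:R * psim (dcoef c e) (dexpo e) (plane x)) /\
  is_derive x (delta_mx 0 i) (psim c e \o plane)
    ((i == i0)%:R * psim (dcoef c e) (dexpo e) (plane x) +
     (i == i1)%:R * psre (dcoef c e) (dexpo e) (plane x)).
Proof.
move=> x1; set rho := (1 + normc (plane x)) / 2.
have z0 := normc_ge0 (plane x); rewrite /cylinder /mkset in x1.
have rho01 : 0 <= rho < 1 by rewrite /rho; apply/andP; split; lra.
have [B cB] := ps_taylor ce rho01.
set w := ((i == i0)%:R +i* (i == i1)%:R)%C : R[i].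
have planeD t : plane (t *: delta_mx 0 i + x) = plane x + (t%:C%C * w).
  by rewrite /plane !mxE !eqxx /= !(eq_sym _ i); apply/eqP;
    rewrite eq_complex/=; apply/andP; split; apply/eqP; ring.
have Rw t : Re (t%:C%C * w) = t * (i == i0)%:R by rewrite ReM /= mul0r subr0.
have Iw t : Im (t%:C%C * w) = t * (i == i1)%:R by rewrite ImM /= mul0r addr0.
have w1 : normc w <= 1.
  rewrite /w /= -[leRHS]sqrtr1 ler_wsqrtr//.
  have [->|] := eqVneq i i0; first by rewrite (negbTE i01) expr0n addr0 expr1n.
  by case: (i == i1); rewrite ?expr0n ?expr1n ?addr0 ?add0r.
have nt t : normc (t%:C%C * w) <= `|t|.
  by rewrite normcM /= expr0n addr0 sqrtr_sqr ler_piMr.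
have nt2 t : `|B| * normc (t%:C%C * w) ^+ 2 <= `|B| * t ^+ 2.
  by rewrite ler_wpM2l// -[leRHS]real_normK ?num_real// lerXn2r ?nnegrE// normc_ge0.
have key t : `|t| <= (1 - normc (plane x)) / 2 -> normc (plane x + t%:C%C * w) <= rho.
  move=> th; apply: le_trans (le_normcD _ _) _.
  by apply: le_trans (lerD (lexx _) (nt t)) _; rewrite /rho; lra.
have zr : normc (plane x) <= rho by rewrite /rho; lra.
have d0 : 0 < (1 - normc (plane x)) / 2 by lra.
split; apply: (is_derive_quadratic (B := `|B|) d0) => t td /=; rewrite planeD;
    have [h1 h2] := cB _ _ zr (key _ td); apply: le_trans (nt2 t);
    apply: le_trans (ler_wpM2r _ (ler_norm B)); rewrite ?exprn_ge0 ?normc_ge0//.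
- apply: le_trans h1; rewrite Rw Iw.
  by rewrite (_ : forall u v A A' : R, t * (u * A - v * A') = t * u * A - t * v * A')//;
    move=> *; ring.
- apply: le_trans h2; rewrite Rw Iw.
  by rewrite (_ : forall u v A A' : R, t * (u * A + v * A') = t * u * A + t * v * A')//;
    move=> *; ring.
Qed.

Lemma continuous_ps x : cylinder x ->
  {for x, continuous (psre c e \o plane)} /\ {for x, continuous (psim c e \o plane)}.
Proof.
move=> x1; set rho := (1 + normc (plane x)) / 2.
have z0 := normc_ge0 (plane x); rewrite /cylinder /mkset in x1.
have rho01 : 0 <= rho < 1 by rewrite /rho; apply/andP; split; lra.
have [B cB] := ps_taylor ce rho01.
set A := psre (dcoef c e) (dexpo e) (plane x).
set A' := psim (dcoef c e) (dexpo e) (plane x).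
have zr : normc (plane x) <= rho by rewrite /rho; lra.
suff key f : (forall h, normc (plane x + h) <= rho -> exists a b : R,
    `|f (plane x + h) - f (plane x) - (Re h * a + Im h * b)| <= B * normc h ^+ 2
    /\ `|a| <= `|A| + `|A'| /\ `|b| <= `|A| + `|A'|) ->
    {for x, continuous (f \o plane)}.
  split; apply: key => h hr; have [h1 h2] := cB _ _ zr hr.
  - exists A, (- A'); rewrite normrN lerDl lerDr !normr_ge0; split=> //.
    by rewrite mulrN.
  - by exists A', A; rewrite lerDl lerDr !normr_ge0; split.
move=> fB; rewrite /prop_for /continuous_at; apply/(cvgrPdist_le (FF := nbhs_filter x)) => eps eps0.
set K := `|B| + 2 * (`|A| + `|A'|) + 1.
have K0 : 0 < K by rewrite /K ltr_wpDl// addr_ge0// mulr_ge0// addr_ge0.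
near=> y; rewrite distrC /=.
have d1 : normc (plane y - plane x) < 1 by near: y; apply: near_plane.
have d2 : normc (plane y - plane x) < (1 - normc (plane x)) / 2.
  by near: y; apply: near_plane; lra.
have d3 : normc (plane y - plane x) < eps / K.
  by near: y; apply: near_plane; rewrite divr_gt0.
have -> : plane y = plane x + (plane y - plane x) by rewrite addrC subrK.
set h := plane y - plane x in d1 d2 d3 *.
have [|a [b [h1 [ha hb]]]] := fB h.
  by apply: le_trans (le_normcD _ _) _; rewrite /rho; lra.
have h0 := normc_ge0 h.
have hh : B * normc h ^+ 2 <= `|B| * normc h.
  apply: (@le_trans _ _ (`|B| * normc h ^+ 2)).
    by rewrite ler_wpM2r ?exprn_ge0 ?ler_norm.
  by rewrite ler_wpM2l// expr2 ler_piMl// ltW.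
have hA a' (r : R) : `|r| <= normc h -> `|a'| <= `|A| + `|A'| ->
    `|r * a'| <= normc h * (`|A| + `|A'|).
  by move=> rh aA; rewrite normrM ler_pM.
have ra := hA a _ (Re_le_normc h) ha; have ib := hA b _ (Im_le_normc h) hb.
have : normc h * K <= eps by rewrite -ler_pdivlMr// ltW.
rewrite -[f _ - f _](subrK (Re h * a + Im h * b)).
have := ler_normD (f (plane x + h) - f (plane x) - (Re h * a + Im h * b))
  (Re h * a + Im h * b).
have := ler_normD (Re h * a) (Im h * b).
rewrite /K; lra.
Unshelve. all: by end_near. Qed.

End Plane.

Section Harmonic.
Variables (R : realType) (n : nat) (i0 i1 : 'I_n).
Hypothesis i01 : i0 != i1.
Local Notation plane := (plane i0 i1).
Local Notation cylinder := (@cylinder R n i0 i1).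

Definition ps_combination (f : 'rV[R]_n -> R) := exists c e a b, radius1 c e /\
  forall x, cylinder x -> f x = a * psre c e (plane x) + b * psim c e (plane x).

Lemma is_derive_ps_combination (f : 'rV[R]_n -> R) c e a b x i : radius1 c e ->
  (forall x, cylinder x -> f x = a * psre c e (plane x) + b * psim c e (plane x)) ->
  cylinder x -> is_derive x (delta_mx 0 i) f
   (((i == i0)%:R * a + (i == i1)%:R * b) * psre (dcoef c e) (dexpo e) (plane x) +
    ((i == i0)%:R * b - (i == i1)%:R * a) * psim (dcoef c e) (dexpo e) (plane x)).
Proof.
move=> ce fE x1; have [d1 d2] := is_derive_ps i01 ce i x1.
have := is_deriveD (is_deriveZ a d1) (is_deriveZ b d2).
rewrite -![_ *: (_ : R)]/(_ * _).
rewrite [X in is_derive _ _ _ X -> _](_ : _ = (((i == i0)%:R * a + (i == i1)%:R * b) *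
    psre (dcoef c e) (dexpo e) (plane x) + ((i == i0)%:R * b - (i == i1)%:R * a) *
    psim (dcoef c e) (dexpo e) (plane x))); last by ring.
apply: near_eq_is_derive.
by near=> y; rewrite fE//; near: y; exact: near_cylinder.
Unshelve. all: by end_near. Qed.

Lemma ps_combination_derive (f : 'rV[R]_n -> R) i :
  ps_combination f -> ps_combination ('D_(delta_mx 0 i) f).
Proof.
move=> [c [e [a [b [ce fE]]]]].
exists (dcoef c e), (dexpo e), ((i == i0)%:R * a + (i == i1)%:R * b),
  ((i == i0)%:R * b - (i == i1)%:R * a); split; first exact: radius1_diff.
by move=> x x1; have [_ ->] := is_derive_ps_combination i ce fE x1.
Qed.

Lemma ps_combination_Ck k (f : 'rV[R]_n -> R) :
  ps_combination f -> Ck_on k cylinder f.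
Proof.
apply: Ck_on_closed_class => [{}f [c [e [a [b [ce fE]]]]] x x1|{}f i]; last first.
  exact: ps_combination_derive.
split; last by move=> i; have [] := is_derive_ps_combination i ce fE x1.
have [c1 c2] := continuous_ps ce x1.
have h : (fun y => a * psre c e (plane y) + b * psim c e (plane y)) @ x -->
    a * psre c e (plane x) + b * psim c e (plane x).
  exact: (cvgD (cvgMl_tmp c1) (cvgMl_tmp c2)).
have N : \forall y \near x,
    a * psre c e (plane y) + b * psim c e (plane y) = f y.
  by near=> y; rewrite fE//; near: y; exact: near_cylinder.
rewrite /prop_for /continuous_at fE//; apply: cvg_trans h.
exact: near_eq_cvg N.
Unshelve. all: by end_near. Qed.

Lemma harmonic_ps c e (f : 'rV[R]_n -> R) : radius1 c e ->
  (forall x, f x = psre c e (plane x)) -> harmonic_on (unit_ball R n) f.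
Proof.
move=> ce fE; have pf : ps_combination f.
  by exists c, e, 1, 0; split => // x _; rewrite fE mul1r mul0r addr0.
split.
  move=> s x sk /(unit_ball_cylinder i01) x1.
  exact: (@ps_combination_Ck 2 f pf s x sk x1).
move=> x /(unit_ball_cylinder i01) x1.
have fE1 y : cylinder y -> f y = 1 * psre c e (plane y) + 0 * psim c e (plane y).
  by rewrite fE mul1r mul0r addr0.
rewrite /laplacian.
have E i : partials [:: i; i] f x = ((i == i0)%:R - (i == i1)%:R) *
    psre (dcoef (dcoef c e) (dexpo e)) (dexpo (dexpo e)) (plane x).
  rewrite /=; have D1 y : cylinder y -> _ := fun y1 =>
    @derive_val _ _ _ _ _ _ _ (is_derive_ps_combination i ce fE1 y1).
  have [_ ->] := is_derive_ps_combination i (radius1_diff ce) D1 x1.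
  have [->|] := eqVneq i i0; first by rewrite (negbTE i01) /=; ring.
  by case: (i == i1) => /= _; ring.
under eq_bigr do rewrite E.
rewrite -mulr_suml (bigD1 i0)//= (bigD1 i1)/=; last by rewrite eq_sym.
rewrite !eqxx (negbTE i01) [i1 == i0]eq_sym (negbTE i01) big1 ?addr0; last first.
  by move=> i /andP[/negbTE-> /negbTE->]; rewrite subrr.
by rewrite subr0 sub0r subrr mul0r.
Qed.

End Harmonic.

(** * Hoelder continuity *)

Section Lacunary.
Variables (R : realType) (alpha : R).
Hypotheses (alpha_gt0 : 0 < alpha) (alpha_lt1 : alpha < 1).

Definition lratio : R := (2 `^ alpha)^-1.
Definition lcoef (j : nat) : R := (2 `^ (j%:R * alpha))^-1.
Definition lexpo (j : nat) : nat := (2 ^ j)%N.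

Lemma lacunaryE n (hn : (1 < n)%N) (x : 'rV[R]_n) :
  lacunary hn alpha x =
  psre lcoef lexpo (plane (Ordinal (ltnW hn)) (Ordinal hn) x).
Proof. by []. Qed.

Lemma lratio_gt0 : 0 < lratio.
Proof. by rewrite invr_gt0 powR_gt0. Qed.

Lemma lratio_lt1 : lratio < 1.
Proof.
rewrite invf_lt1 ?powR_gt0//.
have := @gt0_ltr_powR R alpha alpha_gt0 1 2.
by rewrite powR1; apply; rewrite ?nnegrE// ltr1n.
Qed.

Lemma lratio_gt_half : 1 < 2 * lratio.
Proof.
rewrite ltr_pdivlMr ?powR_gt0// mul1r.
have E : (2 : R) = 2 `^ alpha * 2 `^ (1 - alpha).
  rewrite -powRD; first by rewrite addrC subrK powRr1.
  by rewrite pnatr_eq0 implybT.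
rewrite [ltRHS]E ltr_pMr ?powR_gt0//.
have := @gt0_ltr_powR R (1 - alpha) _ 1 2.
by rewrite powR1; apply; rewrite ?nnegrE ?subr_gt0// ltr1n.
Qed.

Lemma lcoefE j : lcoef j = lratio ^+ j.
Proof. by rewrite /lcoef mulrC powRrM powR_mulrn ?powR_ge0// exprVn. Qed.

Lemma lcoef_ge0 j : 0 <= lcoef j.
Proof. by rewrite lcoefE exprn_ge0// ltW// lratio_gt0. Qed.

Lemma geometric_sum_le (q : R) N : 0 <= q < 1 ->
  \sum_(1 <= j < N) q ^+ j <= (1 - q)^-1.
Proof.
move=> /andP[q0 q1]; have q1' : 0 < 1 - q by rewrite subr_gt0.
have E : forall j, (1 <= j < N)%N -> q ^+ j = - q ^+ j.+1 / (1 - q) - - q ^+ j / (1 - q).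
  by move=> j _; rewrite exprS; field; rewrite gt_eqF.
case: N E => [|N] E; first by rewrite big_geq// invr_ge0 ltW.
rewrite (telescope_sumr_eq (fun j => - q ^+ j / (1 - q)))// -mulrBl ler_pdivrMr// mulVf ?gt_eqF//.
by rewrite opprK expr1; have := exprn_ge0 N.+1 q0; lra.
Qed.

Lemma lcoef_radius1 : radius1 lcoef lexpo.
Proof.
move=> rho /andP[rho0 rho1]; exists (1 - lratio)^-1 => N.
apply: le_trans (geometric_sum_le N (_ : 0 <= lratio < 1)); last first.
  by rewrite ltW ?lratio_gt0 ?lratio_lt1.
apply: ler_sum => j _; rewrite lcoefE ger0_norm ?exprn_ge0 ?(ltW lratio_gt0)//.
by rewrite ler_piMr ?exprn_ge0 ?(ltW lratio_gt0)// exprn_ile1// ltW.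
Qed.

Lemma lratio_powR (d : R) J : 0 < d -> 1 <= 2 ^+ J * d -> lratio ^+ J <= d `^ alpha.
Proof.
move=> d0 dJ; have q0 := exprn_gt0 J lratio_gt0.
have : 1 `^ alpha <= (2 ^+ J * d) `^ alpha.
  by rewrite ge0_ler_powR ?nnegrE ?(ltW alpha_gt0) ?mulr_ge0 ?exprn_ge0 ?(ltW d0)//.
rewrite powR1 powRM ?exprn_ge0 ?(ltW d0)// -[2 ^+ J]powR_mulrn// -powRrM -lcoefE.
by rewrite /lcoef -ler_pdivrMl ?powR_gt0// mulr1.
Qed.

Lemma lacunary_disk_holder : exists C : R, 0 <= C /\
  forall z w : R[i], normc z <= 1 -> normc w <= 1 ->
  `|psre lcoef lexpo z - psre lcoef lexpo w| <= C * normc (z - w) `^ alpha.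
Proof.
have q0 := lratio_gt0; have q1 := lratio_lt1; have q2 := lratio_gt_half.
set q := lratio in q0 q1 q2 *.
set C := 2 / (2 * q - 1) + 2 / (1 - q); have C0 : 0 <= C.
  by rewrite addr_ge0// divr_ge0// subr_ge0 ltW.
exists C; split=> // z w z1 w1; set d := normc (z - w).
have cvg_ps y : normc y <= 1 ->
    cvgn (fun N => \sum_(1 <= j < N) (lcoef j * Re (y ^+ lexpo j))).
  move=> y1; apply: (@bounded_series_cvg _ _ (fun j => q ^+ j) (1 - q)^-1).
    move=> j; rewrite normrM ger0_norm ?lcoef_ge0// lcoefE ler_piMr ?exprn_ge0 ?(ltW q0)//.
    by apply: le_trans (Re_le_normc _) _; rewrite normcX exprn_ile1 ?normc_ge0.
  by move=> N; apply: geometric_sum_le; rewrite ltW.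
have [d0|d0] := eqVneq d 0.
  have -> : z = w by apply/eqP; rewrite -subr_eq0; apply/eqP/eq0_normc.
  rewrite subrr normr0.
  by rewrite mulr_ge0 ?powR_ge0.
have {}d0 : 0 < d by rewrite lt_def d0 normc_ge0.
have d2 : d <= 2.
  by rewrite /d; apply: le_trans (le_normcD _ _) _; rewrite normcN; lra.
(* For j < J the terms differ by at most 2^j d q^j (mean value inequality), for
   j >= J by at most 2 q^j, where 2^J is comparable to 1/d. *)
have exJ : exists J, 1 <= 2 ^+ J * d.
  have [J dJ] := ltr_add_invr (d0 : 0 < d); exists J.
  rewrite add0r in dJ; rewrite -ler_pdivrMr// mul1r.
  apply: le_trans (_ : J.+1%:R <= _).
    by rewrite invf_ple ?posrE// ltW.
  by rewrite -natrX ler_nat ltn_expl.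
pose J := ex_minn exJ.
have [dJ dJ2] : 1 <= 2 ^+ J * d /\ 2 ^+ J * d <= 2.
  rewrite /J; case: ex_minnP => k dk kmin; split=> //.
  case: k dk kmin => [|k] dk kmin; first by rewrite expr0 mul1r.
  have : ~~ (1 <= 2 ^+ k * d).
    by apply/negP => /kmin; rewrite ltnn.
  by rewrite -ltNge exprS; lra.
have qJ := lratio_powR d0 dJ; rewrite -/q in qJ.
pose b j := if (j < J)%N then (2 * q) ^+ j * d else 2 * q ^+ j.
(* an antidifference of b *)
pose p j := (2 * q) ^+ minn j J * d / (2 * q - 1) - 2 * q ^+ maxn j J / (1 - q).
have bp j : b j = p j.+1 - p j.
  rewrite /b /p; case: ltnP => jJ.
    rewrite (minn_idPl jJ) (maxn_idPr jJ).
    by rewrite exprS; field; lra.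
  rewrite (minn_idPr (leqW jJ)) (maxn_idPl (leqW jJ)).
  by rewrite exprS; field; lra.
have pB N : \sum_(1 <= j < N) b j <= C * d `^ alpha.
  apply: le_trans (_ : (2 ^+ J * d / (2 * q - 1) + 2 / (1 - q)) * q ^+ J <= _); last first.
    apply: ler_pM => //.
    - rewrite addr_ge0// ?divr_ge0// ?subr_ge0 ?(ltW q2) ?(ltW q1)//.
      by rewrite mulr_ge0 ?exprn_ge0// ltW.
    - by rewrite exprn_ge0// ltW.
    - by rewrite lerD2r ler_wpM2r// invr_ge0 subr_ge0 ltW.
  case: N => [|N].
    rewrite big_geq// mulr_ge0 ?exprn_ge0 ?ltW// addr_gt0// ?divr_gt0// ?subr_gt0//.
    by rewrite mulr_gt0 ?exprn_gt0.
  rewrite (telescope_sumr_eq p)//.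
  have i0 : 0 < (2 * q - 1)^-1 by rewrite invr_gt0 subr_gt0.
  have i1 : 0 < (1 - q)^-1 by rewrite invr_gt0 subr_gt0.
  have h1 : (2 * q) ^+ minn N.+1 J * d / (2 * q - 1) <=
      2 ^+ J * d / (2 * q - 1) * q ^+ J.
    rewrite [leRHS](_ : _ = (2 * q) ^+ J * d / (2 * q - 1)); last by rewrite exprMn; ring.
    rewrite !ler_pM2r//.
    by rewrite ler_weXn2l ?geq_minr// ltW.
  have h2 : 0 <= 2 * q ^+ maxn N.+1 J / (1 - q).
    by rewrite !mulr_ge0 ?exprn_ge0 ?ltW.
  have h3 : 0 <= (2 * q) ^+ minn 1 J * d / (2 * q - 1).
    by rewrite !mulr_ge0 ?exprn_ge0 ?ltW// mulr_gt0.
  have h4 : 2 * q ^+ maxn 1 J / (1 - q) <= 2 / (1 - q) * q ^+ J.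
    rewrite mulrAC ler_wpM2l ?divr_ge0 ?subr_ge0 ?(ltW q1)//.
    by rewrite ler_wiXn2l ?leq_maxr// ltW.
  rewrite /p (mulrDl (2 ^+ J * d / (2 * q - 1))); have comb (s t v v' x y : R) :
    s <= x -> 0 <= t -> 0 <= v -> v' <= y -> s - t - (v - v') <= x + y by lra.
  exact: comb.
have L := cvgB (FF := eventually_filter) (cvg_ps _ z1) (cvg_ps _ w1).
rewrite /psre -(cvg_lim (@Rhausdorff R) L).
rewrite [X in limn X](_ : _ = fun N =>
  \sum_(1 <= j < N) (lcoef j * Re (z ^+ lexpo j) - lcoef j * Re (w ^+ lexpo j))).
  2: by apply/funext => N; rewrite /= sumrB.
apply: (bounded_series_lim _ pB) => j; rewrite -mulrBr normrM ger0_norm ?lcoef_ge0//.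
rewrite lcoefE -/q -ReN -ReD.
have qj : 0 <= q ^+ j by rewrite exprn_ge0// ltW.
apply: le_trans (ler_wpM2l qj (Re_le_normc _)) _; rewrite /b.
case: ifP => jJ.
  rewrite exprMn -mulrA mulrCA ler_wpM2l//.
  apply: le_trans (normc_subX _ z1 w1) _.
  by rewrite expr1n mulr1 /lexpo natrX.
rewrite mulrC ler_wpM2r//; apply: le_trans (le_normcD _ _) _.
rewrite normcN !normcX.
have := exprn_ile1 (lexpo j) (normc_ge0 z) z1.
have := exprn_ile1 (lexpo j) (normc_ge0 w) w1; lra.
Qed.

Variables (n : nat) (hn : (1 < n)%N).
Local Notation i0 := (Ordinal (ltnW hn)).
Local Notation i1 := (Ordinal hn).
Local Notation pln := (plane i0 i1).

Lemma i0_neq_i1 : i0 != i1. Proof. by []. Qed.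

Lemma planeB (x y : 'rV[R]_n) : pln (x - y) = pln x - pln y.
Proof. by rewrite /plane !mxE. Qed.

Lemma lacunary_holder : holder_on alpha (closed_unit_ball R n) (lacunary hn alpha).
Proof.
have [C [C0 HC]] := lacunary_disk_holder; exists C => x y x1 y1.
rewrite !lacunaryE; apply: le_trans (HC _ _ _ _) _.
- exact: le_trans (normc_plane_le i0_neq_i1 x) x1.
- exact: le_trans (normc_plane_le i0_neq_i1 y) y1.
rewrite ler_wpM2l// ge0_ler_powR ?(ltW alpha_gt0) ?nnegrE ?normc_ge0 ?sqrtr_ge0//.
by rewrite -planeB; exact: (normc_plane_le i0_neq_i1).
Qed.

Lemma enorm_scale_delta (t : R) (i : 'I_n) : enorm (t *: delta_mx 0 i) = `|t|.
Proof.
rewrite /enorm (bigD1 i)//= big1 => [|j ji].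
  by rewrite addr0 !mxE !eqxx mulr1 sqrtr_sqr.
by rewrite !mxE (negbTE ji) andbF mulr0 expr0n.
Qed.

Lemma pow2V01 J : 0 < ((2 : R) ^+ J)^-1 <= 1.
Proof. by rewrite invr_gt0 exprn_gt0//= invf_le1 ?exprn_gt0// exprn_ege1// ler1n. Qed.

Lemma powR_pow2V (a : R) J : ((2 : R) ^+ J)^-1 `^ a = (2 `^ a)^-1 ^+ J.
Proof.
rewrite -powR_invn// -powRrM mulNr powRN mulrC powRrM.
by rewrite powR_mulrn ?powR_ge0// exprVn.
Qed.

Lemma lacunary_axis_gap J : (0 < J)%N ->
  lcoef J / 2 <= lacunary hn alpha (1 *: delta_mx 0 i0) -
     lacunary hn alpha ((1 - (2 ^+ J)^-1) *: delta_mx 0 i0).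
Proof.
move=> J0; set r := 1 - (2 ^+ J)^-1.
have m0 : 0 < 2 ^+ J :> R by rewrite exprn_gt0.
have r01 : 0 <= r <= 1.
  by have := pow2V01 J; rewrite /r => /andP[? ?]; apply/andP; split; lra.
have /andP[r0 r1] := r01.
have planeE (t : R) : pln (t *: delta_mx 0 i0) = t%:C%C.
  by rewrite /plane !mxE /= mulr1 mulr0.
have ReX (t : R) m : Re (t%:C%C ^+ m) = t ^+ m by rewrite -rmorphXn.
have cvgt (t : R) : 0 <= t <= 1 ->
    cvgn (fun N => \sum_(1 <= j < N) lacunary_term hn alpha (t *: delta_mx 0 i0) j).
  move=> /andP[t0 t1]; apply: is_cvg_lacunary => //.
  by rewrite /closed_unit_ball /mkset enorm_scale_delta ger0_norm.
have r2 : r ^+ (2 ^ J) <= 2^-1.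
  have := exprn_convex (2 ^ J) r0 r1; rewrite expr1n.
  rewrite {2}/r opprB addrC subrK mulrAC natrX mulfV ?gt_eqF// mul1r.
  have : r ^+ (2 ^ J) <= r ^+ (2 ^ J).-1 by rewrite ler_wiXn2l// leq_pred.
  lra.
have L := cvgB (FF := eventually_filter) (cvgt 1 ltac:(by rewrite ler01 lexx)) (cvgt r r01).
have termE j : lacunary_term hn alpha (1 *: delta_mx 0 i0) j -
    lacunary_term hn alpha (r *: delta_mx 0 i0) j = lcoef j * (1 - r ^+ (2 ^ j)).
  rewrite /lacunary_term -[(_ +i* _)%C]/(pln _) -[X in _ - _ * Re (X ^+ _)]/(pln _).
  by rewrite !planeE !ReX expr1n -mulrBr.
rewrite [X in X @ _ --> _](_ : _ = fun N => \sum_(1 <= j < N)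
    (lcoef j * (1 - r ^+ (2 ^ j)))) in L; last first.
  apply/funext => N; rewrite -[LHS]/(_ - _) -sumrB.
  by apply: eq_bigr => j _; rewrite termE.
rewrite /lacunary -(cvg_lim (@Rhausdorff R) L).
apply: limr_ge; first by apply/cvg_ex; eexists; exact: L.
near=> N.
rewrite (bigD1_seq J)/= ?iota_uniq//; last first.
  by rewrite mem_index_iota J0/=; near: N; exact: nbhs_infty_gt.
apply: le_trans (_ : lcoef J * (1 - r ^+ (2 ^ J)) <= _).
  by rewrite ler_wpM2l ?lcoef_ge0//; lra.
rewrite lerDl sumr_ge0// => j _; rewrite mulr_ge0 ?lcoef_ge0//.
by rewrite subr_ge0 exprn_ile1.
Unshelve. all: by end_near. Qed.

Lemma lacunary_not_holder (eps : R) : 0 < eps ->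
  ~ holder_on (alpha + eps) (closed_unit_ball R n) (lacunary hn alpha).
Proof.
move=> eps0 [C HC].
set p := (2 `^ eps)^-1 : R.
have p0 : 0 < p by rewrite invr_gt0 powR_gt0.
have p1 : p < 1.
  rewrite invf_lt1 ?powR_gt0//.
  have := @gt0_ltr_powR R eps eps0 1 2.
  by rewrite powR1; apply; rewrite ?nnegrE// ltr1n.
have key J : (0 < J)%N -> 2^-1 <= C * p ^+ J.
  move=> J0; have m0 : 0 < 2 ^+ J :> R by rewrite exprn_gt0.
  have ball (t : R) : 0 <= t <= 1 -> closed_unit_ball R n (t *: delta_mx 0 i0).
    by move=> /andP[t0 t1]; rewrite /closed_unit_ball /mkset enorm_scale_delta ger0_norm.
  have b1 := ball 1 ltac:(by rewrite ler01 lexx).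
  have br := ball (1 - (2 ^+ J)^-1).
  have := HC _ _ b1 (br _).
  rewrite -scalerBl enorm_scale_delta subKr => /(_ _)/=.
  move=> /(_ ltac:(by have /andP[? ?] := pow2V01 J; apply/andP; split; lra)).
  move=> h; have := le_trans (lacunary_axis_gap J0) (le_trans (ler_norm _) h).
  rewrite ger0_norm ?invr_ge0 ?(ltW m0)//.
  have E : (2 ^+ J)^-1 `^ (alpha + eps) = lcoef J * p ^+ J.
    rewrite powRD; last by rewrite [_^-1 == 0]gt_eqF ?implybT// invr_gt0.
    by rewrite !powR_pow2V lcoefE.
  rewrite E mulrCA ler_pM2l//.
  by rewrite lcoefE exprn_gt0 ?lratio_gt0.
have : 2^-1 <= (0 : R).
  have c0 : (fun J => C * p ^+ J) @ \oo --> C * 0.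
    by apply: cvgMl_tmp; apply: cvg_expr; rewrite ger0_norm ?ltW.
  rewrite mulr0 in c0; rewrite -(cvg_lim (@Rhausdorff R) c0).
  apply: limr_ge; first by apply/cvg_ex; eexists; exact: c0.
  by near=> J; apply: key; near: J; exact: nbhs_infty_gt.
by rewrite leNgt invr_gt0 ltr0n.
Unshelve. all: by end_near. Qed.

End Lacunary.

(** * Product test functions *)

Section Smooth.
Variable R : realType.
Implicit Types f g : R -> R.

Fixpoint Dk (k : nat) f : Prop :=
  if k is k'.+1 then (forall x, derivable f x 1) /\ Dk k' (derive1 f) else True.

Definition smooth f := forall k, Dk k f.

Lemma DkW k f : Dk k.+1 f -> Dk k f.
Proof. by elim: k f => [//|k IH] f [df /IH]. Qed.

Lemma smooth_derivable f x : smooth f -> derivable f x 1.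
Proof. by move=> /(_ 1%N)[]. Qed.

Lemma smooth_derive1 f : smooth f -> smooth (derive1 f).
Proof. by move=> sf k; have [] := sf k.+1. Qed.

Lemma smooth_derive1n f k : smooth f -> smooth (derive1n k f).
Proof. by move=> sf; elim: k => [//|k]; rewrite derive1nS; exact: smooth_derive1. Qed.

Lemma smooth_continuous f : smooth f -> continuous f.
Proof.
by move=> sf x; apply/differentiable_continuous/derivable1_diffP/smooth_derivable.
Qed.

Lemma Dk_cst k (a : R) : Dk k (fun=> a).
Proof.
elim: k a => [//|k IH] a; split=> //.
by rewrite (_ : (derive1 _) = fun=> 0)//; apply/funext => x; rewrite derive1_cst.
Qed.

Lemma DkD k f g : Dk k f -> Dk k g -> Dk k (fun x => f x + g x).
Proof.
elim: k f g => [//|k IH] f g [df Df] [dg Dg]; split=> [x|]; first exact: derivableD.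
rewrite (_ : (derive1 _) = fun x => (derive1 f) x + (derive1 g) x); first exact: IH.
by apply/funext => x; rewrite !derive1E deriveD.
Qed.

Lemma DkM k f g : Dk k f -> Dk k g -> Dk k (fun x => f x * g x).
Proof.
elim: k f g => [//|k IH] f g Hf Hg; have [df Df] := Hf; have [dg Dg] := Hg.
split=> [x|]; first exact: derivableM.
rewrite (_ : (derive1 _) = fun x => f x * (derive1 g) x + g x * (derive1 f) x).
  by apply: DkD; apply: IH => //; exact: DkW.
by apply/funext => x; rewrite !derive1E deriveM.
Qed.

Lemma is_derive_affine f a b x : derivable f (a * x + b) 1 ->
  is_derive x 1 (fun y => f (a * y + b)) (a * (derive1 f) (a * x + b)).
Proof.
move=> df.
have d1 : is_derive x 1 (fun y : R => a * y + b) a.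
  have := is_deriveD (is_deriveZ a (is_derive_id x 1)) (is_derive_cst b x 1).
  by rewrite addr0 -[_ *: _]/(_ * _) mulr1.
have d2 : is_derive (a * x + b) 1 f ((derive1 f) (a * x + b)).
  by rewrite derive1E; exact: DeriveDef.
have := @is_derive1_comp R f (fun y => a * y + b) x _ _ d2 d1.
by rewrite mulrC.
Qed.

Lemma Dk_affine k f a b : Dk k f -> Dk k (fun x => f (a * x + b)).
Proof.
elim: k f => [//|k IH] f [df Df]; split=> [x|].
  by have [] := is_derive_affine (df (a * x + b)).
rewrite (_ : (derive1 _) = fun x => a * (derive1 f) (a * x + b)).
  by apply: DkM; [exact: Dk_cst|exact: IH].
by apply/funext => x; rewrite derive1E; have [_ ->] := is_derive_affine (df (a * x + b)).
Qed.

(* The powers of 1/x make the family stable under differentiation. *)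
Definition flat (m : nat) (x : R) : R :=
  if 0 < x then x^-1 ^+ m * expR (- x^-1) else 0.

Lemma flat_le m (x : R) : 0 <= flat m x <= (m.+2)`!%:R * x ^+ 2.
Proof.
rewrite /flat; case: ifPn => [x0|_]; last by rewrite lexx mulr_ge0 ?sqr_ge0.
rewrite mulr_ge0 ?expR_ge0 ?exprn_ge0 ?invr_ge0 ?(ltW x0)//=.
rewrite expRN ler_pdivrMr ?expR_gt0//.
have y0 : 0 <= x^-1 by rewrite invr_ge0 ltW.
have := expR_ge1Dxn m.+1 y0.
have f0 : 0 < (m.+2)`!%:R :> R by rewrite ltr0n fact_gt0.
move=> h; have {h} : (m.+2)`!%:R * x ^+ 2 * (x^-1 ^+ m.+2 / (m.+2)`!%:R) <=
    (m.+2)`!%:R * x ^+ 2 * expR x^-1.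
  by rewrite ler_wpM2l ?mulr_ge0 ?sqr_ge0 ?ltW//; lra.
apply: le_trans; rewrite le_eqVlt; apply/orP; left; apply/eqP.
rewrite !exprS; set y := x^-1 ^+ m; field.
by rewrite !gt_eqF.
Qed.

Lemma is_derive_flat m (x : R) :
  is_derive x 1 (flat m) (- m%:R * flat m.+1 x + flat m.+2 x).
Proof.
have [x0|x0|<-] := ltgtP 0 x.
- have d1 : is_derive x 1 (fun y : R => y^-1) (- x ^- 2).
    have x0' := lt0r_neq0 x0; apply: DeriveDef.
      by apply: (@derivableV _ _ id) => //; exact: derivable_id.
    rewrite (@deriveV _ _ id) ?derive_id; [|exact: x0'|exact: derivable_id].
    by rewrite -[_ *: _]/(_ * _) mulr1.
  have d2 := is_deriveM (is_derive1_comp (is_deriveX m (is_derive_id x^-1 1)) d1)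
    (is_derive1_comp (is_derive_expR _) (is_deriveN d1)).
  suff : is_derive x 1 (fun y => y^-1 ^+ m * expR (- y^-1))
      (- m%:R * flat m.+1 x + flat m.+2 x).
    apply: near_eq_is_derive; near=> y.
    by rewrite /flat ifT//; near: y; exact: (@lt_nbhsr R 0 x x0).
  rewrite exprfctE /comp in d2; apply: (is_derive_eq d2).
  rewrite /flat x0 -![_ *: (_ : R)]/(_ * _) /= !exprS.
  case: m {d2} => [|m] /=; rewrite ?exprS; field; exact: lt0r_neq0.
- rewrite /flat ltNge (ltW x0) /= mulr0 add0r.
  suff : is_derive x 1 (fun=> 0 : R) 0.
    apply: near_eq_is_derive; near=> y.
    by rewrite ltNge ltW//; near: y; exact: lt_nbhsl.
  exact: is_derive_cst.
- have -> : - m%:R * flat m.+1 0 + flat m.+2 0 = 0.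
    by rewrite /flat ltxx mulr0 add0r.
  apply: (@is_derive_quadratic _ _ _ _ _ _ 1 (m.+2)`!%:R) => // t _.
  rewrite {2}/flat ltxx mulr0 !subr0 addr0 -[_ *: _]/(_ * _) mulr1.
  by have /andP[f0 f1] := flat_le m t; rewrite ger0_norm.
Unshelve. all: by end_near. Qed.

Lemma smooth_flat m : smooth (flat m).
Proof.
move=> k; elim: k m => [//|k IH] m; split=> [x|].
  by have [] := is_derive_flat m x.
rewrite (_ : (derive1 _) = fun x => - m%:R * flat m.+1 x + flat m.+2 x).
  by apply: DkD => //; apply: DkM; [exact: Dk_cst|exact: IH].
by apply/funext => x; rewrite derive1E; have [_ ->] := is_derive_flat m x.
Qed.

Definition bump (a b : R) (m : nat) (x : R) : R :=
  flat 0 (m.+1%:R * x + - (m.+1%:R * a)) * flat 0 (- m.+1%:R * x + m.+1%:R * b).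

Lemma smooth_bump a b m : smooth (bump a b m).
Proof. by move=> k; apply: DkM; apply: Dk_affine; exact: smooth_flat. Qed.

Lemma flat0_01 (x : R) : 0 <= flat 0 x <= 1.
Proof.
rewrite /flat; case: ifP => [x0|_]; last by rewrite lexx ler01.
by rewrite expr0 mul1r expR_ge0 expR_le1 oppr_le0 invr_ge0 ltW.
Qed.

Lemma bump_01 a b m x : 0 <= bump a b m x <= 1.
Proof.
have /andP[h1 h2] := flat0_01 (m.+1%:R * x + - (m.+1%:R * a)).
have /andP[h3 h4] := flat0_01 (- m.+1%:R * x + m.+1%:R * b).
by rewrite mulr_ge0//= mulr_ile1.
Qed.

Lemma bump_out a b m x : ~~ (a < x < b) -> bump a b m x = 0.
Proof.
rewrite negb_and -!leNgt /bump /flat => /orP[xa|bx].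
  have /negbTE-> : ~~ (0 < m.+1%:R * x + - (m.+1%:R * a)); last by rewrite mul0r.
  by rewrite -leNgt -mulrBr mulr_ge0_le0// subr_le0.
have /negbTE-> : ~~ (0 < - m.+1%:R * x + m.+1%:R * b); last by rewrite mulr0.
by rewrite -leNgt mulNr addrC -mulrBr mulr_ge0_le0// subr_le0.
Qed.

Lemma flat0_cvg (x : R) : 0 < x ->
  (fun m : nat => flat 0 (m.+1%:R * x)) @ \oo --> (1 : R).
Proof.
move=> x0; rewrite (_ : (fun m => _) = (fun m => expR (- (m.+1%:R^-1 * x^-1)))).
  rewrite -[X in _ --> X]expR0 -oppr0 -(mul0r x^-1).
  apply: (continuous_cvg _ (@continuous_expR R _)).
  apply: cvgN; apply: cvgMr_tmp; exact: cvg_harmonic.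
by apply/funext => m; rewrite /flat mulr_gt0//= expr0 mul1r invfM.
Qed.

Lemma bump_cvg a b x :
  (fun m => bump a b m x) @ \oo --> (((a < x < b)%R : bool)%:R : R).
Proof.
case: (boolP (a < x < b)%R) => [/andP[ax xb]|xab]; last first.
  rewrite (_ : (fun m => _) = fun=> 0); first exact: cvg_cst.
  by apply/funext => m; exact: bump_out.
rewrite -[X in _ --> X](mulr1 (1 : R)).
rewrite (_ : (fun m => _) = (fun m : nat => flat 0 (m.+1%:R * (x - a)) *
  flat 0 (m.+1%:R * (b - x)))); last first.
  by apply/funext => m; rewrite /bump; congr (flat 0 _ * flat 0 _); ring.
by apply: cvgM; apply: flat0_cvg; rewrite subr_gt0.
Qed.

End Smooth.

Section ProductTestFunctions.
Variables (R : realType) (n : nat).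
Implicit Types (e : 'I_n -> R -> R) (x : 'rV[R]_n).

Definition tensor e (x : 'rV[R]_n) : R := \prod_(i < n) e i (x 0 i).

Definition tensor_diff i e j : R -> R := if j == i then (derive1 (e j)) else e j.

Lemma tensor_diff_smooth e i : (forall j, smooth (e j)) ->
  forall j, smooth (tensor_diff i e j).
Proof. by move=> se j; rewrite /tensor_diff; case: ifP => // _; exact: smooth_derive1. Qed.

Lemma is_derive_tensor e x i : derivable (e i) (x 0 i) 1 ->
  is_derive x (delta_mx 0 i) (tensor e) (tensor (tensor_diff i e) x).
Proof.
move=> de; set P := \prod_(j < n | j != i) e j (x 0 j).
have -> : tensor (tensor_diff i e) x = P * (derive1 (e i)) (x 0 i).
  rewrite /tensor (bigD1 i)//= mulrC /tensor_diff eqxx; congr (_ * _).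
  by apply: eq_bigr => j /negbTE ->.
suff : (fun h : R => h^-1 *: ((tensor e \o shift x) (h *: delta_mx 0 i) - tensor e x))
    @ 0^' --> P * (derive1 (e i)) (x 0 i).
  by move=> fd; split; [apply/cvg_ex; eexists; exact: fd|exact: cvg_lim].
rewrite (_ : (fun h => _) = (fun h : R => P * (h^-1 *:
   ((e i \o shift (x 0 i)) (h *: 1) - e i (x 0 i))))).
  by rewrite derive1E; apply: cvgMl_tmp; exact: de.
apply/funext => h /=; rewrite /tensor (bigD1 i)//= [X in _ - X](bigD1 i)//=.
rewrite !mxE !eqxx /= -/P (eq_bigr (fun j => e j (x 0 j))) => [|j ji].
  by rewrite -/P -mulrBl -![_ *: (_ : R)]/(_ * _) [RHS]mulrCA [_ * P]mulrC.
by rewrite !mxE (negbTE ji) andbF mulr0 add0r.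
Qed.

Lemma tensor_continuous e : (forall i, continuous (e i)) -> continuous (tensor e).
Proof.
move=> ce; apply: (@continuous_big _ _ _ _ xpredT _ _ _ (fun i (y : 'rV[R]_n) => e i (y 0 i))).
  exact: mul_continuous.
move=> i _ x; apply: (@continuous_comp _ _ _ (fun y : 'rV[R]_n => y 0 i) (e i)).
  exact: coord_continuous.
exact: ce.
Qed.

Lemma tensor_Ck e k : (forall i, smooth (e i)) -> Ck_on k setT (tensor e).
Proof.
move=> se; apply: (@Ck_on_closed_class _ _ _
  (fun f => exists e, (forall i, smooth (e i)) /\ f = tensor e)); last by exists e.
- move=> _ [{}e [{}se ->]] x _; split.
    by apply: tensor_continuous => i; exact: smooth_continuous.
  by move=> i; have [] := is_derive_tensor (x := x) (smooth_derivable (se i)).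
- move=> _ i [{}e [{}se ->]]; exists (tensor_diff i e); split.
    exact: tensor_diff_smooth.
  apply/funext => x.
  by have [_ ->] := is_derive_tensor (x := x) (smooth_derivable (se i)).
Qed.

Lemma partials_tensor e i k : (forall i, smooth (e i)) ->
  partials (nseq k i) (tensor e) =
  tensor (fun j => if j == i then (derive1n k (e j)) else e j).
Proof.
move=> se; elim: k => [|k IH] /=.
  by congr tensor; apply/funext => j; case: ifP.
rewrite IH; pose e' j := if j == i then derive1n k (e j) else e j; have se' j : smooth (e' j).
  by rewrite /e'; case: ifP => // _; exact: smooth_derive1n.
apply/funext => x.
have [_ ->] := is_derive_tensor (x := x) (smooth_derivable (se' i)).
congr tensor; apply/funext => j; rewrite /tensor_diff /e'.
by case: (j == i).
Qed.

Definition box (a b : 'I_n -> R) : set 'rV[R]_n :=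
  [set x | forall i, a i <= x 0 i <= b i].

Lemma box_compact a b : compact (box a b).
Proof.
have := @rV_compact R n (fun i => `[a i, b i]%classic) (fun i => @segment_compact _ _ _).
by rewrite (_ : mkset _ = box a b).
Qed.

Lemma tensor_test_function (Omega : set 'rV[R]_n) (a b : 'I_n -> R) e :
  (forall i, smooth (e i)) -> (forall i (x : R), ~~ (a i < x < b i) -> e i x = 0) ->
  box a b `<=` Omega -> test_function Omega (tensor e).
Proof.
move=> se eab abO; have cl : closure [set x | tensor e x != 0] `<=` box a b.
  have cb : closed (box a b).
    by apply: compact_closed; [exact: norm_hausdorff|exact: box_compact].
  rewrite [X in _ `<=` X](closure_id _).1//; apply: closureS => x /=.
  apply: contra_neqP => /existsNP[i /negP xi].
  rewrite /tensor (bigD1 i)//= eab ?mul0r//.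
  apply: contra xi => /andP[h1 h2]; by rewrite !ltW.
split; first by move=> k; exact: tensor_Ck.
split; last exact: subset_trans cl abO.
by apply: (subclosed_compact _ (@box_compact a b) cl); exact: closed_closure.
Qed.

End ProductTestFunctions.

(** * Transformations preserving the Lebesgue measure *)

Section Preserves.
Variable R : realType.

Definition preserves d (T : measurableType d) (mu : set T -> \bar R) (phi : T -> T) :=
  measurable_fun setT phi /\
  forall A, measurable A -> mu (phi @^-1` A) = mu A.

Lemma preserves_comp d (T : measurableType d) (mu : set T -> \bar R) (phi psi : T -> T) :
  preserves mu phi -> preserves mu psi -> preserves mu (phi \o psi).
Proof.
move=> [mphi pphi] [mpsi ppsi]; split; first exact: measurableT_comp.
move=> A mA; rewrite comp_preimage ppsi ?pphi//.
by rewrite -[X in measurable X]setTI; exact: mphi.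
Qed.

Lemma preserves_iter d (T : measurableType d) (mu : set T -> \bar R) (phi : T -> T) k :
  preserves mu phi -> preserves mu (iter k phi).
Proof.
move=> pphi; elim: k => [|k IH]; first by split => //; exact: measurable_id.
exact: (preserves_comp pphi IH).
Qed.

Lemma preserves_integral d (T : measurableType d) (mu : {measure set T -> \bar R})
    (phi : T -> T) (D : set T) (f : T -> \bar R) :
  preserves mu phi -> measurable D -> phi @^-1` D = D ->
  measurable_fun D f -> (forall x, D x -> (0 <= f x)%E) ->
  (\int[mu]_(x in D) f (phi x) = \int[mu]_(x in D) f x)%E.
Proof.
move=> [mphi pphi] mD phiD mf f0.
transitivity (\int[pushforward mu phi]_(x in D) f x)%E.
  by rewrite (ge0_integral_pushforward mphi)// ?phiD// => x /set_mem /f0.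
by apply: eq_measure_integral => A mA _; exact: pphi.
Qed.

Lemma preserves_translation (a : R) :
  preserves (@lebesgue_measure R) (fun x : measurableTypeR R => x + a).
Proof.
pose f x : measurableTypeR R := (x : measurableTypeR R) + a.
have mf : measurable_fun setT f by apply: measurable_funD.
split=> // A mA; rewrite -[LHS]/(pushforward lebesgue_measure f A).
apply/esym/lebesgue_measure_unique => //= _ [[b c] _ <-].
rewrite /pushforward (_ : _ @^-1` _ = `]b - a, c - a]%classic).
  rewrite !lebesgue_measure_itv/= !lte_fin ltrD2r -!EFinB.
  by rewrite (_ : c - a - (b - a) = c - b)//; ring.
by apply/seteqP; split=> x /=; rewrite !in_itv/= ltrBlDr lerBrDr.
Qed.

Section Product.
Variables (d1 d2 : measure_display) (T1 : measurableType d1) (T2 : measurableType d2).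
Variables (m1 : {sigma_finite_measure set T1 -> \bar R})
  (m2 : {sigma_finite_measure set T2 -> \bar R}).

Lemma product_measure12 (A : set (T1 * T2)) : measurable A ->
  ((m1 \x m2) A = (m1 \x^ m2) A)%E.
Proof.
by move=> mA; apply: product_measure_unique => //= *; rewrite product_measure2E.
Qed.

Lemma preserves_fiber2 (psi : T1 -> T2 -> T2) :
  measurable_fun setT (fun p : T1 * T2 => (p.1, psi p.1 p.2)) ->
  (forall x, preserves m2 (psi x)) ->
  preserves (m1 \x m2)%E (fun p => (p.1, psi p.1 p.2)).
Proof.
move=> mpsi ppsi; split=> // A mA; rewrite /product_measure1.
apply: eq_integral => x _ /=; rewrite !xsectionE; apply: (ppsi x).2.
by rewrite -xsectionE; exact: measurable_xsection.
Qed.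

Lemma preserves_fiber1 (psi : T2 -> T1 -> T1) :
  measurable_fun setT (fun p : T1 * T2 => (psi p.2 p.1, p.2)) ->
  (forall y, preserves m1 (psi y)) ->
  preserves (m1 \x m2)%E (fun p => (psi p.2 p.1, p.2)).
Proof.
move=> mpsi ppsi; split=> // A mA.
rewrite !product_measure12//; last by rewrite -[X in measurable X]setTI; exact: mpsi.
rewrite /product_measure2.
apply: eq_integral => y _ /=; rewrite !ysectionE; apply: (ppsi y).2.
by rewrite -ysectionE; exact: measurable_ysection.
Qed.

Lemma preserves_product (phi : T1 -> T1) (psi : T2 -> T2) :
  preserves m1 phi -> preserves m2 psi ->
  preserves (m1 \x m2)%E (fun p => (phi p.1, psi p.2)).
Proof.
move=> pphi ppsi.
have m1phi : measurable_fun setT (fun p : T1 * T2 => (phi p.1, p.2)).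
  apply: measurable_fun_pair; last exact: measurable_snd.
  by apply: measurableT_comp; [exact: pphi.1|exact: measurable_fst].
have m2psi : measurable_fun setT (fun p : T1 * T2 => (p.1, psi p.2)).
  apply: measurable_fun_pair; first exact: measurable_fst.
  by apply: measurableT_comp; [exact: ppsi.1|exact: measurable_snd].
have p1 := @preserves_fiber1 (fun _ => phi) m1phi (fun _ => pphi).
have p2 := @preserves_fiber2 (fun _ => psi) m2psi (fun _ => ppsi).
exact: (preserves_comp p1 p2).
Qed.

End Product.

Section Tuple.
Local Notation tup n := (n.-tuple (measurableTypeR R)).

Lemma preserves_cons n (phi : measurableTypeR R * tup n -> measurableTypeR R * tup n) :
  preserves (lebesgue_measure \x lebesgue_tuple R n)%E phi ->
  preserves (lebesgue_tuple R n.+1) (@cons_pair R n \o phi \o @uncons_pair R n).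
Proof.
move=> [mphi pphi].
have mc := @measurable_cons_pair R n; have mu := @measurable_uncons_pair R n.
split; first by do 2 apply: measurableT_comp => //.
move=> A mA; rewrite /= /lebesgue_cons /pushforward.
have mcA : measurable (@cons_pair R n @^-1` A).
  by rewrite -[X in measurable X]setTI; exact: mc.
rewrite -[RHS]pphi//; congr (_ _); apply/seteqP.
by split=> p /=; rewrite uncons_pairK.
Qed.

Lemma measurable_thead n :
  measurable_fun setT (fun t : tup n.+1 => thead t : measurableTypeR R).
Proof. exact: (@measurable_tnth _ (measurableTypeR R) n.+1 ord0). Qed.

Definition shear1 n (s : tup n -> R) : tup n.+1 -> tup n.+1 :=
  @cons_pair R n \o (fun p => (p.1 + s p.2, p.2)) \o @uncons_pair R n.

Lemma preserves_shear1 n (s : tup n -> R) : measurable_fun setT s ->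
  preserves (lebesgue_tuple R n.+1) (shear1 s).
Proof.
move=> ms; apply: preserves_cons.
apply: (@preserves_fiber1 _ _ _ _ _ _ (fun y (x : measurableTypeR R) => x + s y)).
  apply: measurable_fun_pair; last exact: measurable_snd.
  apply: measurable_funD; first exact: measurable_fst.
  by apply: measurableT_comp => //; exact: measurable_snd.
by move=> y; exact: preserves_translation.
Qed.

Definition shear2 n (s : R -> R) : tup n.+2 -> tup n.+2 :=
  @cons_pair R n.+1 \o (fun p => (p.1, shear1 (fun=> s p.1) p.2)) \o
    @uncons_pair R n.+1.

Lemma preserves_shear2 n (s : measurableTypeR R -> R) : measurable_fun setT s ->
  preserves (lebesgue_tuple R n.+2) (@shear2 n s).
Proof.
move=> ms; apply: preserves_cons.
apply: (@preserves_fiber2 _ _ _ _ _ _ (fun (x : measurableTypeR R) => shear1 (fun=> s x))).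
  apply: measurable_fun_pair; first exact: measurable_fst.
  apply: (measurableT_comp (measurable_cons_pair (n := n))) => /=.
  apply: measurable_fun_pair.
    apply: measurable_funD.
      exact: (measurableT_comp (@measurable_thead n) measurable_snd).
    by apply: measurableT_comp => //; exact: measurable_fst.
  exact: (measurableT_comp (@measurable_behead _ (measurableTypeR R) n) measurable_snd).
by move=> x; apply: preserves_shear1.
Qed.

(* A plane rotation is a product of three shears; for s = 0 the junk value of
   the division makes this the identity. *)
Definition rotation n (c s : R) : tup n.+2 -> tup n.+2 :=
  let a := (c - 1) / s in
  shear1 (fun t => a * thead t) \o @shear2 n (fun x => s * x) \o
  shear1 (fun t => a * thead t).

Lemma preserves_rotation n (c s : R) : preserves (lebesgue_tuple R n.+2) (@rotation n c s).
Proof.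
have h : preserves (lebesgue_tuple R n.+2) (shear1 (fun t : tup n.+1 => (c - 1) / s * thead t)).
  apply: preserves_shear1; apply: measurable_funM => //; exact: measurable_thead.
have h2 : preserves (lebesgue_tuple R n.+2) (@shear2 n (fun x => s * x)).
  by apply: preserves_shear2; apply: measurable_funM => //; exact: measurable_id.
exact: (preserves_comp (preserves_comp h h2) h).
Qed.

Lemma rotationE n (c s : R) (t : tup n.+2) : s != 0 -> c ^+ 2 + s ^+ 2 = 1 ->
  rotation c s t = [tuple of c * thead t - s * thead [tuple of behead t] ::
    s * thead t + c * thead [tuple of behead t] :: behead (behead t)].
Proof.
case/tupleP: t => x t; case/tupleP: t => y t s0 cs1; apply: val_inj => /=.
set a := (c - 1) / s; have E1 : a * s = c - 1 by rewrite divfK.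
have E2 : a * (1 + c) = - s.
  apply: (mulIf s0); rewrite mulrAC E1.
  have -> : - s * s = c ^+ 2 - (c ^+ 2 + s ^+ 2) by ring.
  by rewrite cs1; ring.
have F1 : x + a * y + a * (y + s * (x + a * y)) = c * x - s * y.
  rewrite [LHS](_ : _ = (1 + a * s) * x + a * (1 + (1 + a * s)) * y); last by ring.
  by rewrite E1 (_ : 1 + (c - 1) = c) ?E2; ring.
have F2 : y + s * (x + a * y) = s * x + c * y.
  rewrite [LHS](_ : _ = s * x + (1 + a * s) * y); last by ring.
  by rewrite E1; ring.
by apply: (congr2 cons F1); apply: (congr2 cons F2).
Qed.

End Tuple.

End Preserves.

(** * Weak derivatives of power series *)

Section PiLambda.
Local Open Scope ereal_scope.
Context d (T : measurableType d) (R : realType).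
Variables (mu : {measure set T -> \bar R}) (D : set T) (h : T -> \bar R).
Hypotheses (mD : measurable D) (hD : mu.-integrable D h).
Hypothesis h0 : \int[mu]_(x in D) h x = 0.
Variable G : set (set T).
Hypotheses (IG : setI_closed G) (mG : G `<=` measurable)
  (Gm : measurable `<=` <<s G>>).
Hypothesis hG : forall A, G A -> \int[mu]_(x in D `&` A) h x = 0.

Lemma integral_pi_system_ae_eq0 : ae_eq mu D h (cst 0).
Proof.
pose L A := measurable A /\ \int[mu]_(x in D `&` A) h x = 0.
have mh := measurable_int _ hD.
have lambdaL : lambda_system setT L.
  split.
  - by move=> A _.
  - by split => //; rewrite setIT.
  - move=> A B BA [mA A0] [mB B0]; split; first exact: measurableD.
    have E : D `&` A = (D `&` B) `|` (D `&` (A `\` B)).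
      rewrite -setIUr; congr (_ `&` _).
      by rewrite setDUK.
    move: A0; rewrite E integral_setU//.
    + by rewrite B0 add0e.
    + exact: measurableI.
    + by apply: measurableI => //; exact: measurableD.
    + by rewrite -E; apply: measurable_funS mh => //; exact: subIsetl.
    + apply/disj_setPS => x [[_ Bx] [_ [_ ]]]; exact.
  - move=> F ndF FL.
    have mF n : measurable (F n) by have [] := FL n.
    have mU : measurable (\bigcup_n F n) by exact: bigcupT_measurable.
    split=> //; rewrite integral_mkcondr.
    have mr A : measurable A -> measurable_fun D (h \_ A).
      move=> mA; apply/(measurable_restrict _ mA mD).
      by apply: measurable_funS mh => //; exact: subIsetl.
    have cF : {ae mu, forall x, D x ->
        (h \_ (F n)) x @[n --> \oo] --> (h \_ (\bigcup_n F n)) x}.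
      apply: aeW => x Dx; rewrite patchE; case: ifPn => [/set_mem[N _ FNx]|xU].
        apply: cvg_near_cst; near=> n; rewrite patchE mem_set//.
        by move: x FNx {Dx}; apply/subsetPset/ndF; near: n; exact: nbhs_infty_ge.
      rewrite (_ : (fun n => _) = cst 0); first exact: cvg_cst.
      apply/funext => n; rewrite patchE; case: ifPn => // /set_mem Fnx.
      by exfalso; move/negP: xU; apply; apply/mem_set; exists n.
    have bF : {ae mu, forall x n, D x -> `|(h \_ (F n)) x| <= (abse \o h) x}.
      apply: aeW => x n Dx; rewrite patchE; case: ifPn => // _ /=.
      by change (`|0| <= `|h x|); rewrite abse0 abse_ge0.
    have [_ _] := dominated_convergence mD (fun n => mr _ (mF n)) (mr _ mU) cF
      (integrable_abse hD) bF.
    rewrite [X in X @ _ --> _ -> _](_ : _ = cst 0); last first.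
      by apply/funext => n /=; rewrite -integral_mkcondr; have [] := FL n.
    by move/cvg_lim => <-//; rewrite lim_cst.
have sub : <<s G>> `<=` L.
  by apply: (lambda_system_subset IG lambdaL) => // A GA; split; [exact: mG|exact: hG].
apply: (integral_ae_eq mD hD) => // E ED mE.
by have [_] := sub _ (Gm mE); rewrite setIidr// => ->; rewrite integral0.
Unshelve. all: by end_near. Qed.

End PiLambda.

Section Boxes.
Variables (R : realType) (n : nat).
Local Notation tup := (n.-tuple (measurableTypeR R)).
Local Notation mu := (lebesgue_tuple R n).
Implicit Types a b : 'I_n -> R.

Definition obox a b : set tup := [set t | forall i, a i < tnth t i < b i].

Lemma measurable_obox a b : measurable (obox a b).
Proof.
rewrite (_ : obox a b = \bigcap_(i in [set: 'I_n])
    ((@tnth n (measurableTypeR R))^~ i @^-1` `]a i, b i[%classic)).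
  apply: fin_bigcap_measurable => //= i _.
  by rewrite -[X in measurable X]setTI; exact: measurable_tnth.
apply/seteqP; split=> [t abt i _|t abt i] /=; first by rewrite in_itv/=; exact: abt.
by have := abt i Logic.I; rewrite /= in_itv.
Qed.

Definition oboxes : set (set tup) := [set A | exists a b, A = obox a b].

Lemma obox_setI a b a' b' : obox a b `&` obox a' b' =
  obox (fun i => Num.max (a i) (a' i)) (fun i => Num.min (b i) (b' i)).
Proof.
apply/seteqP; split=> [t [h h'] i|t h].
  have /andP[h1 h2] := h i; have /andP[h3 h4] := h' i.
  by rewrite gt_max lt_min h1 h2 h3 h4.
by split=> i; have := h i; rewrite gt_max lt_min => /andP[/andP[h1 h2] /andP[h3 h4]];
  apply/andP.
Qed.

Lemma setI_closed_oboxes : setI_closed oboxes.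
Proof. by move=> _ _ [a [b ->]] [a' [b' ->]]; rewrite obox_setI; do 2 eexists. Qed.

Lemma measurable_oboxes : measurable `<=` <<s oboxes >>.
Proof.
have : measurable_fun [set: g_sigma_algebraType oboxes] (id : _ -> tup).
  apply/measurable_fun_tnthP => i.
  apply: (measurability _ (RGenOInfty.measurableE R)) => _ [_ [x ->] <-].
  rewrite setTI (_ : _ @^-1` _ = \bigcup_k (obox
     (fun j => if j == i then x else - k%:R) (fun=> k%:R))).
    by apply: bigcupT_measurable => k; apply: sub_sigma_algebra; do 2 eexists.
  apply/seteqP; split=> [t|t [k _ /(_ i)]] /=; rewrite in_itv/= andbT; last first.
    by rewrite eqxx => /andP[].
  move=> xt; exists (\max_(j < n) (Num.truncn `|tnth t j|).+1)%N => // j.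
  have : `|tnth t j| < (\max_(j < n) (Num.truncn `|tnth t j|).+1)%N%:R.
    apply: lt_le_trans (truncnS_gt _) _; rewrite ler_nat.
    exact: (leq_bigmax (F := fun j => (Num.truncn `|tnth t j|).+1)).
  by rewrite ltr_norml => /andP[h1 h2]; rewrite h2 andbT; case: eqP => [->|_].
by move=> mid A mA; have := mid measurableT A mA; rewrite setTI.
Qed.

Definition tbump a b m (t : tup) : R := \prod_(i < n) bump (a i) (b i) m (tnth t i).

Lemma tbump_01 a b m t : 0 <= tbump a b m t <= 1.
Proof.
apply/andP; split; first by apply: prodr_ge0 => i _; have /andP[] := bump_01 (a i) (b i) m (tnth t i).
by apply: prodr_ile1 => i _; exact: bump_01.
Qed.

Lemma measurable_tbump a b m : measurable_fun setT (tbump a b m).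
Proof.
apply: measurable_prod => i _.
apply: (@measurableT_comp _ _ _ _ _ _ (bump (a i) (b i) m : measurableTypeR R -> R)).
  by apply: continuous_measurable_fun; apply: smooth_continuous; exact: smooth_bump.
exact: measurable_tnth.
Qed.

Lemma tbump_cvg a b t :
  (fun m => tbump a b m t) @ \oo --> (\1_(obox a b) t : R).
Proof.
have -> : \1_(obox a b) t = \prod_(i < n) ((a i < tnth t i < b i)%R : bool)%:R :> R.
  rewrite indicE; have [/set_mem h|h] := boolP (t \in obox a b).
    by rewrite big1// => i _; rewrite h.
  have /existsNP[i /negP/negbTE hi] : ~ obox a b t by move=> /mem_set; apply/negP.
  by rewrite (bigD1 i)//= hi mul0r.
apply: (cvg_big (P := xpredT)) => [|i _]; first exact: mul_continuous.
exact: bump_cvg.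
Qed.

Lemma du_bois_reymond a b (h : tup -> R) :
  mu.-integrable (obox a b) (EFin \o h) ->
  (forall a' b' m, (forall i, a i <= a' i) -> (forall i, b' i <= b i) ->
    (\int[mu]_(t in obox a b) (h t * tbump a' b' m t)%:E = 0)%E) ->
  ae_eq mu (obox a b) (EFin \o h) (cst 0%E).
Proof.
move=> ih h0; have mD := measurable_obox a b.
have mh := measurable_int _ ih; have mh' := (measurable_EFinP _ _).1 mh.
have key a' b' : (\int[mu]_(t in obox a b `&` obox a' b') (h t)%:E = 0)%E.
  pose A i := Num.max (a i) (a' i); pose B i := Num.min (b i) (b' i).
  have bD : {ae mu, forall t m, obox a b t ->
      `|(h t * tbump A B m t)%:E| <= (abse \o (EFin \o h)) t}%E.
    apply: aeW => t m _ /=; rewrite lee_fin normrM ler_piMr//.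
    by have /andP[? ?] := tbump_01 A B m t; rewrite ger0_norm.
  have mb m : measurable_fun (obox a b) (fun t => (h t * tbump A B m t)%:E).
    apply/measurable_EFinP/measurable_funM => //.
    by apply: measurable_funTS; exact: measurable_tbump.
  have mr : measurable_fun (obox a b) (fun t => (h t * \1_(obox A B) t)%:E).
    by apply/measurable_EFinP/measurable_funM => //; apply: measurable_funTS;
      apply: measurable_indic; exact: measurable_obox.
  have cb : {ae mu, forall t, obox a b t ->
      (h t * tbump A B m t)%:E @[m --> \oo] --> (h t * \1_(obox A B) t)%:E}.
    apply: aeW => t _; apply: cvg_EFin; first by apply: nearW.
    by apply: cvgMl_tmp; exact: tbump_cvg.
  have [_ _] := dominated_convergence mD mb mr cb (integrable_abse ih) bD.
  rewrite [X in X @ _ --> _ -> _](_ : _ = cst 0%E); last first.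
    apply/funext => m /=; apply: h0 => i; first by rewrite le_max lexx.
    by rewrite ge_min lexx.
  move/cvg_lim => /(_ (@ereal_hausdorff R)); rewrite lim_cst// => ->.
  rewrite integral_mkcondr; apply: eq_integral => t /set_mem tab.
  rewrite patchE -obox_setI indicE in_setI (mem_set tab)/=.
  by case: (t \in obox a' b'); rewrite ?mulr1 ?mulr0.
apply: (integral_pi_system_ae_eq0 mD ih _ setI_closed_oboxes _ measurable_oboxes).
- by have := key a b; rewrite setIid.
- by move=> _ [a' [b' ->]]; exact: measurable_obox.
- by move=> _ [a' [b' ->]]; exact: key.
Qed.

End Boxes.

Section CompactSupport.
Variable R : realType.
Implicit Types (f : R -> R) (a b : R).

Lemma derive1_supported f a b : smooth f ->
  (forall x, ~~ (a < x < b) -> f x = 0) ->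
  forall x, ~~ (a < x < b) -> derive1 f x = 0.
Proof.
move=> sf f0.
have far x : x < a \/ b < x -> derive1 f x = 0.
  move=> xab; rewrite derive1E -(derive_cst (0 : R) x (1 : R)).
  apply: near_eq_derive; case: xab => xab; near=> y; apply: f0; rewrite negb_and -!leNgt.
  - by apply/orP; left; apply: ltW; near: y; exact: lt_nbhsl.
  - by apply/orP; right; apply: ltW; near: y; exact: lt_nbhsr.
have cf := smooth_continuous (smooth_derive1 sf).
have limit (s x : R) : (forall m : nat, derive1 f (x + s * m.+1%:R^-1) = 0) ->
    derive1 f x = 0.
  move=> fs0.
  have c1 : (fun m : nat => x + s * m.+1%:R^-1) @ \oo --> x.
    rewrite -[X in _ --> X]addr0 -(mulr0 s).
    by apply: cvgD; [exact: cvg_cst|apply: cvgMl_tmp; exact: cvg_harmonic].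
  have c2 := cvg_comp _ _ c1 (cf x).
  have E : derive1 f \o (fun m : nat => x + s * m.+1%:R^-1) = cst 0.
    by apply/funext => m; exact: fs0.
  rewrite -[fmap _ _]/(fmap (derive1 f \o (fun m : nat => x + s * m.+1%:R^-1)) _) E in c2.
  by rewrite -(cvg_lim (@Rhausdorff R) c2); exact: lim_cst.
move=> x; rewrite negb_and -!leNgt => /orP[xa|bx].
- apply: (limit (-1)) => m; apply: far; left.
  by rewrite (lt_le_trans _ xa)// mulN1r gtrBl invr_gt0.
- apply: (limit 1) => m; apply: far; right.
  by rewrite (le_lt_trans bx)// mul1r ltrDl invr_gt0.
Unshelve. all: by end_near. Qed.

Lemma derive1n_supported f a b k : smooth f ->
  (forall x, ~~ (a < x < b) -> f x = 0) ->
  forall x, ~~ (a < x < b) -> derive1n k f x = 0.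
Proof.
move=> sf f0; elim: k => [//|k IH] x xab.
by rewrite derive1nS; apply: (derive1_supported _ IH) => //; exact: smooth_derive1n.
Qed.

Lemma supported_bounded f a b : smooth f ->
  (forall x, ~~ (a < x < b) -> f x = 0) ->
  exists B, 0 <= B /\ forall x, `|f x| <= B.
Proof.
move=> sf f0; have [ab|ba] := leP a b; last first.
  exists 0; split=> // x; rewrite f0 ?normr0//.
  by apply/negP => /andP[ax xb]; have := lt_trans (lt_trans ax xb) ba; rewrite ltxx.
have cf : {within `[a, b], continuous (fun x => `|f x|)}.
  apply: continuous_subspaceT => x.
  by apply: (continuous_comp (smooth_continuous sf (x := x))); exact: norm_continuous.
have [c _ fc] := EVT_max ab cf; exists `|f c|; split=> // x.
have [xab|/f0->] := boolP (a < x < b); last by rewrite normr0.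
by apply: fc; rewrite in_itv/=; case/andP: xab => /ltW-> /ltW->.
Qed.

Lemma integral_derive_product (phi phi' e : R -> R) a b :
  (forall x, a <= x <= b -> is_derive x 1 phi (phi' x)) ->
  (forall x, a <= x <= b -> {for x, continuous phi'}) ->
  smooth e -> e a = 0 -> e b = 0 ->
  (\int[lebesgue_measure]_(x in `]a, b[)
     (phi x * derive1 e x + phi' x * e x)%:E = 0)%E.
Proof.
move=> dphi cphi' se ea eb; have [ab|ba] := ltP a b; last first.
  by rewrite set_itv_ge ?integral_set0// bnd_simp -leNgt.
pose F x := phi x * e x; pose f x := phi x * derive1 e x + phi' x * e x.
have dF x : a <= x <= b -> is_derive x 1 F (f x).
  move=> xab.
  have de : is_derive x 1 e (derive1 e x).
    by rewrite derive1E; apply: DeriveDef => //; exact: smooth_derivable.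
  apply: (is_derive_eq (is_deriveM (dphi _ xab) de)).
  by rewrite /f [phi' x * _]mulrC.
have cphi x : a <= x <= b -> {for x, continuous phi}.
  move=> /dphi[h _]; exact/differentiable_continuous/derivable1_diffP.
have cf x : a <= x <= b -> {for x, continuous f}.
  move=> xab; apply: cvgD; apply: cvgM.
  - exact: cphi.
  - exact/smooth_continuous/smooth_derive1.
  - exact: cphi'.
  - exact: smooth_continuous.
have cfw : {within `[a, b], continuous f}.
  by apply: continuous_in_subspaceT => x; rewrite inE /= in_itv/= => /cf.
have cF x : a <= x <= b -> {for x, continuous F}.
  move=> /dF[h _]; exact/differentiable_continuous/derivable1_diffP.
have oo x : x \in `]a, b[ -> a <= x <= b.
  by rewrite in_itv/= => /andP[/ltW-> /ltW->].
have dFo : derivable_oo_LRcontinuous F a b.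
  split=> [x /oo /dF[]//||].
  - by apply: cvg_at_right_filter; apply: cF; rewrite lexx ltW.
  - by apply: cvg_at_left_filter; apply: cF; rewrite lexx ltW.
have F'f : {in `]a, b[, derive1 F =1 f}.
  by move=> x /oo /dF[_]; rewrite derive1E.
change (\int[lebesgue_measure]_(x in `]a, b[) (f x)%:E = 0)%E.
have mf : measurable_fun `]a, b[ (fun x => (f x)%:E).
  apply/measurable_EFinP; apply: open_continuous_measurable_fun => // x.
  by rewrite inE => /oo /cf.
rewrite -(@integral_itv_bndoo R a b (fun x => (f x)%:E) true false mf).
by rewrite (continuous_FTC2 ab cfw dFo F'f) /F ea eb !mulr0 subee.
Qed.

End CompactSupport.

Section PlaneMeasurable.
Variables (R : realType) (n : nat) (i0 i1 : 'I_n).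
Local Notation tup := (n.-tuple (measurableTypeR R)).

Definition tplane (t : tup) : R[i] := plane i0 i1 (row_of t).

Lemma tplaneE t : tplane t = (tnth t i0 +i* tnth t i1)%C.
Proof. by rewrite /tplane /plane !mxE. Qed.

Lemma measurable_tplaneX m :
  measurable_fun setT (fun t => Re (tplane t ^+ m)) /\
  measurable_fun setT (fun t => Im (tplane t ^+ m)).
Proof.
have m0 : measurable_fun setT (fun t : tup => Re (tplane t)).
  rewrite (_ : (fun t => _) = (fun t => tnth t i0)); first exact: measurable_tnth.
  by apply/funext => t; rewrite tplaneE.
have m1 : measurable_fun setT (fun t : tup => Im (tplane t)).
  rewrite (_ : (fun t => _) = (fun t => tnth t i1)); first exact: measurable_tnth.
  by apply/funext => t; rewrite tplaneE.
elim: m => [|m [IH1 IH2]]; first by split; exact: measurable_cst.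
split.
- rewrite (_ : (fun t => _) = (fun t => Re (tplane t) * Re (tplane t ^+ m) -
    Im (tplane t) * Im (tplane t ^+ m))).
    by apply: measurable_funB; exact: measurable_funM.
  by apply/funext => t; rewrite exprS ReM.
- rewrite (_ : (fun t => _) = (fun t => Re (tplane t) * Im (tplane t ^+ m) +
    Im (tplane t) * Re (tplane t ^+ m))).
    by apply: measurable_funD; exact: measurable_funM.
  by apply/funext => t; rewrite exprS ImM.
Qed.

Lemma measurable_psre (c : nat -> R) e (D : set tup) : radius1 c e -> measurable D ->
  (forall t, D t -> normc (tplane t) < 1) ->
  measurable_fun D (fun t => psre c e (tplane t)).
Proof.
move=> ce mD D1.
apply: (measurable_fun_cvg
  (fun N => _ : measurable_fun D (fun t => \sum_(1 <= j < N) (c j * Re (tplane t ^+ e j))))).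
- move=> N; apply: measurable_sum => j; apply: measurable_funTS.
  by apply: measurable_funM => //; exact: (measurable_tplaneX _).1.
- by move=> t /D1 t1; exact: (ps_cvg ce t1).1.
Qed.

Lemma psre_bounded (c : nat -> R) e (rho : R) : radius1 c e -> 0 <= rho < 1 ->
  exists B, forall z, normc z <= rho -> `|psre c e z| <= B.
Proof.
move=> ce rho01; have [B cB] := ce _ rho01; exists B => z zr.
apply: (bounded_series_lim _ cB) => j; rewrite normrM ler_wpM2l//.
apply: le_trans (Re_le_normc _) _; rewrite normcX lerXn2r ?nnegrE ?normc_ge0//.
by case/andP: rho01.
Qed.

Definition ttensor (e : 'I_n -> R -> R) (t : tup) : R := \prod_(i < n) e i (tnth t i).

Lemma tensor_row_of e t : tensor e (row_of t) = ttensor e t.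
Proof. by apply: eq_bigr => i _; rewrite mxE. Qed.

Lemma measurable_ttensor e : (forall i, smooth (e i)) -> measurable_fun setT (ttensor e).
Proof.
move=> se; apply: measurable_prod => i _.
apply: (@measurableT_comp _ _ _ _ _ _ (e i : measurableTypeR R -> R)).
  by apply: continuous_measurable_fun; exact: smooth_continuous.
exact: measurable_tnth.
Qed.

Lemma ttensor_bounded e (a b : 'I_n -> R) : (forall i, smooth (e i)) ->
  (forall i x, ~~ (a i < x < b i) -> e i x = 0) ->
  exists B, forall t, `|ttensor e t| <= B.
Proof.
move=> se e0.
have /choice[B HB] : forall i, exists B, 0 <= B /\ forall x, `|e i x| <= B.
  by move=> i; exact: (supported_bounded (se i) (e0 i)).
exists (\prod_(i < n) B i) => t; rewrite normr_prod.
by apply: ler_prod => i _; have [_ ->] := HB i; rewrite normr_ge0.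
Qed.

Lemma ttensor_out e (a b : 'I_n -> R) t :
  (forall i x, ~~ (a i < x < b i) -> e i x = 0) -> ~ obox a b t -> ttensor e t = 0.
Proof.
by move=> e0 /existsNP[i /negP/e0 ei]; rewrite /ttensor (bigD1 i)//= ei mul0r.
Qed.

Lemma obox_finite (a b : 'I_n -> R) : (lebesgue_tuple R n (obox a b) < +oo)%E.
Proof.
have -> : obox a b = [set t | forall i, `]a i, b i[%classic (tnth t i)].
  by apply/seteqP; split=> t /= tab i; have := tab i; rewrite in_itv.
rewrite (@lebesgue_tuple_box R n (fun i => `]a i, b i[%classic)).
  rewrite ltey_eq; apply/orP; left; elim/big_ind: _ => //.
    by move=> x y; exact: fin_numM.
  by move=> i _; rewrite lebesgue_measure_itv/=; case: ifP => _; rewrite -?EFinB.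
by move=> i; exact: measurable_itv.
Qed.

End PlaneMeasurable.

Section ByParts.
Variables (R : realType) (n : nat).
Local Notation tup := (n.+1.-tuple (measurableTypeR R)).
Local Notation mu := (lebesgue_tuple R n.+1).
Local Notation glue x t := (@cons_pair R n (x, t)).

Lemma row_of_cons (h x : R) t :
  row_of (glue (h + x) t) = h *: delta_mx 0 ord0 + row_of (glue x t).
Proof.
apply/rowP => i; rewrite !mxE /cons_pair/=.
case: (unliftP ord0 i) => [j ->|->]; first by rewrite !tnthS mulr0 add0r.
by rewrite !eqxx mulr1.
Qed.

Lemma is_derive_line (f : 'rV[R]_n.+1 -> R) (x : R) t d :
  is_derive (row_of (glue x t)) (delta_mx 0 ord0) f d ->
  is_derive x 1 (fun y : R => f (row_of (glue y t))) d.
Proof.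
have E : (fun h : R => h^-1 *: (((fun y : R => f (row_of (glue y t))) \o shift x) (h *: 1)
    - f (row_of (glue x t)))) = (fun h : R => h^-1 *: ((f \o shift (row_of (glue x t)))
    (h *: delta_mx 0 ord0) - f (row_of (glue x t)))).
  by apply/funext => h /=; rewrite -row_of_cons -[h *: 1]/(h * 1) mulr1.
by move=> [df <-]; split; rewrite /derivable /derive E.
Qed.

Lemma integral_tuple_fubini (W : tup -> R) : mu.-integrable setT (EFin \o W) ->
  (\int[mu]_t (W t)%:E =
   \int[lebesgue_tuple R n]_t \int[lebesgue_measure]_x (W (glue x t))%:E)%E.
Proof.
move=> iW; have mW := measurable_int _ iW.
have mc := @measurable_cons_pair R n.
have mWc : measurable_fun setT ((EFin \o W) \o @cons_pair R n).
  exact: measurableT_comp.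
have iWc : (lebesgue_measure \x lebesgue_tuple R n)%E.-integrable setT
    ((EFin \o W) \o @cons_pair R n).
  apply/integrableP; split=> //; have /integrableP[_] := iW.
  congr (_ < _)%E.
  rewrite -[LHS]/(\int[pushforward (lebesgue_measure \x lebesgue_tuple R n)%E
    (@cons_pair R n)]_x `|(EFin \o W) x|)%E.
  by rewrite (ge0_integral_pushforward mc)//; exact: measurableT_comp.
rewrite -[LHS]/(\int[pushforward (lebesgue_measure \x lebesgue_tuple R n)%E
    (@cons_pair R n)]_x (EFin \o W) x)%E.
rewrite (integral_pushforward mc)//.
by rewrite preimage_setT -(integral21_prod_meas1 iWc).
Qed.

Lemma integrable_obox (a b : 'I_n.+1 -> R) (f : tup -> R) B :
  measurable_fun (obox a b) f -> (forall t, obox a b t -> `|f t| <= B) ->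
  mu.-integrable (obox a b) (EFin \o f).
Proof.
move=> mf fB; apply: measurable_bounded_integrable => //.
- exact: measurable_obox.
- exact: obox_finite.
exists B; split; first exact: num_real.
by move=> M BM t abt; apply: le_trans (fB _ abt) (ltW BM).
Qed.

Variable i1 : 'I_n.+1.
Hypothesis i01 : ord0 != i1.
Local Notation tplane := (@tplane R n.+1 ord0 i1).
Variables (a b : 'I_n.+1 -> R) (rho : R).
Hypotheses (rho01 : 0 <= rho < 1)
  (ab_rho : forall x, box a b x -> normc (plane ord0 i1 x) <= rho).

Lemma obox_rho t : obox a b t -> normc (tplane t) <= rho.
Proof.
by move=> abt; apply: ab_rho => i; rewrite mxE; have /andP[/ltW-> /ltW->] := abt i.
Qed.

Lemma obox_lt1 t : obox a b t -> normc (tplane t) < 1.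
Proof. by move=> /obox_rho /le_lt_trans; apply; case/andP: rho01. Qed.

Lemma integrable_ps_tensor (c : nat -> R) e ee : radius1 c e -> (forall i, smooth (ee i)) ->
  (forall i x, ~~ (a i < x < b i) -> ee i x = 0) ->
  mu.-integrable (obox a b) (fun t => (psre c e (tplane t) * ttensor ee t)%:E).
Proof.
move=> ce se ee0; have [B1 HB1] := psre_bounded ce rho01.
have [B2 HB2] := ttensor_bounded se ee0.
apply: (@integrable_obox _ _ _ (B1 * B2)).
  apply: measurable_funM.
    by apply: measurable_psre => //; [exact: measurable_obox|exact: obox_lt1].
  by apply: measurable_funTS; exact: measurable_ttensor.
by move=> t /obox_rho tr; rewrite normrM ler_pM// HB1.
Qed.

Lemma ps_by_parts (c : nat -> R) e ee : radius1 c e -> (forall i, smooth (ee i)) ->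
  (forall i x, ~~ (a i < x < b i) -> ee i x = 0) ->
  (\int[mu]_(t in obox a b) (psre c e (tplane t) * ttensor (tensor_diff ord0 ee) t)%:E =
   - \int[mu]_(t in obox a b)
       (psre (dcoef c e) (dexpo e) (tplane t) * ttensor ee t)%:E)%E.
Proof.
move=> ce se ee0; have ce' := radius1_diff ce; have mO := measurable_obox a b.
have i1i := integrable_ps_tensor ce (tensor_diff_smooth ord0 se) _.
have {i1i} I1 : mu.-integrable (obox a b)
    (fun t => (psre c e (tplane t) * ttensor (tensor_diff ord0 ee) t)%:E).
  apply: i1i => i x xab; rewrite /tensor_diff; case: ifP => _; last exact: ee0.
  exact: (derive1_supported (se i) (ee0 i)).
have I2 := integrable_ps_tensor ce' se ee0.
pose w t := psre c e (tplane t) * ttensor (tensor_diff ord0 ee) t +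
  psre (dcoef c e) (dexpo e) (tplane t) * ttensor ee t.
have Iw : mu.-integrable (obox a b) (EFin \o w).
  rewrite (_ : EFin \o w = (fun t => (psre c e (tplane t) *
      ttensor (tensor_diff ord0 ee) t)%:E) \+ (fun t =>
      (psre (dcoef c e) (dexpo e) (tplane t) * ttensor ee t)%:E))%E.
    exact: integrableD.
  by apply/funext => t; rewrite /= EFinD.
suff w0 : (\int[mu]_(t in obox a b) (w t)%:E = 0)%E.
  have f1 := integrable_fin_num mO I1; have f2 := integrable_fin_num mO I2.
  move: w0; under eq_integral do rewrite /w EFinD.
  rewrite integralD// -(fineK f1) -(fineK f2) -EFinD => -[h].
  by rewrite -EFinN; congr EFin; apply/eqP; rewrite -addr_eq0 h.
pose V t := w t * \1_(obox a b) t.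
have VE : EFin \o V = (EFin \o w) \_ (obox a b).
  apply/funext => t; rewrite patchE /= /V indicE.
  by case: (t \in _); rewrite ?mulr1 ?mulr0.
rewrite -[LHS]/(\int[mu]_(t in obox a b) (EFin \o w) t)%E integral_mkcond -VE.
rewrite integral_tuple_fubini; last by rewrite VE; apply/(integrable_mkcond _ mO).
apply: integral0_eq => t _.
have mem x : obox a b (glue x t) <-> (a ord0 < x < b ord0) /\
    obox (a \o lift ord0) (b \o lift ord0) t.
  split=> [h|[h0 h] i].
    split; first exact: (h ord0).
    by move=> i; have := h (lift ord0 i); rewrite tnthS.
  by have [j ->|->] := unliftP ord0 i; [rewrite tnthS; exact: h|exact: h0].
have [tab|tab] := pselect (obox (a \o lift ord0) (b \o lift ord0) t); last first.
  apply: integral0_eq => x _; rewrite /V indicE memNset ?mulr0//.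
  by move=> /mem[].
pose P := \prod_(i < n) ee (lift ord0 i) (tnth t i).
pose phi x := psre c e (tplane (glue x t)) * P.
pose phi' x := psre (dcoef c e) (dexpo e) (tplane (glue x t)) * P.
have wE x : w (glue x t) = phi x * derive1 (ee ord0) x + phi' x * ee ord0 x.
  have T1 : ttensor (tensor_diff ord0 ee) (glue x t) = derive1 (ee ord0) x * P.
    rewrite /ttensor big_ord_recl; congr (_ * _).
    by apply: eq_bigr => i _; rewrite tnthS /tensor_diff eq_sym (negbTE (neq_lift _ _)).
  have T2 : ttensor ee (glue x t) = ee ord0 x * P.
    rewrite /ttensor big_ord_recl; congr (_ * _).
    by apply: eq_bigr => i _; rewrite tnthS.
  have alg (s s' p y y' : R) : s * (y * p) + s' * (y' * p) = s * p * y + s' * p * y'.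
    by ring.
  by rewrite /w T1 T2 alg.
transitivity (\int[lebesgue_measure]_(x in `]a ord0, b ord0[)
     (phi x * derive1 (ee ord0) x + phi' x * ee ord0 x)%:E)%E.
  rewrite [RHS]integral_mkcond; apply: eq_integral => x _; rewrite patchE /V indicE.
  case: ifPn => [/set_mem|/negP xab].
    rewrite /= in_itv/= => xab; rewrite mem_set ?mulr1 ?wE//.
    exact/mem.
  rewrite memNset ?mulr0//; move=> /mem[xab' _]; apply: xab; apply/mem_set.
  by rewrite /= in_itv.
have cyl x : a ord0 <= x <= b ord0 -> @cylinder R n.+1 ord0 i1 (row_of (glue x t)).
  move=> xab; apply: le_lt_trans (ab_rho _) _; last by case/andP: rho01.
  move=> i; rewrite mxE; have [j ->|->] := unliftP ord0 i; last by [].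
  by rewrite tnthS; have /andP[/ltW-> /ltW->] := tab j.
have dps c' e' x : radius1 c' e' -> a ord0 <= x <= b ord0 ->
    is_derive x 1 (fun x => psre c' e' (tplane (glue x t)) * P)
     (psre (dcoef c' e') (dexpo e') (tplane (glue x t)) * P).
  move=> ce1 xab.
  have [d1 _] := is_derive_ps i01 ce1 ord0 (cyl x xab).
  have := is_derive_line d1; rewrite eqxx (negbTE i01) mul1r mul0r subr0 => d2.
  have := is_deriveZ P d2.
  rewrite -[_ *: (_ : R)]/(_ * _) mulrC; congr is_derive.
  by apply/funext => y; rewrite mulrC.
apply: integral_derive_product => //.
- by move=> x xab; exact: dps.
- move=> x xab; have [h _] := dps _ _ x ce' xab.
  exact/differentiable_continuous/derivable1_diffP.
- by apply: ee0; rewrite ltxx.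
- by apply: ee0; rewrite ltxx andbF.
Qed.

(* The k-th derivative in z, which is also the k-th derivative in the coordinate
   x_1. *)
Fixpoint dpow k (c : nat -> R) (e : nat -> nat) :=
  if k is k'.+1 then dpow k' (dcoef c e) (dexpo e) else (c, e).

Lemma dpow_radius1 k c e : radius1 c e -> radius1 (dpow k c e).1 (dpow k c e).2.
Proof. by elim: k c e => [//|k IH] c e ce /=; exact/IH/radius1_diff. Qed.

Lemma dpow_expo k c e j : (dpow k c e).2 j = (e j - k)%N.
Proof. by elim: k c e => [|k IH] c e /=; rewrite ?subn0// IH /dexpo -subn1 -subnDA add1n. Qed.

Lemma dpow_coef k c e j : (dpow k c e).1 j = ((e j) ^_ k)%:R * c j.
Proof.
elim: k c e => [|k IH] c e /=; first by rewrite ffactn0 mul1r.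
by rewrite IH /dcoef /dexpo mulrA -natrM mulnC -ffactnS.
Qed.

Lemma ps_by_partsn k (c : nat -> R) e ee : radius1 c e -> (forall i, smooth (ee i)) ->
  (forall i x, ~~ (a i < x < b i) -> ee i x = 0) ->
  (\int[mu]_(t in obox a b) (psre c e (tplane t) *
       ttensor (fun i => if i == ord0 then derive1n k (ee i) else ee i) t)%:E =
   ((-1) ^+ k)%:E * \int[mu]_(t in obox a b)
       (psre (dpow k c e).1 (dpow k c e).2 (tplane t) * ttensor ee t)%:E)%E.
Proof.
move=> ce se ee0; elim: k c e ce => [|k IH] c e ce.
  rewrite expr0 mul1e; apply: eq_integral => t _; congr (_ * _)%:E.
  by apply: eq_bigr => i _; case: ifP.
pose ee' i := if i == ord0 then derive1n k (ee i) else ee i.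
have se' i : smooth (ee' i) by rewrite /ee'; case: ifP => _ //; exact: smooth_derive1n.
have ee'0 i x : ~~ (a i < x < b i) -> ee' i x = 0.
  move=> xab; rewrite /ee'; case: ifP => _; last exact: ee0.
  exact: (derive1n_supported _ (se i) (ee0 i)).
rewrite exprS mulN1r EFinN mulNe -(IH _ _ (radius1_diff ce)) -(ps_by_parts ce se' ee'0).
apply: eq_integral => t _; congr (_ * _)%:E; apply: eq_bigr => i _.
by rewrite /tensor_diff /ee'; case: (i == ord0).
Qed.

End ByParts.

Section WeakDerivative.
Variables (R : realType) (n : nat).
Local Notation tup := (n.+1.-tuple (measurableTypeR R)).
Local Notation mu := (lebesgue_tuple R n.+1).
Local Notation Omega := (unit_ball R n.+1).

Lemma measurable_enorm_row d (T : measurableType d) N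
    (f : T -> N.-tuple (measurableTypeR R)) (g : T -> N.-tuple (measurableTypeR R)) :
  measurable_fun setT f -> measurable_fun setT g ->
  measurable_fun setT (fun x => enorm (row_of (f x) - row_of (g x))).
Proof.
move=> mf mg; apply: (@measurableT_comp _ _ _ _ _ _ (@Num.sqrt R)).
  by apply: continuous_measurable_fun; exact: sqrt_continuous.
apply: measurable_sum => i; apply: measurable_funX.
rewrite (_ : (fun x => _) = (fun x => tnth (f x) i - tnth (g x) i)).
  by apply: measurable_funB; apply: (measurableT_comp (measurable_tnth i)).
by apply/funext => x; rewrite !mxE.
Qed.

Lemma measurable_unit_ball N : measurable (tuples_of (unit_ball R N)).
Proof.
have m : measurable_fun setT (fun t : N.-tuple (measurableTypeR R) => enorm (row_of t)).
  rewrite (_ : (fun t => _) = (fun t => enorm (row_of t - row_of (nseq_tuple N 0)))).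
    by apply: measurable_enorm_row => //; exact: measurable_cst.
  apply/funext => t; congr enorm; rewrite (_ : row_of (nseq_tuple N 0) = 0) ?subr0//.
  by apply/rowP => i; rewrite !mxE (tnth_nth 0)/= nth_nseq ltn_ord.
have := m measurableT _ (@measurable_itv R `]-oo, 1[); by rewrite setTI.
Qed.

Lemma integral_support d (T : measurableType d) (nu : {measure set T -> \bar R})
    (A B : set T) (f : T -> \bar R) :
  A `<=` B -> (forall x, B x -> ~ A x -> f x = 0%E) ->
  (\int[nu]_(x in B) f x = \int[nu]_(x in A) f x)%E.
Proof.
move=> AB f0; rewrite [LHS]integral_mkcond [RHS]integral_mkcond.
apply: eq_integral => x _; rewrite !patchE.
case: ifPn => [/set_mem Bx|/negP Bx]; case: ifPn => [/set_mem Ax|/negP Ax] //.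
  by apply: f0 => // Ax'; apply: Ax; exact/mem_set.
by exfalso; apply: Bx; apply/mem_set/AB.
Qed.

Variable i1 : 'I_n.+1.
Hypothesis i01 : ord0 != i1.
Local Notation tplane := (@tplane R n.+1 ord0 i1).
Variables (c : nat -> R) (e : nat -> nat) (k : nat).
Hypothesis ce : radius1 c e.
Variables (f g : 'rV[R]_n.+1 -> R).
Hypothesis fE : forall x, f x = psre c e (plane ord0 i1 x).
Hypotheses (gL2 : L2_on Omega g) (gw : weak_partials Omega (nseq k ord0) f g).
Local Notation fk t := (psre (dpow k c e).1 (dpow k c e).2 (tplane t)).

Section OnBox.
Variables (a b : 'I_n.+1 -> R) (rho : R).
Hypotheses (rho01 : 0 <= rho < 1) (ab_rho : forall x, box a b x -> enorm x <= rho).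

Let obox_Omega : obox a b `<=` tuples_of Omega.
Proof.
move=> t abt; rewrite /tuples_of /unit_ball /=.
apply: le_lt_trans (ab_rho _) _; last by case/andP: rho01.
by move=> i; rewrite mxE; have /andP[/ltW-> /ltW->] := abt i.
Qed.

Let plane_rho x : box a b x -> normc (plane ord0 i1 x) <= rho.
Proof. by move=> /ab_rho; apply: le_trans; exact: normc_plane_le. Qed.

Let mO := measurable_obox a b.

Let mg : measurable_fun (obox a b) (g \o @row_of R n.+1).
Proof.
by apply: measurable_funS gL2.1 => //; exact: measurable_unit_ball.
Qed.

Let integrable_g : mu.-integrable (obox a b) (EFin \o (g \o @row_of R n.+1)).
Proof.
have i1c : mu.-integrable (obox a b) (EFin \o (fun _ : tup => 1 : R)).
  by apply: (@integrable_obox _ _ _ _ _ 1) => // t _; rewrite normr1.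
have i2 : mu.-integrable (obox a b) (EFin \o (fun t : tup => g (row_of t) ^+ 2)).
  apply/integrableP; split; first by apply/measurable_EFinP/measurable_funX.
  apply: le_lt_trans gL2.2; under eq_integral do rewrite /= ger0_norm ?sqr_ge0//.
  apply: ge0_subset_integral => //.
  - exact: measurable_unit_ball.
  - by apply/measurable_EFinP/measurable_funX; exact: gL2.1.
  - by move=> t _; rewrite lee_fin sqr_ge0.
apply: (le_integrable mO _ _ (integrableD mO i1c i2)); first exact/measurable_EFinP.
move=> t _; change (`|g (row_of t)|%:E <= `|1 + g (row_of t) ^+ 2|%:E)%E.
rewrite lee_fin [leRHS]ger0_norm ?addr_ge0 ?sqr_ge0//.
rewrite -(real_normK (num_real (g (row_of t)))).
have := sqr_ge0 (`|g (row_of t)| - 1); have := normr_ge0 (g (row_of t)).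
by rewrite sqrrB expr1n mulr1; set x := `|_|; nra.
Qed.

Lemma weak_derivative_ae_box :
  ae_eq mu (obox a b) (EFin \o (g \o @row_of R n.+1)) (fun t => (fk t)%:E).
Proof.
have cek := dpow_radius1 k ce.
pose h t := g (row_of t) - fk t.
have mfk : measurable_fun (obox a b) (fun t => fk t).
  by apply: measurable_psre => // t; exact: (obox_lt1 rho01 plane_rho).
have [B HB] := psre_bounded cek rho01.
have ifk : mu.-integrable (obox a b) (EFin \o (fun t => fk t)).
  apply: (@integrable_obox _ _ _ _ _ B) => // t abt; apply: HB.
  exact: (obox_rho plane_rho).
have ih : mu.-integrable (obox a b) (EFin \o h).
  rewrite (_ : EFin \o h = (EFin \o (g \o @row_of R n.+1)) \- (EFin \o (fun t => fk t)))%E.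
    exact: integrableB.
  by apply/funext => t; rewrite /= EFinB.
have h0 : ae_eq mu (obox a b) (EFin \o h) (cst 0%E).
  apply: du_bois_reymond => // a' b' m aa' b'b.
  pose ee i := bump (a' i) (b' i) m.
  have se i : smooth (ee i) by exact: smooth_bump.
  have ee0 i x : ~~ (a i < x < b i) -> ee i x = 0.
    move=> xab; apply: bump_out; apply: contra xab => /andP[ax xb].
    by rewrite (le_lt_trans (aa' i) ax) (lt_le_trans xb (b'b i)).
  have ttE t : tbump a' b' m t = ttensor ee t by [].
  have boxO : box a b `<=` Omega.
    by move=> x /ab_rho /le_lt_trans; apply; case/andP: rho01.
  have tf := tensor_test_function se ee0 boxO.
  have := gw tf; rewrite size_nseq partials_tensor//.
  rewrite (@integral_support _ _ mu (obox a b) (tuples_of Omega)) //; last first.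
    move=> t _ tab; rewrite tensor_row_of (ttensor_out (a := a) (b := b)) ?mulr0// => i x xab.
    case: ifP => _; last exact: ee0.
    exact: (derive1n_supported _ (se i) (ee0 i)).
  rewrite [X in _ = (_ * X)%E -> _](@integral_support _ _ mu (obox a b) (tuples_of Omega)) //; last first.
    by move=> t _ tab; rewrite tensor_row_of (ttensor_out ee0 tab) mulr0.
  under eq_integral do rewrite fE tensor_row_of.
  under [X in _ = (_ * X)%E -> _]eq_integral do rewrite tensor_row_of.
  rewrite (ps_by_partsn i01 rho01 plane_rho k ce se ee0).
  have I1 := integrable_ps_tensor rho01 plane_rho cek se ee0.
  have I2 : mu.-integrable (obox a b) (fun t => (g (row_of t) * ttensor ee t)%:E).
    apply: (le_integrable mO _ _ integrable_g).
      apply/measurable_EFinP/measurable_funM => //.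
      by apply: measurable_funTS; exact: measurable_ttensor.
    move=> t _ /=; rewrite lee_fin normrM ler_piMr// -ttE.
    by have /andP[? ?] := tbump_01 a' b' m t; rewrite ger0_norm.
  have f1 := integrable_fin_num mO I1; have f2 := integrable_fin_num mO I2.
  rewrite -(fineK f1) -(fineK f2) => -[E].
  transitivity (\int[mu]_(t in obox a b) ((g (row_of t) * ttensor ee t)%:E -
     (fk t * ttensor ee t)%:E))%E.
    by apply: eq_integral => t _; rewrite /h mulrBl EFinB.
  rewrite integralB// -(fineK f1) -(fineK f2) -EFinB; congr EFin; apply/eqP.
  by rewrite subr_eq0; apply/eqP; apply: (mulfI _ (esym E)); rewrite signr_eq0.
apply: filterS h0 => t h0t abt; have := h0t abt; rewrite /h /= => -[/eqP].
by rewrite subr_eq0 => /eqP ->.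
Qed.

End OnBox.

Lemma weak_derivative_ae :
  ae_eq mu (tuples_of Omega) (EFin \o (g \o @row_of R n.+1)) (fun t => (fk t)%:E).
Proof.
(* The ball is covered by the countably many boxes ](l_i - 1)/m, (l_i + 1)/m[
   with integer l_i contained in a smaller ball. *)
pose lo (p : {ffun 'I_n.+1 -> int} * nat) (i : 'I_n.+1) : R := ((p.1 i)%:~R - 1) / p.2.+1%:R.
pose hi (p : {ffun 'I_n.+1 -> int} * nat) (i : 'I_n.+1) : R := ((p.1 i)%:~R + 1) / p.2.+1%:R.
pose good p := exists rho, 0 <= rho < 1 /\ forall x, box (lo p) (hi p) x -> enorm x <= rho.
pose bad m := if unpickle m is Some p then
  [set t : tup | good p /\ obox (lo p) (hi p) t /\
     (EFin \o (g \o @row_of R n.+1)) t <> (fk t)%:E] else set0.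
have negl_bad m : mu.-negligible (bad m).
  rewrite /bad; case: unpickle => [p|]; last exact: negligible_set0.
  have [[rho [rho01 prho]]|ngood] := pselect (good p); last first.
    by apply: (negligibleS _ (negligible_set0 _)) => t [].
  apply: (negligibleS _ (weak_derivative_ae_box rho01 prho)) => t [_ [tp E]] /=.
  by apply: contra_not E => /(_ tp).
apply: (negligibleS _ (negligible_bigcup negl_bad)) => t /= /not_implyP[tO gf].
have t1 : \sum_i tnth t i ^+ 2 < 1.
  have := tO; rewrite /tuples_of /unit_ball /= /enorm => h.
  have : \sum_i row_of t 0 i ^+ 2 < 1.
    have s0 : 0 <= \sum_i row_of t 0 i ^+ 2 by apply: sumr_ge0 => i _; exact: sqr_ge0.
    by rewrite -[ltLHS]sqr_sqrtr// expr_lt1 ?sqrtr_ge0.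
  by rewrite (eq_bigr (fun i => tnth t i ^+ 2))// => i _; rewrite mxE.
set S := \sum_i _ in t1.
have ti i : `|tnth t i| <= 1.
  rewrite -(@ler_pXn2r _ 2) ?nnegrE// expr1n real_normK ?num_real//.
  apply: le_trans (ltW t1); rewrite /S (bigD1 i)//= lerDl.
  by apply: sumr_ge0 => j _; exact: sqr_ge0.
have N0 : (0 : R) < 8 * n.+1%:R by rewrite mulr_gt0.
have [m Sm] : exists m : nat, S + (8 * n.+1%:R) / m.+1%:R < 1.
  have [|m] := @ltr_add_invr R 0 ((1 - S) / (8 * n.+1%:R)).
    by rewrite divr_gt0// subr_gt0.
  rewrite add0r ltr_pdivlMr// => h; exists m.
  by rewrite addrC -ltrBrDr mulrC.
pose p : {ffun 'I_n.+1 -> int} * nat := ([ffun i => Num.floor (tnth t i * m.+1%:R)], m).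
have m0 : (0 : R) < m.+1%:R by [].
have fl i : (Num.floor (tnth t i * m.+1%:R))%:~R <= tnth t i * m.+1%:R <
    (Num.floor (tnth t i * m.+1%:R))%:~R + 1.
  by rewrite floor_le_tmp/= -intrD1 floorD1_gt.
exists (pickle p) => //; rewrite /bad pickleK; split; last split=> //.
- have R0 : 0 <= S + (8 * n.+1%:R) / m.+1%:R.
    rewrite addr_ge0 ?divr_ge0 ?(ltW N0)//.
    by apply: sumr_ge0 => j _; exact: sqr_ge0.
  exists (Num.sqrt (S + (8 * n.+1%:R) / m.+1%:R)); split.
    rewrite sqrtr_ge0/= -(@ltr_pXn2r _ 2) ?nnegrE ?sqrtr_ge0//.
    by rewrite sqr_sqrtr ?expr1n.
  move=> x xp; rewrite /enorm ler_sqrt//.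
  have -> : S + (8 * n.+1%:R) / m.+1%:R =
      \sum_(i < n.+1) (tnth t i ^+ 2 + 8 / m.+1%:R).
    rewrite big_split/= sumr_const card_ord -mulr_natr; congr (_ + _); ring.
  apply: ler_sum => i _; have := xp i; rewrite /lo /hi ffunE /=.
  have /andP[] := fl i; have := ti i.
  move: (tnth t i) (x 0 i) ((Num.floor _)%:~R : R) => y z w.
  rewrite ler_norml ler_pdivrMr// ler_pdivlMr// => /andP[y1 y2] h1 h2 /andP[h3 h4].
  have v0 : 0 < m.+1%:R^-1 :> R by rewrite invr_gt0.
  have v1 : m.+1%:R^-1 <= 1 :> R by rewrite invf_le1// ler1n.
  have vm : m.+1%:R * m.+1%:R^-1 = 1 :> R by rewrite mulfV.
  move: vm v0 v1 h1 h2 h3 h4 m0; set v := m.+1%:R^-1; move: (m.+1%:R) v => M v.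
  move=> vm v0 v1 h1 h2 h3 h4 M0.
  have a1 : z - y <= 2 * v.
    have : (z - y) * M * v <= 2 * v by rewrite ler_wpM2r ?ltW//; lra.
    by rewrite -mulrA vm mulr1.
  have a2 : - (2 * v) <= z - y.
    have : - 2 * v <= (z - y) * M * v by rewrite ler_wpM2r ?ltW//; lra.
    by rewrite -mulrA vm mulr1 mulNr.
  have -> : z ^+ 2 = y ^+ 2 + (z - y) * (z - y + 2 * y) by ring.
  rewrite lerD2l; apply: le_trans (ler_norm _) _; rewrite normrM.
  have -> : 8 * v = (2 * v) * 4 by ring.
  rewrite ler_pM// ler_norml; apply/andP; split; lra.
- move=> i; rewrite /lo /hi ffunE /=.
  have /andP[h1 h2] := fl i.
  by rewrite ltr_pdivrMr// ltr_pdivlMr//; apply/andP; split; lra.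
Qed.

End WeakDerivative.

(** * Rotations by dyadic roots of unity *)

Section DyadicRootsOfUnity.
Variable R : realType.
Implicit Types (z w : R[i]).

Lemma dyadic_root M : exists omega : R[i], omega ^+ (2 ^ M) = -1.
Proof.
elim: M => [|M [omega IH]]; first by exists (-1); rewrite expr1.
by exists (sqrtc omega); rewrite expnS exprM sqr_sqrtc.
Qed.

Variables (M : nat) (omega : R[i]).
Hypothesis omegaM : omega ^+ (2 ^ M.+1) = -1.
Local Notation L := (2 ^ M.+2)%N.

Lemma omega_order : omega ^+ L = 1.
Proof. by rewrite expnS mulnC exprM omegaM sqrrN expr1n. Qed.

Lemma omega_normc : normc omega = 1.
Proof.
have : normc omega ^+ (2 ^ M.+1) = 1 by rewrite -normcX omegaM normcN normc1.
move/eqP; rewrite -[X in _ == X](expr1n _ (2 ^ M.+1)) eqrXn2 ?normc_ge0 ?expn_gt0//.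
by move/eqP.
Qed.

Lemma omega_neq1 a : (0 < a < L)%N -> omega ^+ a != 1.
Proof.
move=> /andP[a0 aL]; apply/eqP => oa.
have [m m2 am] := pfactor_coprime (isT : prime 2) a0.
set v := logn 2 a in am.
have vM : (v <= M.+1)%N.
  rewrite -ltnS -(@ltn_exp2l 2)//; apply: leq_ltn_trans aL.
  by rewrite am leq_pmull// lt0n; apply: contraTneq m2 => ->.
have : (omega ^+ a) ^+ (2 ^ (M.+1 - v)) = -1.
  rewrite -exprM am -mulnA -expnD subnKC// mulnC exprM omegaM -signr_odd.
  by move: m2; rewrite coprime2n => ->; rewrite expr1.
rewrite oa expr1n => /eqP; rewrite -subr_eq0 opprK (_ : 1 + 1 = 2%:R)//.
by rewrite pnatr_eq0.
Qed.

Lemma omega_pow_big j : (M.+1 < j)%N -> omega ^+ (2 ^ j) = 1.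
Proof. by move=> Mj; rewrite -(subnKC Mj) expnD exprM omega_order expr1n. Qed.

Lemma omega_unit : omega \is a GRing.unit.
Proof.
rewrite unitfE; apply/eqP => o0; have := omega_normc.
by rewrite o0 normc0 => /eqP; rewrite eq_sym oner_eq0.
Qed.

Lemma omega_dyadic_shift_neq k J j : (k <= 2 ^ J)%N -> (k <= 2 ^ j)%N ->
  (J <= M)%N -> j != J -> omega ^+ (2 ^ J - k) != omega ^+ (2 ^ j - k).
Proof.
move=> kJ kj JM jJ.
have ok := unitrX k omega_unit.
rewrite -(inj_eq (mulIr ok)) -!exprD !subnK//.
have JL : (2 ^ J < L)%N by rewrite ltn_exp2l// ltnS (leq_trans JM).
have [Mj|jM] := ltnP M.+1 j.
  by rewrite (omega_pow_big Mj) omega_neq1// expn_gt0.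
have jL : (2 ^ j < L)%N by rewrite ltn_exp2l.
have oJ := unitrX (2 ^ J) omega_unit; have oj := unitrX (2 ^ j) omega_unit.
case: (ltngtP j J) jJ => // [jJ|Jj] _.
- have lt : (2 ^ j < 2 ^ J)%N by rewrite ltn_exp2l.
  rewrite -(subnK (ltnW lt)) exprD -[X in _ != X]mul1r (inj_eq (mulIr oj)).
  by rewrite omega_neq1// subn_gt0 lt/= (leq_ltn_trans (leq_subr _ _)).
- have lt : (2 ^ J < 2 ^ j)%N by rewrite ltn_exp2l.
  rewrite eq_sym -(subnK (ltnW lt)) exprD -[X in _ != X]mul1r (inj_eq (mulIr oJ)).
  by rewrite omega_neq1// subn_gt0 lt/= (leq_ltn_trans (leq_subr _ _)).
Qed.

Lemma omega_dyadic_shift_mul k J j : (2 * k < 2 ^ J)%N -> (k <= 2 ^ j)%N ->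
  (J <= M)%N -> omega ^+ (2 ^ J - k) * omega ^+ (2 ^ j - k) != 1.
Proof.
move=> kJ kj JM; rewrite -exprD.
have [Mj|jM] := ltnP M.+1 j.
  have -> : ((2 ^ J - k) + (2 ^ j - k) = 2 ^ j + (2 ^ J - 2 * k))%N by lia.
  rewrite exprD (omega_pow_big Mj) mul1r omega_neq1// subn_gt0 kJ/=.
  by rewrite (leq_ltn_trans (leq_subr _ _))// ltn_exp2l// ltnS (leq_trans JM).
rewrite omega_neq1//; apply/andP; split; first by lia.
have : (2 ^ J <= 2 ^ M)%N by rewrite leq_exp2l.
have : (2 ^ j <= 2 ^ M.+1)%N by rewrite leq_exp2l.
have : (0 < 2 ^ M)%N by rewrite expn_gt0.
by rewrite !expnS; lia.
Qed.

Lemma unity_sum0 z : z ^+ L = 1 -> z != 1 -> \sum_(l < L) z ^+ l = 0.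
Proof.
move=> zL z1; have /eqP := subrX1 z L; rewrite zL subrr eq_sym mulf_eq0 subr_eq0.
by rewrite (negbTE z1) => /eqP.
Qed.

Lemma ReM2 z w : 2 * (Re z * Re w) = Re (z * w) + Re (z * conjc w).
Proof. by case: z => a b; case: w => c d /=; ring. Qed.

Lemma Re_sum (I : Type) (r : seq I) (P : pred I) (F : I -> R[i]) :
  Re (\sum_(i <- r | P i) F i) = \sum_(i <- r | P i) Re (F i).
Proof. by elim/big_rec2: _ => // i x y _ <-; rewrite ReD. Qed.

Lemma omega_conj m : omega ^+ m * conjc (omega ^+ m) = 1.
Proof.
have : normc (omega ^+ m) = 1 by rewrite normcX omega_normc expr1n.
case: (omega ^+ m) => x y /= xy1; apply/eqP; rewrite eq_complex /=.
rewrite mulrN opprK mulrN [y * x]mulrC addNr eqxx andbT -!expr2.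
by rewrite -[X in X == _]sqr_sqrtr ?addr_ge0 ?sqr_ge0// xy1 expr1n.
Qed.

(* With B = z^m, this is Re ((omega^l z)^m). *)
Definition twist m (B : R[i]) (l : nat) : R := Re (omega ^+ (l * m) * B).

Lemma twist_inner m m' A B :
  2 * \sum_(l < L) (twist m A l * twist m' B l) =
  Re (A * B * \sum_(l < L) (omega ^+ m * omega ^+ m') ^+ l) +
  Re (A * conjc B * \sum_(l < L) (omega ^+ m * conjc (omega ^+ m')) ^+ l).
Proof.
rewrite !mulr_sumr !Re_sum -big_split /=; apply: eq_bigr => l _.
have E p : omega ^+ (l * p) = (omega ^+ p) ^+ l by rewrite mulnC exprM.
rewrite /twist ReM2 !E; move: (omega ^+ m) (omega ^+ m') => u v.
rewrite !exprMn [in X in _ + Re X]rmorphM/= rmorphXn/=.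
by congr (Re _ + Re _); rewrite mulrACA mulrC.
Qed.

Lemma twist_orthogonal m m' A B :
  omega ^+ m != omega ^+ m' -> omega ^+ m * omega ^+ m' != 1 ->
  \sum_(l < L) (twist m A l * twist m' B l) = 0.
Proof.
move=> mm' mm1; apply: (mulfI (_ : 2 != 0 :> R)); first by rewrite pnatr_eq0.
have oL p : (omega ^+ p) ^+ L = 1 by rewrite exprAC omega_order expr1n.
rewrite twist_inner unity_sum0//; last by rewrite exprMn !oL mulr1.
rewrite unity_sum0 ?mulr0 ?addr0//.
- by rewrite exprMn oL mul1r -rmorphXn/= oL conjc1.
- apply: contra mm' => /eqP h; apply/eqP.
  by rewrite -[LHS]mulr1 -(omega_conj m') mulrCA h mulr1.
Qed.

Lemma twist_norm m A : omega ^+ m * omega ^+ m != 1 ->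
  \sum_(l < L) twist m A l ^+ 2 = L%:R / 2 * normc A ^+ 2.
Proof.
move=> mm1; apply: (mulfI (_ : 2 != 0 :> R)); first by rewrite pnatr_eq0.
have oL p : (omega ^+ p) ^+ L = 1 by rewrite exprAC omega_order expr1n.
under eq_bigr do rewrite expr2.
rewrite twist_inner unity_sum0//; last by rewrite exprMn !oL mulr1.
rewrite mulr0 add0r omega_conj.
under eq_bigr do rewrite expr1n.
rewrite sumr_const card_ord; case: A => x y.
rewrite -mulr_natr mul1r mulrC Re_natM /= sqr_sqrtr ?addr_ge0 ?sqr_ge0//.
by field.
Qed.

Lemma bessel J0 (a : nat -> R) (m : nat -> nat) (B : nat -> R[i]) (F : nat -> R) :
  (0 < J0)%N ->
  (forall J j, (J0 <= J <= M)%N -> (0 < j)%N -> a j != 0 -> j != J ->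
     omega ^+ m J != omega ^+ m j) ->
  (forall J j, (J0 <= J <= M)%N -> (0 < j)%N -> a j != 0 ->
     omega ^+ m J * omega ^+ m j != 1) ->
  (forall J, (J0 <= J <= M)%N -> a J != 0) ->
  (forall l, (fun N => \sum_(1 <= j < N) (a j * twist (m j) (B j) l)) @ \oo --> F l) ->
  L%:R / 2 * \sum_(J0 <= J < M.+1) (a J ^+ 2 * normc (B J) ^+ 2) <=
  \sum_(l < L) F l ^+ 2.
Proof.
move=> J00 neqm neq1 a0 FE.
pose v j l := twist (m j) (B j) l.
pose G (l : nat) := \sum_(J0 <= J < M.+1) (a J * v J l).
have orth J j : (J0 <= J <= M)%N -> (0 < j)%N -> j != J ->
    a j * (\sum_(l < L) (v j l * v J l)) = 0.
  move=> JM j0 jJ; have [->|aj] := eqVneq (a j) 0; first by rewrite mul0r.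
  rewrite twist_orthogonal ?mulr0//; first by rewrite eq_sym neqm.
  by rewrite mulrC neq1.
have norm J : (J0 <= J <= M)%N ->
    \sum_(l < L) (v J l * v J l) = L%:R / 2 * normc (B J) ^+ 2.
  move=> JM; rewrite -(@twist_norm (m J)); last first.
    by apply: neq1 => //; [rewrite (leq_trans J00)//; case/andP: JM|exact: a0].
  by apply: eq_bigr => l _; rewrite expr2.
have inner J : (J0 <= J <= M)%N ->
    \sum_(l < L) (F l * v J l) = a J * (L%:R / 2 * normc (B J) ^+ 2).
  move=> JM; have J1 : (0 < J)%N by rewrite (leq_trans J00)//; case/andP: JM.
  have c1 : (fun N => \sum_(l < L) ((\sum_(1 <= j < N) (a j * v j l)) * v J l)) @ \oo -->
      \sum_(l < L) (F l * v J l).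
    apply: (cvg_big (P := xpredT)) => [|l _].
      exact: add_continuous.
    by apply: cvgMr_tmp; exact: FE.
  rewrite -(cvg_lim (@Rhausdorff R) c1); apply: cvg_lim => //.
  apply: cvg_near_cst; near=> N.
  under eq_bigr do rewrite mulr_suml.
  rewrite exchange_big /= (bigD1_seq J)/= ?iota_uniq//; last first.
    by rewrite mem_index_iota J1/=; near: N; exact: nbhs_infty_gt.
  rewrite [X in _ + X]big_nat_cond [X in _ + X]big1; last first.
    move=> j /andP[/andP[j0 _] jJ].
    by under eq_bigr do rewrite -mulrA; rewrite -mulr_sumr orth.
  by under eq_bigr do rewrite -mulrA; rewrite -mulr_sumr norm// addr0.
set S := \sum_(J0 <= J < M.+1) _.
have FG : \sum_(l < L) (F l * G l) = L%:R / 2 * S.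
  under eq_bigr do rewrite /G mulr_sumr.
  rewrite exchange_big /= /S mulr_sumr; apply: eq_big_nat => J JM.
  under eq_bigr do rewrite mulrCA.
  by rewrite -mulr_sumr inner//; ring.
have GG : \sum_(l < L) (G l * G l) = L%:R / 2 * S.
  under eq_bigr do rewrite {2}/G mulr_sumr.
  rewrite exchange_big /= /S mulr_sumr; apply: eq_big_nat => J JM.
  have JM' : (J0 <= J <= M)%N by [].
  under eq_bigr do rewrite mulrCA.
  rewrite -mulr_sumr; under eq_bigr do rewrite /G mulr_suml.
  rewrite exchange_big /= (bigD1_seq J)/= ?iota_uniq ?mem_index_iota//.
  rewrite [X in _ + X]big_nat_cond [X in _ + X]big1; last first.
    move=> j /andP[/andP[j0 _] jJ].
    under eq_bigr do rewrite -mulrA; rewrite -mulr_sumr orth//.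
    exact: leq_trans j0.
  under eq_bigr do rewrite -mulrA.
  by rewrite -mulr_sumr norm// addr0; ring.
(* G is the orthogonal projection of F on the frequencies m_J, J0 <= J <= M. *)
have : 0 <= \sum_(l < L) (F l - G l) ^+ 2 by apply: sumr_ge0 => l _; exact: sqr_ge0.
have -> : \sum_(l < L) (F l - G l) ^+ 2 = \sum_(l < L) F l ^+ 2 - 2 * (\sum_(l < L) (F l * G l)) +
    \sum_(l < L) (G l * G l).
  rewrite mulr_sumr -sumrB -big_split /=; apply: eq_bigr => l _; ring.
by rewrite FG GG; lra.
Unshelve. all: by end_near. Qed.

End DyadicRootsOfUnity.

(** * Lower bounds on a shell near the sphere *)

Section ShellVolume.
Variables (R : realType) (n : nat).
Local Notation N := n.+2.
Local Notation tup := (N.-tuple (measurableTypeR R)).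
Local Notation mu := (lebesgue_tuple R N).

Definition cbox m (l u : 'I_m -> R) : set (m.-tuple (measurableTypeR R)) :=
  [set t | forall i, l i <= tnth t i <= u i].

Lemma cboxE m (l u : 'I_m -> R) :
  cbox l u = [set t | forall i, `[l i, u i]%classic (tnth t i)].
Proof. by apply/seteqP; split=> t /= h i; have := h i; rewrite in_itv. Qed.

Lemma measurable_cbox m (l u : 'I_m -> R) : measurable (cbox l u).
Proof.
rewrite cboxE (_ : mkset _ = \bigcap_(i in [set: 'I_m])
    ((@tnth m (measurableTypeR R))^~ i @^-1` `[l i, u i]%classic)).
  apply: fin_bigcap_measurable => //= i _.
  by rewrite -[X in measurable X]setTI; exact: measurable_tnth.
by apply/seteqP; split=> [t h i _|t h i]; [exact: h|exact: (h i Logic.I)].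
Qed.

Lemma lebesgue_cbox m (l u : 'I_m -> R) : (forall i, l i <= u i) ->
  lebesgue_tuple R m (cbox l u) = (\prod_(i < m) (u i - l i))%:E.
Proof.
move=> lu; rewrite cboxE (@lebesgue_tuple_box R m (fun i => `[l i, u i]%classic)); last first.
  by move=> i; exact: measurable_itv.
elim/big_rec2: _ => // i x y _ ->; rewrite EFinM; congr (_ * _)%E.
rewrite lebesgue_measure_itv/= lte_fin -EFinB; case: ltP => // ul.
by rewrite (_ : u i = l i) ?subrr//; apply/eqP; rewrite eq_le ul lu.
Qed.

Local Notation i1 := (lift ord0 ord0 : 'I_N).
Local Notation tplane := (@tplane R N ord0 i1).

Lemma tnth_shear2 (s : R -> R) (t : tup) i :
  tnth (shear2 s t) i = if i == i1 then tnth t i1 + s (tnth t ord0) else tnth t i.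
Proof.
case/tupleP: t => x t; case/tupleP: t => y t.
have [j ->|->] := unliftP ord0 i; last by [].
have [l ->|->] := unliftP ord0 j; last by rewrite eqxx.
have -> : (lift ord0 (lift ord0 l) == i1) = false by [].
by rewrite !(tnth_nth 0).
Qed.

Variable J : nat.
Let Lam : R := 2 ^+ J.

Let Lam1 : 1 <= Lam. Proof. by rewrite exprn_ege1// ler1n. Qed.
Let Lam0 : 0 < Lam. Proof. exact: lt_le_trans Lam1. Qed.
Let Lv0 : 0 < Lam^-1. Proof. by rewrite invr_gt0. Qed.
Let Lv1 : Lam^-1 <= 1. Proof. by rewrite invf_le1. Qed.

(* The shell is a slab of thickness 1/(16 Lam) along the circular arc
   |z|^2 = 1 - 1/(2 Lam), where |z|^m is bounded below for all m <= Lam; the other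
   coordinates are of order Lam^(-1/2), so that the shell stays in the ball. *)
Definition shell_width : R := Num.sqrt ((16 * N%:R * Lam)^-1).
Definition shell_arc (x : R) : R := Num.sqrt (1 - Lam^-1 / 2 - x ^+ 2).
Definition shell_box (i : 'I_N) : R :=
  if i == ord0 then 2^-1 else if i == i1 then Lam^-1 / 16 else shell_width.
Definition shell : set tup :=
  @shear2 R n (fun x => - shell_arc x) @^-1` cbox (fun=> 0) shell_box.

Let w0 i : 0 <= shell_box i.
Proof.
rewrite /shell_box; case: ifP => _; first by rewrite invr_ge0.
by case: ifP => _; rewrite ?sqrtr_ge0// divr_ge0// ltW.
Qed.

Let preserves_shell : preserves mu (@shear2 R n (fun x => - shell_arc x)).
Proof.
apply: preserves_shear2; apply: continuous_measurable_fun => x.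
apply: continuousN; apply: continuous_comp; last exact: sqrt_continuous.
apply: continuousB; first exact: cvg_cst.
exact: exprn_continuous.
Qed.

Lemma measurable_shell : measurable shell.
Proof.
rewrite -[X in measurable X]setTI; apply: preserves_shell.1 => //.
exact: measurable_cbox.
Qed.

Lemma shell_volume : mu shell = (Lam^-1 / 32 * shell_width ^+ n)%:E.
Proof.
rewrite preserves_shell.2; last exact: measurable_cbox.
rewrite lebesgue_cbox//; congr EFin.
rewrite !big_ord_recl /= !subr0 {1 2}/shell_box /=.
rewrite (eq_bigr (fun=> shell_width)) => [|i _]; last by rewrite subr0 /shell_box.
by rewrite prodr_const card_ord; field; exact: lt0r_neq0.
Qed.

Lemma shell_normc t : shell t ->
  1 - Lam^-1 / 2 <= normc (tplane t) ^+ 2 /\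
  \sum_i tnth t i ^+ 2 <= 1 - Lam^-1 / 4.
Proof.
have L0 := Lv0; have L1 := Lv1.
move=> h; rewrite tplaneE /= sqr_sqrtr ?addr_ge0 ?sqr_ge0//.
have := h ord0; rewrite tnth_shear2 /= /shell_box /= => /andP[x0 x1].
have := h i1; rewrite tnth_shear2 /= /shell_box /= => /andP[].
move: x0 x1; set x := tnth t ord0; set y := tnth t i1 => x0 x1.
have arg0 : 0 <= 1 - Lam^-1 / 2 - x ^+ 2.
  have : x ^+ 2 <= 2^-1 ^+ 2 by rewrite lerXn2r ?nnegrE ?invr_ge0.
  have : (2^-1 : R) ^+ 2 = 4^-1 by rewrite exprVn -natrX.
  lra.
have aE := sqr_sqrtr arg0; have a0 := sqrtr_ge0 (1 - Lam^-1 / 2 - x ^+ 2).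
rewrite -/(shell_arc x) in aE a0; set a := shell_arc x in aE a0 *.
have a1 : a <= 1.
  rewrite -(@ler_pXn2r _ 2) ?nnegrE// expr1n aE.
  have := sqr_ge0 x; lra.
move=> s0 s1; set s := y - a in s0 s1.
have yE : y = a + s by rewrite /s addrC subrK.
have y2 : y ^+ 2 = a ^+ 2 + s * (2 * a + s) by rewrite yE; ring.
split.
  rewrite y2 aE; have : 0 <= s * (2 * a + s) by rewrite mulr_ge0// addr_ge0// mulr_ge0.
  lra.
rewrite !big_ord_recl /= -/x -[lift _ _]/i1 -/y y2 aE.
have sB : s * (2 * a + s) <= Lam^-1 / 16 * 3.
  have a3 : 2 * a + s <= 3 by lra.
  have a4 : 0 <= 2 * a + s by lra.
  exact: ler_pM.
have rest : \sum_(i < n) tnth t (lift ord0 (lift ord0 i)) ^+ 2 <= Lam^-1 / 16.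
  have ti (i : 'I_n) : tnth t (lift ord0 (lift ord0 i)) ^+ 2 <= (16 * N%:R * Lam)^-1.
    have := h (lift ord0 (lift ord0 i)); rewrite tnth_shear2 /= /shell_box /=.
    have p0 : 0 <= (16 * N%:R * Lam)^-1 by rewrite invr_ge0 !mulr_ge0// ltW.
    move=> /andP[h0 h1]; rewrite -[leRHS](sqr_sqrtr p0).
    by rewrite lerXn2r ?nnegrE ?sqrtr_ge0.
  apply: le_trans (ler_sum _ (fun i _ => ti i)) _.
  rewrite sumr_const card_ord -(mulr_natr _ n).
  have split3 (p q r v : R) : (p * q * r)^-1 * v = r^-1 / p * (v / q).
    by rewrite !invfM; ring.
  rewrite split3.
  have L16 : 0 <= Lam^-1 / 16 by rewrite divr_ge0// ltW.
  rewrite ler_piMr// ler_pdivrMr// mul1r ler_nat; lia.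
lra.
Qed.

Lemma bernoulli (r : R) m : 0 <= r <= 1 -> 1 - m%:R * (1 - r) <= r ^+ m.
Proof.
move=> /andP[r0 r1]; elim: m => [|m IH]; first by rewrite mul0r subr0 expr0.
apply: le_trans (_ : r * (1 - m%:R * (1 - r)) <= _); last by rewrite exprS ler_wpM2l.
rewrite -natr1; have : 0 <= m%:R * (1 - r) * (1 - r) by rewrite !mulr_ge0 ?subr_ge0.
set q := m%:R; nra.
Qed.

Lemma shell_ball t : shell t -> tuples_of (unit_ball R N) t.
Proof.
have L0 := Lv0; have L1 := Lv1.
move=> /shell_normc[_ h]; rewrite /tuples_of /unit_ball /= /enorm.
rewrite (eq_bigr (fun i => tnth t i ^+ 2)) => [|i _]; last by rewrite mxE.
rewrite -[ltRHS]sqrtr1 ltr_sqrt//; apply: le_lt_trans h _; lra.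
Qed.

Lemma shell_normcX t m : shell t -> (m <= 2 ^ J)%N -> 2^-1 <= normc (tplane t) ^+ m.
Proof.
have L0 := Lv0; have L1 := Lv1.
move=> ht mJ; have [h1 h2] := shell_normc ht.
have z0 := normc_ge0 (tplane t).
have z1 : normc (tplane t) <= 1.
  apply: le_trans (normc_plane_le _ _) _ => //.
  by have := shell_ball ht; rewrite /tuples_of /unit_ball /= => /ltW.
apply: le_trans (_ : (normc (tplane t) ^+ 2) ^+ (2 ^ J) <= _); last first.
  by rewrite -exprM ler_wiXn2l// (leq_trans mJ)// mul2n -addnn leq_addr.
apply: le_trans (_ : (1 - Lam^-1 / 2) ^+ (2 ^ J) <= _); last first.
  by rewrite lerXn2r ?nnegrE ?exprn_ge0//; lra.
apply: le_trans (bernoulli (2 ^ J) (_ : 0 <= 1 - Lam^-1 / 2 <= 1)); last first.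
  by apply/andP; split; lra.
rewrite natrX -/Lam subKr mulrA mulfV ?gt_eqF//; lra.
Qed.

(* Small enough that m |h| <= 1/4 whenever m <= Lam and |h| <= 2 kappa / Lam: the
   first order term then dominates in (z + h)^m - z^m. *)
Definition kappa : R := (24 * N%:R)^-1.

Definition shell_pairs : set (tup * tup) :=
  [set p | shell p.1 /\ cbox (fun i => tnth p.1 i + kappa / 2 * Lam^-1)
                            (fun i => tnth p.1 i + kappa * Lam^-1) p.2].

Let kappa0 : 0 < kappa. Proof. by rewrite invr_gt0 mulr_gt0. Qed.

Let kappaN : N%:R * kappa = 24^-1.
Proof. by rewrite /kappa; field. Qed.

Let kappa1 : kappa <= 24^-1.
Proof. by rewrite -kappaN ler_peMl ?(ltW kappa0)// ler1n. Qed.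

Let pair_diff p i : shell_pairs p ->
  kappa / 2 * Lam^-1 <= tnth p.2 i - tnth p.1 i <= kappa * Lam^-1.
Proof.
by move=> [_ /(_ i)]; rewrite lerBrDl lerBlDl.
Qed.

Lemma shell_pairs_ball p : shell_pairs p ->
  tuples_of (unit_ball R N) p.1 /\ tuples_of (unit_ball R N) p.2.
Proof.
have L0 := Lv0; have L1 := Lv1; have k0 := kappa0; have k1 := kappa1.
move=> hp; have sp := hp.1; split; first exact: shell_ball.
have [_ h] := shell_normc sp; rewrite /tuples_of /unit_ball /= /enorm.
rewrite (eq_bigr (fun i => tnth p.2 i ^+ 2)) => [|i _]; last by rewrite mxE.
rewrite -[ltRHS]sqrtr1 ltr_sqrt//.
have xi i : `|tnth p.1 i| <= 1.
  rewrite -(@ler_pXn2r _ 2) ?nnegrE// expr1n real_normK ?num_real//.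
  apply: le_trans (_ : \sum_i tnth p.1 i ^+ 2 <= _); last by lra.
  by rewrite (bigD1 i)//= lerDl sumr_ge0// => j _; exact: sqr_ge0.
have yi i : tnth p.2 i ^+ 2 <= tnth p.1 i ^+ 2 + 3 * kappa * Lam^-1.
  have /andP[d0 d1] := pair_diff i hp; set x := tnth p.1 i in d0 d1 *.
  have kL : 0 < kappa * Lam^-1 by rewrite mulr_gt0.
  have kL1 : kappa * Lam^-1 <= 1 by rewrite mulr_ile1 ?(ltW kappa0) ?(ltW Lv0)//; lra.
  have -> : tnth p.2 i = x + (tnth p.2 i - x) by rewrite addrC subrK.
  move: d0 d1; set d := tnth p.2 i - x => d0 d1.
  have d00 : 0 <= d by apply: le_trans d0; rewrite mulr_ge0 ?divr_ge0 ?(ltW kappa0) ?(ltW Lv0).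
  have -> : (x + d) ^+ 2 = x ^+ 2 + d * (2 * x + d) by ring.
  rewrite lerD2l; have := xi i; rewrite -/x ler_norml => /andP[_ x1].
  apply: le_trans (_ : d * 3 <= _); first by rewrite ler_wpM2l//; lra.
  by rewrite mulrC -mulrA ler_wpM2l.
apply: le_lt_trans (ler_sum _ (fun i _ => yi i)) _.
rewrite big_split /= sumr_const card_ord -[_ *+ N]mulr_natl.
have -> : N%:R * (3 * kappa * Lam^-1) = 3 * (N%:R * kappa) * Lam^-1 by ring.
rewrite kappaN; lra.
Qed.

Lemma shell_pairs_enorm p : shell_pairs p ->
  0 < enorm (row_of p.1 - row_of p.2) <= Lam^-1.
Proof.
have L0 := Lv0; have L1 := Lv1; have k0 := kappa0; have k1 := kappa1.
move=> hp; rewrite /enorm.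
rewrite (eq_bigr (fun i => (tnth p.2 i - tnth p.1 i) ^+ 2)) => [|i _]; last first.
  by rewrite !mxE -sqrrN opprB.
have kL : 0 < kappa / 2 * Lam^-1 by rewrite mulr_gt0// divr_gt0.
apply/andP; split.
  rewrite sqrtr_gt0 (bigD1 ord0)//= ltr_pwDl ?sumr_ge0// => [|i _]; last exact: sqr_ge0.
  have /andP[d0 _] := pair_diff ord0 hp.
  by rewrite exprn_gt0// (lt_le_trans kL d0).
rewrite -[leRHS]ger0_norm ?(ltW Lv0)// -sqrtr_sqr ler_wsqrtr//.
apply: le_trans (_ : \sum_(i < N) (kappa * Lam^-1) ^+ 2 <= _).
  apply: ler_sum => i _; have /andP[d0 d1] := pair_diff i hp.
  have d00 := ltW (lt_le_trans kL d0).
  by rewrite lerXn2r ?nnegrE// (le_trans d00 d1).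
rewrite sumr_const card_ord -[_ *+ N]mulr_natl exprMn mulrA ler_piMl ?sqr_ge0//.
rewrite expr2 mulrA kappaN mulr_ile1 ?(ltW kappa0)//; lra.
Qed.

Lemma shell_pairs_diff p m : shell_pairs p -> (2 ^ J <= 2 * m)%N -> (m <= 2 ^ J)%N ->
  kappa / 16 <= normc (tplane p.1 ^+ m - tplane p.2 ^+ m).
Proof.
have L0 := Lv0; have L1 := Lv1; have k0 := kappa0; have k1 := kappa1.
move=> hp mJ mJ'; have sp := hp.1.
have [b1 b2] := shell_pairs_ball hp.
have p1 q : tuples_of (unit_ball R N) q -> normc (tplane q) <= 1.
  move=> hq; apply: le_trans (normc_plane_le _ _) _ => //.
  exact: ltW hq.
set z := tplane p.1; set h := tplane p.2 - z.
have z1 : normc z <= 1 by exact: p1.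
have zh1 : normc (z + h) <= 1 by rewrite /h addrC subrK; exact: p1.
have T := @expr_taylor1 R z h m 1 z1 zh1.
rewrite expr1n mulr1 in T.
have h0 := normc_ge0 h.
have hE : h = ((tnth p.2 ord0 - tnth p.1 ord0)%R +i* (tnth p.2 i1 - tnth p.1 i1)%R)%C.
  by rewrite /h /z !tplaneE.
have /andP[x0 x1] := pair_diff ord0 hp; have /andP[y0 y1] := pair_diff i1 hp.
have kL : 0 < kappa / 2 * Lam^-1 by rewrite mulr_gt0// divr_gt0.
have hlo : kappa / 2 * Lam^-1 <= normc h.
  apply: le_trans (Re_le_normc h); rewrite hE /=; apply: le_trans x0 _.
  exact: ler_norm.
have hhi : normc h <= 2 * (kappa * Lam^-1).
  rewrite hE; apply: le_trans (normc_le_add _ _) _.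
  rewrite !ger0_norm; [lra|exact: ltW (lt_le_trans kL y0)|exact: ltW (lt_le_trans kL x0)].
have mL : m%:R <= Lam by rewrite /Lam -natrX ler_nat.
have mL' : Lam <= 2 * m%:R by rewrite /Lam -!natrX -natrM ler_nat.
have m0 : 0 <= m%:R :> R by [].
have mh : m%:R * normc h <= 4^-1.
  apply: le_trans (_ : Lam * (2 * (kappa * Lam^-1)) <= _); first exact: ler_pM.
  by rewrite (_ : _ * _ = 2 * kappa * (Lam * Lam^-1)); [rewrite mulfV ?gt_eqF//; lra|ring].
have mhlo : kappa / 4 <= m%:R * normc h.
  apply: le_trans (_ : (Lam / 2) * (kappa / 2 * Lam^-1) <= _).
    have alg (r q v : R) : (r / 2) * (q / 2 * v) = q / 4 * (r * v) by field.
    by rewrite alg mulfV ?gt_eqF// mulr1.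
  by apply: ler_pM; rewrite ?divr_ge0 ?(ltW Lam0) ?(ltW kL)//; lra.
have zm : 2^-1 <= normc z ^+ m.-1.
  by apply: shell_normcX => //; apply: leq_trans (leq_pred _) mJ'.
have E : normc (m%:R * (h * z ^+ m.-1)) <= normc (z ^+ m - tplane p.2 ^+ m) +
    normc ((z + h) ^+ m - z ^+ m - m%:R * (h * z ^+ m.-1)).
  rewrite -[leLHS]normcN; apply: le_trans (le_normcD _ _).
  rewrite (_ : tplane p.2 = z + h); last by rewrite /h addrC subrK.
  by rewrite le_eqVlt; apply/orP; left; apply/eqP; congr normc; ring.
rewrite normc_natM normcM normcX in E.
have Q : m%:R * (m.-1)%:R * normc h ^+ 2 <= (m%:R * normc h) * (m%:R * normc h).
  have : (m.-1)%:R <= m%:R :> R by rewrite ler_nat leq_pred.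
  move=> mm; rewrite (_ : (m%:R * normc h) * (m%:R * normc h) = m%:R * m%:R * normc h ^+ 2); last by ring.
  by rewrite ler_wpM2r ?exprn_ge0// ler_wpM2l.
have P : (m%:R * normc h) * 2^-1 <= m%:R * (normc h * normc z ^+ m.-1).
  by rewrite mulrA ler_wpM2l// mulr_ge0.
have Q' : (m%:R * normc h) * (m%:R * normc h) <= (m%:R * normc h) * 4^-1.
  by rewrite ler_wpM2l// mulr_ge0.
move: (m%:R * normc h) P Q Q' E T mhlo mh => q P Q Q' E T mhlo mh.
have := le_trans P (le_trans E (lerD (lexx _) (le_trans T (le_trans Q Q')))).
lra.
Qed.

Lemma measurable_shell_pairs : measurable shell_pairs.
Proof.
rewrite (_ : shell_pairs = (fst @^-1` shell) `&` \bigcap_(i in [set: 'I_N])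
   ((fun p : tup * tup => tnth p.2 i - tnth p.1 i) @^-1`
      `[kappa / 2 * Lam^-1, kappa * Lam^-1]%classic)).
  apply: measurableI.
    by rewrite -[X in measurable X]setTI; apply: measurable_fst => //; exact: measurable_shell.
  apply: fin_bigcap_measurable => //= i _.
  rewrite -[X in measurable X]setTI.
  apply: (measurable_funB (measurableT_comp (measurable_tnth i) measurable_snd)
    (measurableT_comp (measurable_tnth i) measurable_fst)) => //.
apply/seteqP; split=> [p hp|p [hs hb]].
  split; first exact: hp.1.
  by move=> i _; rewrite /= in_itv/=; exact: pair_diff.
split=> // i; have := hb i Logic.I; rewrite /= in_itv/=.
by rewrite lerBrDl lerBlDl.
Qed.

Lemma shell_pairs_volume :
  (mu \x mu)%E shell_pairs =
  ((kappa / 2 * Lam^-1) ^+ N * (Lam^-1 / 32 * shell_width ^+ n))%:E.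
Proof.
rewrite /product_measure1.
rewrite (eq_integral (fun x => ((kappa / 2 * Lam^-1) ^+ N)%:E * (\1_shell x)%:E)%E); last first.
  move=> x _ /=; rewrite xsectionE indicE.
  have [/set_mem sx|/negP sx] := boolP (x \in shell).
    rewrite mule1.
    rewrite (_ : _ @^-1` _ = cbox (fun i => tnth x i + kappa / 2 * Lam^-1)
                            (fun i => tnth x i + kappa * Lam^-1)); last first.
      by apply/seteqP; split=> [y []//|y h]; split.
    rewrite lebesgue_cbox; last first.
      by move=> i; rewrite lerD2l ler_wpM2r ?(ltW Lv0)//; have := kappa0; lra.
    congr EFin; rewrite -[in RHS](card_ord N) -prodr_const; apply: eq_bigr => i _.
    by rewrite opprD addrACA subrr add0r -mulrBl; congr (_ * _); field.
  rewrite mule0 (_ : _ @^-1` _ = set0) ?measure0//.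
  by apply/seteqP; split=> // y [hs _]; apply: sx; apply/mem_set.
rewrite ge0_integralZl//; last 2 first.
- apply/measurable_EFinP; apply: measurable_indic; exact: measurable_shell.
- by rewrite lee_fin exprn_ge0// mulr_ge0 ?divr_ge0 ?ltW.
rewrite integral_indic//; last exact: measurable_shell.
by rewrite setIT [in RHS]EFinM; congr (_ * _)%E; exact: shell_volume.
Qed.

End ShellVolume.

Section RotationAction.
Variables (R : realType) (n : nat).
Local Notation N := n.+2.
Local Notation tup := (N.-tuple (measurableTypeR R)).
Local Notation i1 := (lift ord0 ord0 : 'I_N).
Local Notation tplane := (@tplane R N ord0 i1).
Variable omega : R[i].
Hypotheses (omega1 : normc omega = 1) (omega_im : Im omega != 0).

Definition rot : tup -> tup := rotation (Re omega) (Im omega).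

Let cs1 : Re omega ^+ 2 + Im omega ^+ 2 = 1.
Proof.
move: omega1; case: omega => c s /= h.
by rewrite -[LHS]sqr_sqrtr ?addr_ge0 ?sqr_ge0// h expr1n.
Qed.

Let rotE t :
  [/\ tnth (rot t) ord0 = Re omega * tnth t ord0 - Im omega * tnth t i1,
      tnth (rot t) i1 = Im omega * tnth t ord0 + Re omega * tnth t i1 &
      forall i : 'I_n, tnth (rot t) (lift ord0 (lift ord0 i)) =
                       tnth t (lift ord0 (lift ord0 i))].
Proof.
rewrite /rot rotationE//; case/tupleP: t => x t; case/tupleP: t => y t.
by split=> [||i]; rewrite !(tnth_nth 0).
Qed.

Lemma tplane_rot t : tplane (rot t) = omega * tplane t.
Proof.
rewrite !tplaneE; have [-> -> _] := rotE t; case: omega => c s /=.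
by apply/eqP; rewrite eq_complex /= eqxx/=; apply/eqP; rewrite addrC.
Qed.

Lemma tplane_iter_rot l t : tplane (iter l rot t) = omega ^+ l * tplane t.
Proof. by elim: l => [|l IH]; rewrite ?mul1r// iterS tplane_rot IH exprS mulrA. Qed.

Lemma enorm_rot_sub t u :
  enorm (row_of (rot t) - row_of (rot u)) = enorm (row_of t - row_of u).
Proof.
have E (v v' : tup) : \sum_i (row_of v - row_of v') 0 i ^+ 2 =
    \sum_i (tnth v i - tnth v' i) ^+ 2 by apply: eq_bigr => i _; rewrite !mxE.
rewrite /enorm !E !big_ord_recl.
have [t0 t1 t2] := rotE t; have [u0 u1 u2] := rotE u.
rewrite -![lift ord0 (ord0 : 'I_n.+1)]/i1 t0 t1 u0 u1.
under eq_bigr do rewrite t2 u2.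
congr Num.sqrt; rewrite !addrA; congr (_ + _).
set a := Re omega; set b := Im omega.
rewrite [LHS](_ : _ = (a ^+ 2 + b ^+ 2) * ((tnth t ord0 - tnth u ord0) ^+ 2 +
  (tnth t i1 - tnth u i1) ^+ 2)); last by ring.
by rewrite cs1 mul1r.
Qed.

Lemma enorm_rot t : enorm (row_of (rot t)) = enorm (row_of t).
Proof.
have z : rot (nseq_tuple N 0) = nseq_tuple N 0.
  apply: eq_from_tnth => i; have [h0 h1 h2] := rotE (nseq_tuple N 0).
  have z0 j : tnth (nseq_tuple N (0 : R)) j = 0 by rewrite (tnth_nth 0) nth_nseq ltn_ord.
  have [j ->|->] := unliftP ord0 i; last by rewrite h0 !z0 !mulr0 subrr.
  have [l ->|->] := unliftP ord0 j; first by rewrite h2.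
  by rewrite h1 !z0 !mulr0 addr0.
have r0 : row_of (nseq_tuple N 0) = 0 :> 'rV[R]_N.
  by apply/rowP => i; rewrite !mxE (tnth_nth 0) nth_nseq ltn_ord.
by have := enorm_rot_sub t (nseq_tuple N 0); rewrite z r0 !subr0.
Qed.

Lemma preserves_rot : preserves (lebesgue_tuple R N) rot.
Proof. exact: preserves_rotation. Qed.

End RotationAction.

Section Averaging.
Local Open Scope ereal_scope.
Context d (T : measurableType d) (R : realType).
Variable mu : {measure set T -> \bar R}.
Variables (D : set T).
Hypothesis mD : measurable D.

Lemma integral_ge_cst (S : set T) (f : T -> R) (v : R) : measurable S -> S `<=` D ->
  measurable_fun D f -> (forall x, D x -> 0 <= f x)%R -> (0 <= v)%R ->
  (forall x, S x -> v <= f x)%R -> v%:E * mu S <= \int[mu]_(x in D) (f x)%:E.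
Proof.
move=> mS SD mf f0 v0 vf; rewrite -(integral_cst mu mS).
apply: (@le_trans _ _ (\int[mu]_(x in S) (f x)%:E)).
  apply: ge0_le_integral => //.
  by apply/measurable_EFinP; exact: measurable_funS mf.
by apply: ge0_subset_integral => //; exact/measurable_EFinP.
Qed.

Lemma averaging_lower_bound (phi : T -> T) (Psi : T -> R) (Phi : nat -> T -> R)
    (L J0 M : nat) (c : R) :
  preserves mu phi -> phi @^-1` D = D ->
  measurable_fun D Psi -> (forall x, D x -> 0 <= Psi x)%R ->
  (forall J, measurable_fun D (Phi J)) -> (forall J x, D x -> 0 <= Phi J x)%R ->
  (0 < L)%N ->
  (forall x, D x -> L%:R / 2 * \sum_(J0 <= J < M.+1) Phi J x <=
     \sum_(l < L) Psi (iter l phi x))%R ->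
  (forall J, (J0 <= J <= M)%N -> c%:E <= \int[mu]_(x in D) (Phi J x)%:E) ->
  ((M.+1 - J0)%:R * c / 2)%:E <= \int[mu]_(x in D) (Psi x)%:E.
Proof.
move=> pphi phiD mPsi Psi0 mPhi Phi0 L0 PP cPhi.
have iD l : iter l phi @^-1` D = D.
  by elim: l => [//|l IH]; rewrite /= -[in RHS]IH -[X in _ = iter l phi @^-1` X]phiD.
have mi l : measurable_fun D (fun x => Psi (iter l phi x)).
  apply: (measurable_comp (F := D)) => //; last first.
    by apply: measurable_funTS; exact: (preserves_iter l pphi).1.
  by move=> _ [x Dx <-]; move: Dx; rewrite -{1}(iD l).
have invl l : \int[mu]_(x in D) (Psi (iter l phi x))%:E = \int[mu]_(x in D) (Psi x)%:E.
  apply: (preserves_integral (f := fun x => (Psi x)%:E) (preserves_iter l pphi)) => //.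
  exact/measurable_EFinP.
have s1 : \int[mu]_(x in D) (\sum_(l < L) Psi (iter l phi x))%:E =
    L%:R%:E * \int[mu]_(x in D) (Psi x)%:E.
  under eq_integral do rewrite -sumEFin.
  rewrite ge0_integral_sum//; last 2 first.
  - by move=> l; exact/measurable_EFinP.
  - move=> l x Dx; rewrite lee_fin Psi0//; by move: Dx; rewrite -{1}(iD l).
  rewrite (eq_bigr (fun=> \int[mu]_(x in D) (Psi x)%:E))//.
  by rewrite mule_natl sumr_const card_ord.
have LR0 : (0 < L%:R :> R)%R by rewrite ltr0n.
have mS : measurable_fun D (fun x => \sum_(J0 <= J < M.+1) Phi J x)%R.
  exact: measurable_sum.
have s2 : ((M.+1 - J0)%:R * c)%:E <= \int[mu]_(x in D) (\sum_(J0 <= J < M.+1) Phi J x)%:E.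
  under eq_integral do rewrite -sumEFin.
  rewrite ge0_integral_sum//; last by move=> J; exact/measurable_EFinP.
  rewrite mulr_natl -sumr_const_nat -sumEFin.
  rewrite big_seq [leRHS]big_seq; apply: lee_sum => J.
  by rewrite mem_index_iota => JM; exact: cPhi.
have s3 : (L%:R / 2)%:E * \int[mu]_(x in D) (\sum_(J0 <= J < M.+1) Phi J x)%:E <=
    L%:R%:E * \int[mu]_(x in D) (Psi x)%:E.
  have S0 x : D x -> (0 <= \sum_(J0 <= J < M.+1) Phi J x)%R.
    by move=> Dx; apply: sumr_ge0 => J _; exact: Phi0.
  rewrite -s1 -ge0_integralZl_EFin//; last exact/measurable_EFinP.
  apply: ge0_le_integral => //.
  - by move=> x Dx; rewrite -EFinM lee_fin mulr_ge0// S0.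
  - by under eq_fun do rewrite -EFinM; apply/measurable_EFinP/measurable_funM.
  - exact/measurable_EFinP/measurable_sum.
have L2 : (0 <= (L%:R / 2 : R)%:E) by rewrite lee_fin divr_ge0.
rewrite -(@lee_pmul2l _ L%:R%:E)//; apply: le_trans s3.
apply: le_trans (lee_wpmul2l L2 s2).
by rewrite -!EFinM lee_fin; lra.
Qed.

End Averaging.

Section EnergyLowerBounds.
Variables (R : realType) (alpha : R) (n : nat).
Hypotheses (alpha_gt0 : 0 < alpha) (alpha_lt1 : alpha < 1).
Local Notation N := n.+2.
Local Notation tup := (N.-tuple (measurableTypeR R)).
Local Notation mu := (lebesgue_tuple R N).
Local Notation Omega := (tuples_of (unit_ball R N)).
Local Notation i1 := (lift ord0 ord0 : 'I_N).
Local Notation tplane := (@tplane R N ord0 i1).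
Local Notation Lam J := (2 ^+ J : R).
Variable k : nat.
Local Notation ak := (dpow k (lcoef alpha) lexpo).1.
Local Notation mk := (dpow k (lcoef alpha) lexpo).2.

Lemma ffact_ge m p : ((m - p) ^ p <= m ^_ p)%N.
Proof.
elim: p m => [//|p IH] m; rewrite ffactnS expnS; apply: leq_mul; first exact: leq_subr.
by have := IH m.-1; rewrite -subn1 -subnDA add1n.
Qed.

Lemma mkE j : mk j = (2 ^ j - k)%N. Proof. exact: dpow_expo. Qed.

Lemma ak_ge J : (2 * k <= 2 ^ J)%N -> lcoef alpha J * (Lam J / 2) ^+ k <= ak J.
Proof.
move=> kJ; rewrite dpow_coef mulrC ler_wpM2r ?lcoef_ge0//.
apply: le_trans (_ : ((2 ^ J - k) ^ k)%:R <= _); last by rewrite ler_nat ffact_ge.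
rewrite natrX lerXn2r ?nnegrE ?divr_ge0 ?exprn_ge0//.
rewrite ler_pdivrMr// -natrX -natrM ler_nat; lia.
Qed.

Lemma ak_neq0 J : (ak J != 0) = (k <= 2 ^ J)%N.
Proof.
rewrite dpow_coef mulf_eq0 negb_or pnatr_eq0 -lt0n ffact_gt0.
by rewrite lcoefE expf_neq0 ?andbT// gt_eqF// lratio_gt0.
Qed.

Definition scale_constant : R := 4^-1 ^+ k / 32 * Num.sqrt ((16 * N%:R)^-1) ^+ n.

Lemma scale_constant_gt0 : 0 < scale_constant.
Proof.
by rewrite mulr_gt0 ?divr_gt0 ?exprn_gt0 ?sqrtr_gt0// ?invr_gt0 ?mulr_gt0.
Qed.

Lemma scaling J (theta : R) : 0 <= 2 * k%:R + 2 * theta - 2 * alpha - N%:R / 2 ->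
  scale_constant <= (lcoef alpha J * (Lam J / 2) ^+ k) ^+ 2 *
    ((Lam J)^-1 / 32 * shell_width R n J ^+ n) * Lam J `^ (2 * theta).
Proof.
move=> E0; set la := Lam J.
have la1 : 1 <= la by rewrite exprn_ege1// ler1n.
have la0 : 0 < la by apply: lt_le_trans la1.
have lan : la != 0 by rewrite gt_eqF.
have e1 : lcoef alpha J = la `^ (- alpha).
  by rewrite powRN /la -powR_mulrn// -powRrM.
have e2 : shell_width R n J = Num.sqrt ((16 * N%:R)^-1) * la `^ (- 2^-1).
  rewrite /shell_width -/la invfM sqrtrM ?invr_ge0 ?mulr_ge0//.
  congr (_ * _).
  by rewrite -(@powR12_sqrt _ la^-1) ?invr_ge0 ?(ltW la0)// -powR_inv1 ?(ltW la0)// -powRrM mulN1r.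
have e3 : la^-1 = la `^ (- 1) by rewrite powR_inv1// ltW.
have e4 : la ^+ k = la `^ k%:R by rewrite powR_mulrn// ltW.
rewrite e1 e2 e3 !exprMn e4 -!exprM.
rewrite -!(powR_mulrn _ (powR_ge0 _ _)) -!powRrM.
rewrite (_ : (2^-1 : R) ^+ (k * 2) = 4^-1 ^+ k); last first.
  by rewrite mulnC exprM; congr (_ ^+ _); rewrite exprVn -natrX.
set q := Num.sqrt _.
have -> : la `^ (- alpha * 2) * (la `^ (k%:R * 2) * 4^-1 ^+ k) *
   (la `^ (- 1) / 32 * (q ^+ n * la `^ (- 2^-1 * n%:R))) * la `^ (2 * theta) =
   scale_constant * (la `^ (- alpha * 2) * la `^ (k%:R * 2) * la `^ (- 1) *
     la `^ (- 2^-1 * n%:R) * la `^ (2 * theta)).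
  by rewrite /scale_constant -/q; ring.
rewrite -!powRD ?lan ?implybT// ler_peMr ?(ltW scale_constant_gt0)//.
rewrite -[leLHS](powRr0 la); apply: ler_powR => //.
by move: E0; rewrite -[n.+2]addn2 natrD; lra.
Qed.

Lemma normc_sqr (z : R[i]) : normc z ^+ 2 = Re z ^+ 2 + Im z ^+ 2.
Proof. by case: z => x y /=; rewrite sqr_sqrtr// addr_ge0 ?sqr_ge0. Qed.

Lemma single_bound J : (2 * k <= 2 ^ J)%N -> 0 <= 2 * k%:R - 2 * alpha - N%:R / 2 ->
  ((scale_constant / 4)%:E <=
    \int[mu]_(t in Omega) (ak J ^+ 2 * normc (tplane t ^+ mk J) ^+ 2)%:E)%E.
Proof.
move=> kJ E0; pose v : R := (lcoef alpha J * (Lam J / 2) ^+ k) ^+ 2 / 4.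
have b0 : 0 <= lcoef alpha J * (Lam J / 2) ^+ k.
  by rewrite mulr_ge0 ?lcoef_ge0// exprn_ge0// divr_ge0.
apply: (@le_trans _ _ (v%:E * mu (@shell R n J))%E).
  rewrite shell_volume -EFinM lee_fin.
  have := @scaling J 0; rewrite mulr0 addr0 powRr0 mulr1 => /(_ E0).
  by rewrite /v; lra.
apply: integral_ge_cst.
- exact: measurable_unit_ball.
- exact: measurable_shell.
- by move=> t; exact: shell_ball.
- apply: measurable_funM => //.
  have [m1 m2] := @measurable_tplaneX R N ord0 i1 (mk J).
  rewrite (_ : (fun t => _) = (fun t => Re (tplane t ^+ mk J) ^+ 2 +
    Im (tplane t ^+ mk J) ^+ 2)).
    by apply: measurable_funTS; apply: measurable_funD; exact: measurable_funX.
  by apply/funext => t; rewrite normc_sqr.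
- by move=> t _; rewrite mulr_ge0 ?sqr_ge0.
- by rewrite /v divr_ge0 ?sqr_ge0.
move=> t st; rewrite /v normcX.
have h := @shell_normcX R n J t (mk J) st _.
have {}h : 2^-1 <= normc (tplane t) ^+ mk J by apply: h; rewrite mkE leq_subr.
apply: ler_pM; rewrite ?sqr_ge0 ?invr_ge0//.
  by rewrite lerXn2r ?nnegrE// ?(le_trans b0)// ak_ge.
rewrite (_ : 4^-1 = 2^-1 ^+ 2 :> R); last by rewrite exprVn -natrX.
by rewrite lerXn2r ?nnegrE ?invr_ge0// exprn_ge0// normc_ge0.
Qed.

Definition pair_weight (theta : R) (p : tup * tup) : R :=
  (enorm (row_of p.1 - row_of p.2) `^ (N%:R + 2 * theta))^-1.

Lemma pair_weight_ge0 theta p : 0 <= pair_weight theta p.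
Proof. by rewrite invr_ge0 powR_ge0. Qed.

Lemma measurable_pair_weight theta : measurable_fun setT (pair_weight theta).
Proof.
rewrite (_ : pair_weight theta = (fun p => enorm (row_of p.1 - row_of p.2)
   `^ (- (N%:R + 2 * theta)))); last by apply/funext => p; rewrite powRN.
apply: (@measurableT_comp _ _ _ _ _ _ (@powR R ^~ (- (N%:R + 2 * theta)))).
  exact: measurable_powR.
by apply: measurable_enorm_row.
Qed.

Lemma measurable_pair_diff m :
  measurable_fun setT (fun p : tup * tup => normc (tplane p.1 ^+ m - tplane p.2 ^+ m) ^+ 2).
Proof.
have [m1 m2] := @measurable_tplaneX R N ord0 i1 m.
rewrite (_ : (fun p => _) = (fun p : tup * tup =>
   (Re (tplane p.1 ^+ m) - Re (tplane p.2 ^+ m)) ^+ 2 +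
   (Im (tplane p.1 ^+ m) - Im (tplane p.2 ^+ m)) ^+ 2)).
  apply: measurable_funD; apply: measurable_funX; apply: measurable_funB.
  - exact: (measurableT_comp m1 measurable_fst).
  - exact: (measurableT_comp m1 measurable_snd).
  - exact: (measurableT_comp m2 measurable_fst).
  - exact: (measurableT_comp m2 measurable_snd).
by apply/funext => p; rewrite normc_sqr !ReIm.
Qed.

Definition pair_constant : R :=
  scale_constant * (kappa R n / 16) ^+ 2 * (kappa R n / 2) ^+ N.

Lemma pair_constant_gt0 : 0 < pair_constant.
Proof.
have k0 : 0 < kappa R n by rewrite invr_gt0 mulr_gt0.
rewrite mulr_gt0 ?exprn_gt0 ?divr_gt0//.
by rewrite mulr_gt0 ?scale_constant_gt0// ?exprn_gt0 ?divr_gt0.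
Qed.

Lemma pair_bound J theta : (2 * k <= 2 ^ J)%N -> 0 <= theta ->
  0 <= 2 * k%:R + 2 * theta - 2 * alpha - N%:R / 2 ->
  (pair_constant%:E <= \int[mu \x mu]_(p in Omega `*` Omega)
    (ak J ^+ 2 * normc (tplane p.1 ^+ mk J - tplane p.2 ^+ mk J) ^+ 2 *
      pair_weight theta p)%:E)%E.
Proof.
move=> kJ th0 E0; set la := Lam J.
have la0 : 0 < la by rewrite exprn_gt0.
have k0 : 0 < kappa R n by rewrite invr_gt0 mulr_gt0.
pose v : R := (lcoef alpha J * (la / 2) ^+ k) ^+ 2 * (kappa R n / 16) ^+ 2 *
  la `^ (N%:R + 2 * theta).
have b0 : 0 <= lcoef alpha J * (la / 2) ^+ k.
  by rewrite mulr_ge0 ?lcoef_ge0// exprn_ge0// divr_ge0// ltW.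
apply: (@le_trans _ _ (v%:E * (mu \x mu) (@shell_pairs R n J))%E).
  rewrite shell_pairs_volume -EFinM lee_fin /v -/la powRD; last first.
    by rewrite (gt_eqF la0) implybT.
  rewrite powR_mulrn ?(ltW la0)// [(_ / la) ^+ N]exprMn exprVn.
  have := @scaling J theta E0; rewrite -/la.
  have lN : la ^+ N != 0 by rewrite expf_neq0// gt_eqF.
  set A := (lcoef alpha J * _) ^+ 2; set B := la^-1 / 32 * _; set C := la `^ _ => h.
  rewrite (_ : A * _ * _ * _ = (A * B * C) * (kappa R n / 16) ^+ 2 * (kappa R n / 2) ^+ N *
     (la ^+ N / la ^+ N)); last by rewrite -[la ^- N]/(la ^+ N)^-1; ring.
  rewrite mulfV// mulr1 /pair_constant.
  have k16 c : 0 < c -> 0 <= kappa R n / c by move=> c0; rewrite divr_ge0 ?ltW.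
  apply: ler_wpM2r; first by rewrite exprn_ge0// k16.
  by apply: ler_wpM2r => //; rewrite exprn_ge0// k16.
apply: integral_ge_cst.
- by apply: measurableX; exact: measurable_unit_ball.
- exact: measurable_shell_pairs.
- by move=> p /shell_pairs_ball.
- apply: measurable_funTS; apply: measurable_funM; last exact: measurable_pair_weight.
  by apply: measurable_funM => //; exact: measurable_pair_diff.
- by move=> p _; apply: mulr_ge0 (pair_weight_ge0 _ _); apply: mulr_ge0; exact: sqr_ge0.
- by apply: mulr_ge0 (powR_ge0 _ _); apply: mulr_ge0; exact: sqr_ge0.
move=> p sp; have [w0 w1] := andP (shell_pairs_enorm sp).
apply: ler_pM; first 2 last.
  apply: ler_pM; rewrite ?sqr_ge0//.
    by rewrite lerXn2r ?nnegrE// ?(le_trans b0)// ak_ge.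
  rewrite lerXn2r ?nnegrE ?normc_ge0 ?divr_ge0 ?(ltW k0)//.
  by apply: (shell_pairs_diff sp); rewrite mkE ?leq_subr//; lia.
rewrite /pair_weight -[leLHS]invrK lef_pV2 ?posrE ?invr_gt0 ?powR_gt0//.
rewrite -powRN -mulN1r powRrM powR_inv1 ?(ltW la0)//.
rewrite ge0_ler_powR ?nnegrE ?invr_ge0 ?(ltW la0) ?(ltW w0)//.
  by rewrite addr_ge0// mulr_ge0.
- by apply: mulr_ge0; exact: sqr_ge0.
- exact: powR_ge0.
Qed.

End EnergyLowerBounds.

(** * Divergence of the Sobolev energy *)

Lemma infinite_of_linear (R : realType) (I : \bar R) (c : R) (J0 : nat) : 0 < c ->
  (forall M, (0 < M)%N -> (((M.+1 - J0)%:R * c / 2)%:E <= I)%E) -> I = +oo%E.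
Proof.
case: I => [r||] c0 h //.
- have [m rm] : exists m, r < m%:R * (c / 2).
    exists (Num.bound `|r / (c / 2)|).
    rewrite -ltr_pdivrMr ?divr_gt0//; apply: le_lt_trans (ler_norm _) _.
    exact: archi_boundP (normr_ge0 _).
  have := h (J0 + m)%N.+1 isT; rewrite lee_fin leNgt -mulrA => /negP[].
  apply: lt_le_trans rm _; rewrite ler_wpM2r ?divr_ge0 ?(ltW c0)// ler_nat; lia.
by have := h 1%N isT; rewrite leeNy_eq.
Qed.

Section EnergyDivergence.
Variables (R : realType) (alpha : R) (n : nat).
Hypotheses (alpha_gt0 : 0 < alpha) (alpha_lt1 : alpha < 1).
Local Notation N := n.+2.
Local Notation tup := (N.-tuple (measurableTypeR R)).
Local Notation mu := (lebesgue_tuple R N).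
Local Notation Omega := (tuples_of (unit_ball R N)).
Local Notation i1 := (lift ord0 ord0 : 'I_N).
Local Notation tplane := (@tplane R N ord0 i1).
Variable k : nat.
Local Notation ak := (dpow k (lcoef alpha) lexpo).1.
Local Notation mk := (dpow k (lcoef alpha) lexpo).2.

(* On the unit ball this is the k-th derivative of u in x_1. *)
Definition lderiv (t : tup) : R := psre ak mk (tplane t).

Lemma nonreal_dyadic_root M : (0 < M)%N ->
  exists2 omega : R[i], omega ^+ (2 ^ M.+1) = -1 & Im omega != 0.
Proof.
move=> M0; have [omega omegaM] := dyadic_root R M.+1; exists omega => //.
apply/eqP => im0.
have lt2 : (0 < 2 < 2 ^ M.+2)%N by rewrite /= -[X in (X < _)%N](expn1 2) ltn_exp2l.
have := omega_neq1 omegaM lt2; have := omega_normc omegaM.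
case: omega im0 {omegaM} => x y /= ->; rewrite expr0n addr0 => h /eqP[].
have x2 : x ^+ 2 = 1 by rewrite -[LHS]sqr_sqrtr ?sqr_ge0// h expr1n.
by apply/eqP; rewrite eq_complex/= !(mulr0, mul0r, subr0, addr0) -expr2 x2 !eqxx.
Qed.

Lemma lacunary_bessel M (omega : R[i]) (B : nat -> R[i]) (F : nat -> R) :
  omega ^+ (2 ^ M.+1) = -1 ->
  (forall l, (fun K => \sum_(1 <= j < K) (ak j * twist omega (mk j) (B j) l)) @ \oo --> F l) ->
  (2 ^ M.+2)%:R / 2 * \sum_(k.+2 <= J < M.+1) (ak J ^+ 2 * normc (B J) ^+ 2) <=
  \sum_(l < 2 ^ M.+2) F l ^+ 2.
Proof.
move=> omegaM FE; have big J : (k.+2 <= J <= M)%N -> (2 * k < 2 ^ J)%N.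
  move=> /andP[kJ _]; apply: leq_trans (leq_pexp2l _ kJ) => //.
  by rewrite !expnS; have := ltn_expl k (isT : (1 < 2)%N); lia.
have le2 J : (2 * k < 2 ^ J)%N -> (k <= 2 ^ J)%N by lia.
apply: (bessel omegaM) FE => //.
- move=> J j kJ j0; rewrite (ak_neq0 alpha) => kj jJ; rewrite !(mkE alpha).
  have /andP[_ JM] := kJ.
  exact: (omega_dyadic_shift_neq omegaM (le2 _ (big _ kJ)) kj JM jJ).
- move=> J j kJ j0; rewrite (ak_neq0 alpha) => kj; rewrite !(mkE alpha).
  have /andP[_ JM] := kJ.
  exact: (omega_dyadic_shift_mul omegaM (big _ kJ) kj JM).
by move=> J kJ; rewrite ak_neq0 le2// big.
Qed.

Lemma Omega_plane t : Omega t -> normc (tplane t) < 1.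
Proof. by apply: unit_ball_cylinder. Qed.

Lemma lderiv_cvg t : Omega t ->
  (fun K => \sum_(1 <= j < K) (ak j * Re (tplane t ^+ mk j))) @ \oo --> lderiv t.
Proof.
move=> Ot; have := ps_cvg (dpow_radius1 k (lcoef_radius1 alpha_gt0)) (Omega_plane Ot).
by case.
Qed.

Lemma measurable_lderiv : measurable_fun Omega lderiv.
Proof.
apply: measurable_psre; first exact: dpow_radius1 (lcoef_radius1 alpha_gt0).
  exact: measurable_unit_ball.
exact: Omega_plane.
Qed.

Section Rotation.
Variable omega : R[i].
Hypotheses (omega1 : normc omega = 1) (omega_im : Im omega != 0).

Lemma rot_Omega t : Omega (@rot R n omega t) = Omega t.
Proof. by rewrite /tuples_of /unit_ball /= enorm_rot. Qed.

Lemma iter_rot_Omega l t : Omega t -> Omega (iter l (@rot R n omega) t).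
Proof. by move=> Ot; elim: l => // l IH; rewrite iterS rot_Omega. Qed.

Lemma lderiv_iter_rot t l : Omega t ->
  (fun K => \sum_(1 <= j < K) (ak j * twist omega (mk j) (tplane t ^+ mk j) l)) @ \oo -->
  lderiv (iter l (@rot R n omega) t).
Proof.
move=> Ot; have := lderiv_cvg (iter_rot_Omega l Ot).
suff -> : (fun K => \sum_(1 <= j < K) (ak j * Re (tplane (iter l (@rot R n omega) t) ^+ mk j))) =
  (fun K => \sum_(1 <= j < K) (ak j * twist omega (mk j) (tplane t ^+ mk j) l)) by [].
apply/funext => K; apply: eq_bigr => j _.
by rewrite (tplane_iter_rot omega1)// /twist exprMn -exprM.
Qed.

End Rotation.

Lemma lderiv_energy : 0 <= 2 * k%:R - 2 * alpha - N%:R / 2 ->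
  (\int[mu]_(t in Omega) (lderiv t ^+ 2)%:E = +oo)%E.
Proof.
move=> E0; have c0 : 0 < scale_constant R n k / 4.
  by rewrite divr_gt0// scale_constant_gt0.
apply: (infinite_of_linear (J0 := k.+2) c0) => M M0.
have [omega omegaM omega_im] := nonreal_dyadic_root M0.
have omega1 := omega_normc omegaM.
apply: (averaging_lower_bound (@measurable_unit_ball R N) (phi := @rot R n omega) (L := (2 ^ M.+2)%N)
  (Phi := fun J t => ak J ^+ 2 * normc (tplane t ^+ mk J) ^+ 2)).
- exact: preserves_rot.
- by apply/funext => t; exact: rot_Omega.
- exact: measurable_funX measurable_lderiv.
- by move=> t _; exact: sqr_ge0.
- move=> J; apply: measurable_funTS; apply: measurable_funM => //.
  have [m1 m2] := @measurable_tplaneX R N ord0 i1 (mk J).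
  rewrite (_ : (fun t => _) = (fun t => Re (tplane t ^+ mk J) ^+ 2 +
    Im (tplane t ^+ mk J) ^+ 2)).
    by apply: measurable_funD; exact: measurable_funX.
  by apply/funext => t; rewrite normc_sqr.
- by move=> J t _; apply: mulr_ge0; exact: sqr_ge0.
- by rewrite expn_gt0.
- move=> t Ot.
  apply: (lacunary_bessel (F := fun l => lderiv (iter l (@rot R n omega) t)) omegaM) => l.
  exact: lderiv_iter_rot.
move=> J /andP[kJ _]; apply: single_bound => //.
apply: leq_trans (leq_pexp2l _ kJ) => //.
by rewrite !expnS; have := ltn_expl k (isT : (1 < 2)%N); lia.
Qed.

Lemma measurable_OmegaX : measurable (Omega `*` Omega).
Proof. by apply: measurableX; exact: measurable_unit_ball. Qed.

Lemma measurable_fst_Omega (f : tup -> R) : measurable_fun Omega f ->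
  measurable_fun (Omega `*` Omega) (fun p => f p.1).
Proof.
move=> mf; apply: (measurable_comp (F := Omega) (g := fst)) => //; first exact: measurable_unit_ball.
  by move=> _ [p [p1 _] <-].
by apply: measurable_funTS; exact: measurable_fst.
Qed.

Lemma measurable_snd_Omega (f : tup -> R) : measurable_fun Omega f ->
  measurable_fun (Omega `*` Omega) (fun p => f p.2).
Proof.
move=> mf; apply: (measurable_comp (F := Omega) (g := snd)) => //; first exact: measurable_unit_ball.
  by move=> _ [p [_ p2] <-].
by apply: measurable_funTS; exact: measurable_snd.
Qed.

Lemma measurable_gagliardo (f : tup -> R) theta : measurable_fun Omega f ->
  measurable_fun (Omega `*` Omega)
    (fun p => (f p.1 - f p.2) ^+ 2 * pair_weight theta p).
Proof.
move=> mf; apply: measurable_funM; last by apply: measurable_funTS; exact: measurable_pair_weight.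
apply: measurable_funX; apply: measurable_funB.
  exact: measurable_fst_Omega.
exact: measurable_snd_Omega.
Qed.

Lemma lderiv_gagliardo theta : 0 <= theta ->
  0 <= 2 * k%:R + 2 * theta - 2 * alpha - N%:R / 2 ->
  (\int[mu \x mu]_(p in Omega `*` Omega)
     ((lderiv p.1 - lderiv p.2) ^+ 2 * pair_weight theta p)%:E = +oo)%E.
Proof.
move=> th0 E0.
apply: (infinite_of_linear (J0 := k.+2) (pair_constant_gt0 R n k)) => M M0.
have [omega omegaM omega_im] := nonreal_dyadic_root M0.
have omega1 := omega_normc omegaM.
pose phi (p : tup * tup) := (@rot R n omega p.1, @rot R n omega p.2).
have phiE l p : iter l phi p = (iter l (@rot R n omega) p.1, iter l (@rot R n omega) p.2).
  by elim: l => [|l IH]; [case: p | rewrite iterS IH].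
have weight l p : pair_weight theta (iter l phi p) = pair_weight theta p.
  have w1 q : pair_weight theta (phi q) = pair_weight theta q.
    by rewrite /pair_weight (enorm_rot_sub omega1 omega_im q.1 q.2).
  by elim: l => [|l IH]; [|rewrite iterS w1].
apply: (averaging_lower_bound measurable_OmegaX (phi := phi) (L := (2 ^ M.+2)%N)
  (Phi := fun J p => ak J ^+ 2 * normc (tplane p.1 ^+ mk J - tplane p.2 ^+ mk J) ^+ 2 *
    pair_weight theta p)).
- by apply: preserves_product; exact: preserves_rot.
- by apply/funext => p; rewrite /phi /preimage /= !rot_Omega.
- by apply: measurable_gagliardo; exact: measurable_lderiv.
- by move=> p _; apply: mulr_ge0 (pair_weight_ge0 _ _); exact: sqr_ge0.
- move=> J; apply: measurable_funTS; apply: measurable_funM; last first.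
    exact: measurable_pair_weight.
  by apply: measurable_funM => //; exact: measurable_pair_diff.
- by move=> J t _; apply: mulr_ge0 (pair_weight_ge0 _ _); apply: mulr_ge0; exact: sqr_ge0.
- by rewrite expn_gt0.
- move=> p [p1 p2]; rewrite -mulr_suml mulrA.
  rewrite [leRHS](eq_bigr (fun l : 'I__ => (lderiv (iter l (@rot R n omega) p.1) -
    lderiv (iter l (@rot R n omega) p.2)) ^+ 2 * pair_weight theta p)); last first.
    by move=> l _; rewrite weight phiE.
  rewrite -[leRHS]mulr_suml ler_wpM2r ?pair_weight_ge0//.
  apply: (lacunary_bessel (B := fun J => tplane p.1 ^+ mk J - tplane p.2 ^+ mk J)
    (F := fun l => lderiv (iter l (@rot R n omega) p.1) -
                   lderiv (iter l (@rot R n omega) p.2)) omegaM) => l.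
  have := cvgB (FF := eventually_filter) (lderiv_iter_rot omega1 omega_im (l := l) p1)
    (lderiv_iter_rot omega1 omega_im (l := l) p2).
  apply: cvg_trans; apply: near_eq_cvg; apply: nearW => K /=.
  rewrite -[LHS]/(_ - _) -sumrB; apply: eq_bigr => j _.
  by rewrite -mulrBr; congr (_ * _); rewrite /twist mulrBr !ReIm.
move=> J /andP[kJ _]; apply: pair_bound => //.
apply: leq_trans (leq_pexp2l _ kJ) => //.
by rewrite !expnS; have := ltn_expl k (isT : (1 < 2)%N); lia.
Qed.

End EnergyDivergence.

Section SobolevFailure.
Variables (R : realType) (alpha : R) (n : nat).
Hypotheses (alpha_gt0 : 0 < alpha) (alpha_lt1 : alpha < 1).
Local Notation N := n.+2.
Local Notation tup := (N.-tuple (measurableTypeR R)).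
Local Notation mu := (lebesgue_tuple R N).
Local Notation Omega := (tuples_of (unit_ball R N)).
Local Notation i1 := (lift ord0 ord0 : 'I_N).

Lemma ae_eq_pairs (D : set tup) (f g : tup -> R) :
  ae_eq mu D (EFin \o f) (EFin \o g) ->
  {ae (mu \x mu)%E, forall p, (D `*` D) p -> f p.1 = g p.1 /\ f p.2 = g p.2}.
Proof.
move=> [A [mA A0 DA]]; exists ((A `*` setT) `|` (setT `*` A)); split.
- by apply: measurableU; apply: measurableX.
- have l0 : (mu \x mu)%E (A `*` setT) = 0%E by rewrite product_measure1E// [X in (X * _)%E]A0 mul0e.
  have r0 : (mu \x mu)%E (setT `*` A) = 0%E by rewrite product_measure1E// [X in (_ * X)%E]A0 mule0.
  exact: (null_set_setU (mu := (mu \x mu)%E) (measurableX mA measurableT) (measurableX measurableT mA) l0 r0).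
move=> p; apply: contraPP => /not_orP[nA1 nA2]; rewrite /= notK => -[p1 p2].
split.
  by apply: contrapT => ne; apply: nA1; split=> //; apply: DA => /(_ p1)[].
by apply: contrapT => ne; apply: nA2; split=> //; apply: DA => /(_ p2)[].
Qed.

Lemma lacunary_not_Hs (hn : (1 < N)%N) (sigma : R) :
  alpha + (N%:R - 2) / 4 <= sigma ->
  ~ in_Hs (sigma + 2^-1) (unit_ball R N) (lacunary hn alpha).
Proof.
move=> sE; set s := sigma + 2^-1 => -[_ /(_ (nseq (Num.truncn s) ord0))].
rewrite size_nseq => /(_ (leqnn _)) [g [gL2 gw gG]].
set k := Num.truncn s in gw gG.
have s0 : 0 <= s by rewrite /s; have := ler0n R n; rewrite -(addn2 n) natrD in sE; have := alpha_gt0; lra.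
have ks : k%:R <= s by have /andP[] := truncn_itv s0.
have fE x : lacunary hn alpha x = psre (lcoef alpha) lexpo (plane ord0 i1 x).
  rewrite lacunaryE (_ : Ordinal (ltnW hn) = ord0); last exact: val_inj.
  by rewrite (_ : Ordinal hn = i1)//; exact: val_inj.
have gf : ae_eq mu Omega (EFin \o (g \o @row_of R N)) (EFin \o lderiv alpha k).
  exact: (weak_derivative_ae (i1 := i1) isT (lcoef_radius1 alpha_gt0) fE gL2 gw).
have mf : measurable_fun Omega (lderiv alpha k) := @measurable_lderiv R alpha n alpha_gt0 k.
have [mg gfin] := gL2.
have [theta0|theta0] := leP (s - k%:R) 0.
  have sk : s = k%:R by lra.
  have E0 : 0 <= 2 * k%:R - 2 * alpha - N%:R / 2 by rewrite -sk /s; lra.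
  have := lderiv_energy alpha_gt0 alpha_lt1 E0.
  rewrite -(@ge0_ae_eq_integral _ _ _ mu Omega (fun t => (g (row_of t) ^+ 2)%:E)).
  - by move=> gE; move: gfin; rewrite gE.
  - exact: measurable_unit_ball.
  - by apply/measurable_EFinP; exact: measurable_funX mg.
  - by apply/measurable_EFinP; exact: measurable_funX mf.
  - by move=> t _; rewrite lee_fin sqr_ge0.
  - by move=> t _; rewrite lee_fin sqr_ge0.
  by move: gf; apply: filterS => t h /h [->].
have E0 : 0 <= 2 * k%:R + 2 * (s - k%:R) - 2 * alpha - N%:R / 2 by rewrite /s; lra.
have := lderiv_gagliardo alpha_gt0 alpha_lt1 (ltW theta0) E0.
rewrite -(@ge0_ae_eq_integral _ _ _ (mu \x mu)%E (Omega `*` Omega)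
  (fun p => ((g (row_of p.1) - g (row_of p.2)) ^+ 2 * pair_weight (s - k%:R) p)%:E)).
- by move=> gE; have := gG erefl theta0; rewrite /gagliardo gE.
- exact: measurable_OmegaX.
- by apply/measurable_EFinP; exact: (measurable_gagliardo _ mg).
- by apply/measurable_EFinP; exact: (measurable_gagliardo _ mf).
- by move=> p _; rewrite lee_fin; apply: mulr_ge0 (pair_weight_ge0 _ _); exact: sqr_ge0.
- by move=> p _; rewrite lee_fin; apply: mulr_ge0 (pair_weight_ge0 _ _); exact: sqr_ge0.
by move: (ae_eq_pairs gf); apply: filterS => p h /h /= [-> ->].
Qed.

End SobolevFailure.

Theorem proposition11 (R : realType) (n : nat) (hn : (1 < n)%N) (alpha : R)
    (alpha_gt0 : 0 < alpha) (alpha_lt1 : alpha < 1) :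
  let u := lacunary hn alpha in
  harmonic_on (unit_ball R n) u /\
  holder_on alpha (closed_unit_ball R n) u /\
  (forall epsilon : R, 0 < epsilon ->
     ~ holder_on (alpha + epsilon) (closed_unit_ball R n) u) /\
  (forall sigma : R, alpha + (n%:R - 2) / 4 <= sigma ->
     ~ in_Hs (sigma + 2^-1) (unit_ball R n) u).
Proof.
move=> u; split.
  exact: (harmonic_ps (i0_neq_i1 hn) (lcoef_radius1 alpha_gt0)).
split; first exact: lacunary_holder.
split; first exact: lacunary_not_holder.
by case: n hn @u => [|[|n]] // hn u; exact: lacunary_not_Hs.
Qed.
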